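(* Let $G_0(x,\xi)=G(x,\xi;0)$ be the Green's function at $\lambda=0$ of the two-interval boundary value transmission problem described in the context, let $\lambda_0,\lambda_1,\lambda_2,\dots$ be its eigenvalues, and let $\varphi_0,\varphi_1,\varphi_2,\dots$ be the corresponding normalized eigenfunctions. Then $G_0(x,\xi)$ can be expanded into the eigenfunction series $$G_0(x,\xi)=-\sum_{n=0}^{\infty}\lambda_n^{-1}\,\varphi_n(x)\,\varphi_n(\xi),$$ which converges absolutely and uniformly on $\big([-\pi,0)\cup(0,\pi]\big)^2$.
   Context: Problem. Let $p(x)=p_1>0$ for $x\in[-\pi,0)$ and $p(x)=p_2>0$ for $x\in(0,\pi]$ ($p_1,p_2$ constants). Let $q$ be a given real-valued function, continuous on each of $[-\pi,0)$ and $(0,\pi]$, with finite one-sided limits $q(0-)$, $q(0+)$. Let $\beta^{\pm}_{ij}$ ($i=1,2$, $j=0,1$) be real numbers, and let $\alpha,\beta$ be the parameters in the boundary conditions below. For a complex parameter $\lambda$ consider the equation $$-p(x)y''(x)+q(x)y(x)=\lambda y(x)$$ on the disjoint intervals $(-\pi,0)$ and $(0,\pi)$, with boundary conditions $\cos\alpha\, y(-\pi)+\sin\alpha\, y'(-\pi)=0$ and $\cos\beta\, y(\pi)+\sin\beta\, y'(\pi)=0$, and transmission conditions $$\beta^{-}_{i1}y'(0-)+\beta^{-}_{i0}y(0-)+\beta^{+}_{i1}y'(0+)+\beta^{+}_{i0}y(0+)=0,\qquad i=1,2.$$ Here $0\pm$ denote one-sided limits at $0$. An eigenvalue is a $\lambda$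 for which this problem has a nontrivial solution (an eigenfunction). It is assumed that $\lambda=0$ is not an eigenvalue. Let $T=\begin{pmatrix}\beta^{+}_{10}&\beta^{+}_{11}&\beta^{-}_{10}&\beta^{-}_{11}\\ \beta^{+}_{20}&\beta^{+}_{21}&\beta^{-}_{20}&\beta^{-}_{21}\end{pmatrix}$ and, for $1\le i<j\le4$, let $\Delta_{ij}$ be the determinant of the $i$-th and $j$-th columns of $T$. Basic solutions. Primes denote $x$-derivatives; values at $0$ of functions given on one of the intervals are one-sided limits. $\phi_1(\cdot,\lambda)$ is the solution of the equation on $[-\pi,0)$ with $u(-\pi)=\sin\alpha$, $u'(-\pi)=-\cos\alpha$; $\phi_2(\cdot,\lambda)$ is the solution on $(0,\pi]$ with $u(0+)=\frac{1}{\Delta_{12}}\big(\Delta_{23}\phi_1(0,\lambda)+\Delta_{24}\phi_1'(0,\lambda)\big)$, $u'(0+)=\frac{-1}{\Delta_{12}}\big(\Delta_{13}\phi_1(0,\lambda)+\Delta_{14}\phi_1'(0,\lambda)\big)$. $\chi_2(\cdot,\lambda)$ is the solution on $(0,\pi]$ with $u(\pi)=-\sin\beta$, $u'(\pi)=\cos\beta$; $\chi_1(\cdot,\lambda)$ is the solution on $[-\pi,0)$ with $u(0-)=\frac{-1}{\Delta_{34}}\big(\Delta_{14}\chi_2(0,\lambda)+\Delta_{24}\chi_2'(0,\lambda)\big)$, $u'(0-)=\frac{1}{\Delta_{34}}\big(\Delta_{13}\chi_2(0,\lambda)+\Delta_{23}\chi_2'(0,\lambda)\big)$. Let $\omega_i(\lambda)=\phi_i\chi_i'-\phi_i'\chi_i$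 ($i=1,2$) be the Wronskians, which are independent of $x$. Green's function. $$G(x,\xi;\lambda)=\begin{cases} \dfrac{\phi_1(x,\lambda)\chi_1(\xi,\lambda)}{\Delta_{34}\,p_1\,\omega_1(\lambda)},& x\in[-\pi,0),\ \xi\in[-\pi,x),\\[2mm] \dfrac{\chi_1(x,\lambda)\phi_1(\xi,\lambda)}{\Delta_{34}\,p_1\,\omega_1(\lambda)},& x\in[-\pi,0),\ \xi\in[x,0),\\[2mm] \dfrac{\chi_1(x,\lambda)\phi_2(\xi,\lambda)}{\Delta_{34}\,p_1\,\omega_1(\lambda)},& x\in[-\pi,0),\ \xi\in(0,\pi],\\[2mm] \dfrac{\phi_2(x,\lambda)\chi_2(\xi,\lambda)}{\Delta_{12}\,p_2\,\omega_2(\lambda)},& x\in(0,\pi],\ \xi\in(0,x],\\[2mm] \dfrac{\chi_2(x,\lambda)\phi_2(\xi,\lambda)}{\Delta_{12}\,p_2\,\omega_2(\lambda)},& x\in(0,\pi],\ \xi\in[x,\pi],\\[2mm] \dfrac{\phi_2(x,\lambda)\chi_1(\xi,\lambda)}{\Delta_{12}\,p_2\,\omega_2(\lambda)},& x\in(0,\pi],\ \xi\in[-\pi,0). \end{cases}$$ Eigenfunctions. The problem has precisely denumerably many eigenvalues $\lambda_0,\lambda_1,\lambda_2,\dots$. The function $\phi_n(x)=\phi(x,\lambda_n)$, equal to $\phi_1(x,\lambda_n)$ on $[-\pi,0)$ and to $\phi_2(x,\lambda_n)$ on $(0,\pi]$, is an eigenfunction for $\lambda_n$, and the normalized eigenfunctions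 are $$\varphi_n(x)=\Big(\tfrac{\Delta_{34}}{p_1}\int_{-\pi}^{0}\phi_n^2(\xi)\,d\xi+\tfrac{\Delta_{12}}{p_2}\int_{0}^{\pi}\phi_n^2(\xi)\,d\xi\Big)^{-1/2}\phi_n(x).$$
   Formalization: The printed Green's function does not equal the series: in all six numerators φ and χ are exchanged and the factors p_1, p_2 are dropped from the denominators; also Δ_12 and Δ_34 are assumed to have the same sign (Δ_12Δ_34 > 0), so that the normalization is definite. *)

(* Defs.v *)
(* Stdlib reals with Coquelicot. *)
From Stdlib Require Import Reals Lra.
From Coquelicot Require Import Coquelicot.
Open Scope R_scope.

Definition left_part (x : R) : Prop := - PI <= x < 0.
Definition right_part (x : R) : Prop := 0 < x <= PI.
Definition two_intervals (x : R) : Prop := left_part x \/ right_part x.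

(* [bm i j] and [bp i j] are beta^-_{ij} and beta^+_{ij}; only i = 1, 2 and
   j = 0, 1 are ever used. *)
Record bvtp := Bvtp {
  p1 : R; p2 : R;
  q : R -> R;
  alpha : R; beta : R;
  bm : nat -> nat -> R;
  bp : nat -> nat -> R
}.

Definition pcoef (P : bvtp) (x : R) : R := if Rlt_dec x 0 then p1 P else p2 P.

Definition admissible (P : bvtp) : Prop :=
  0 < p1 P /\ 0 < p2 P /\
  continuous_on left_part (q P) /\ continuous_on right_part (q P) /\
  (exists l : R, filterlim (q P) (at_left 0) (locally l)) /\
  (exists l : R, filterlim (q P) (at_right 0) (locally l)).

Definition Tmat (P : bvtp) (i j : nat) : R :=
  match j with
  | 1%nat => bp P i 0
  | 2%nat => bp P i 1
  | 3%nat => bm P i 0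
  | _ => bm P i 1
  end.

Definition DeltaT (P : bvtp) (i j : nat) : R :=
  Tmat P 1 i * Tmat P 2 j - Tmat P 1 j * Tmat P 2 i.

(* Derivative at [x] of a complex function of a real variable, relative to
   [D]: one-sided at an endpoint belonging to [D]. *)
Definition is_derive_on (D : R -> Prop) (f : R -> C) (x : R) (l : C) : Prop :=
  filterdiff (U := R_NormedModule) (V := C_R_NormedModule)
    f (within D (locally x)) (fun h : R => @scal R_AbsRing C_R_NormedModule h l).

(* [dy] is the derivative of the solution [y]. *)
Definition is_solution (P : bvtp) (D : R -> Prop) (lam : C) (y dy : R -> C) : Prop :=
  exists ddy : R -> C, forall x : R, D x ->
    is_derive_on D y x (dy x) /\
    is_derive_on D dy x (ddy x) /\
    (- pcoef P x * ddy x + q P x * y x = lam * y x)%C.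

Definition lim0m (f : R -> C) (l : C) : Prop := filterlim f (at_left 0) (locally l).
Definition lim0p (f : R -> C) (l : C) : Prop := filterlim f (at_right 0) (locally l).

Definition is_eigenvalue (P : bvtp) (lam : C) : Prop :=
  exists y dy : R -> C,
    is_solution P left_part lam y dy /\
    is_solution P right_part lam y dy /\
    (cos (alpha P) * y (- PI)%R + sin (alpha P) * dy (- PI)%R = 0)%C /\
    (cos (beta P) * y PI + sin (beta P) * dy PI = 0)%C /\
    (exists ym dym yp dyp : C,
       lim0m y ym /\ lim0m dy dym /\ lim0p y yp /\ lim0p dy dyp /\
       forall i : nat, (i = 1%nat \/ i = 2%nat) ->
         (bm P i 1 * dym + bm P i 0 * ym + bp P i 1 * dyp + bp P i 0 * yp = 0)%C) /\
    (exists x : R, two_intervals x /\ y x <> 0%C).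

(* [phi1 lam], [chi1 lam] are meaningful on [left_part] only and [phi2 lam],
   [chi2 lam] on [right_part] only; there the initial conditions determine
   them uniquely.  [dphi1], ... are the derivatives in [x]. *)
Record basic_solutions (P : bvtp) := BasicSolutions {
  phi1 : C -> R -> C; dphi1 : C -> R -> C;
  phi2 : C -> R -> C; dphi2 : C -> R -> C;
  chi1 : C -> R -> C; dchi1 : C -> R -> C;
  chi2 : C -> R -> C; dchi2 : C -> R -> C;
  phi1_sol : forall lam : C,
    is_solution P left_part lam (phi1 lam) (dphi1 lam) /\
    phi1 lam (- PI) = sin (alpha P) /\ dphi1 lam (- PI) = (- cos (alpha P))%R;
  phi2_sol : forall lam : C,
    is_solution P right_part lam (phi2 lam) (dphi2 lam) /\
    exists u du : C,
      lim0m (phi1 lam) u /\ lim0m (dphi1 lam) du /\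
      lim0p (phi2 lam) (1 / DeltaT P 1 2 * (DeltaT P 2 3 * u + DeltaT P 2 4 * du))%C /\
      lim0p (dphi2 lam) (-1 / DeltaT P 1 2 * (DeltaT P 1 3 * u + DeltaT P 1 4 * du))%C;
  chi2_sol : forall lam : C,
    is_solution P right_part lam (chi2 lam) (dchi2 lam) /\
    chi2 lam PI = (- sin (beta P))%R /\ dchi2 lam PI = cos (beta P);
  chi1_sol : forall lam : C,
    is_solution P left_part lam (chi1 lam) (dchi1 lam) /\
    exists u du : C,
      lim0p (chi2 lam) u /\ lim0p (dchi2 lam) du /\
      lim0m (chi1 lam) (-1 / DeltaT P 3 4 * (DeltaT P 1 4 * u + DeltaT P 2 4 * du))%C /\
      lim0m (dchi1 lam) (1 / DeltaT P 3 4 * (DeltaT P 1 3 * u + DeltaT P 2 3 * du))%C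
}.

Arguments phi1 {P}. Arguments dphi1 {P}. Arguments phi2 {P}. Arguments dphi2 {P}.
Arguments chi1 {P}. Arguments dchi1 {P}. Arguments chi2 {P}. Arguments dchi2 {P}.

(* The Wronskians do not depend on the point of the respective interval; they
   are evaluated here at -PI and at PI. *)
Definition omega1 {P : bvtp} (S : basic_solutions P) (lam : C) : C :=
  (phi1 S lam (- PI)%R * dchi1 S lam (- PI)%R
   - dphi1 S lam (- PI)%R * chi1 S lam (- PI)%R)%C.
Definition omega2 {P : bvtp} (S : basic_solutions P) (lam : C) : C :=
  (phi2 S lam PI * dchi2 S lam PI - dphi2 S lam PI * chi2 S lam PI)%C.

(* phi satisfies the condition at -PI and chi the one at PI, so phi carries the
   smaller of the two arguments.  The source prints the two letters exchanged in
   all six numerators and has extra factors p1, p2 in the denominators.  Neither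
   can stand: a jump of the x-derivative across x = xi of phi1 chi1 / (Delta_34
   omega1) equal to 1 / Delta_34 is what the weights Delta_34 / p1 and
   Delta_12 / p2 of [norm2] below dictate, and with p1, p2 included G is not even
   symmetric (recall Delta_12 omega2 = Delta_34 omega1) unless p1 = p2, whereas
   the bilinear eigenfunction series is. *)
Definition Green {P : bvtp} (S : basic_solutions P) (lam : C) (x xi : R) : C :=
  if Rlt_dec x 0 then
    (if Rlt_dec xi 0 then
       if Rlt_dec xi x then chi1 S lam x * phi1 S lam xi
       else phi1 S lam x * chi1 S lam xi
     else phi1 S lam x * chi2 S lam xi) / (DeltaT P 3 4 * omega1 S lam)
  else
    (if Rlt_dec xi 0 then chi2 S lam x * phi1 S lam xi
     else if Rle_dec xi x then chi2 S lam x * phi2 S lam xi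
     else phi2 S lam x * chi2 S lam xi) / (DeltaT P 1 2 * omega2 S lam).

Definition phi {P : bvtp} (S : basic_solutions P) (lam : C) (x : R) : C :=
  if Rlt_dec x 0 then phi1 S lam x else phi2 S lam x.

(* Principal square root: the one in the closed right half-plane, with
   nonnegative imaginary part on the negative real axis. *)
Definition Csqrt (z : C) : C :=
  (sqrt ((Cmod z + Re z) / 2),
   (if Rlt_dec (Im z) 0 then -1 else 1) * sqrt ((Cmod z - Re z) / 2)).

(* The values of [phi S lam] outside [two_intervals] do not affect these integrals. *)
Definition norm2 {P : bvtp} (S : basic_solutions P) (lam : C) : C :=
  ((DeltaT P 3 4 / p1 P)%R *
     RInt (V := C_R_CompleteNormedModule)
       (fun t : R => (phi S lam t * phi S lam t)%C) (- PI) 0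
   + (DeltaT P 1 2 / p2 P)%R *
     RInt (V := C_R_CompleteNormedModule)
       (fun t : R => (phi S lam t * phi S lam t)%C) 0 PI)%C.

Definition normalized_phi {P : bvtp} (S : basic_solutions P) (lam : C) (x : R) : C :=
  (/ Csqrt (norm2 S lam) * phi S lam x)%C.

Definition eigen_term {P : bvtp} (S : basic_solutions P) (lam : nat -> C)
    (x xi : R) (n : nat) : C :=
  (/ lam n * normalized_phi S (lam n) x * normalized_phi S (lam n) xi)%C.

(* Main.v *)
(* The negative of Green's function at 0, multiplied by the common sign of Delta_12 and
   Delta_34, is the kernel K of the inverse of a symmetric operator L on a weighted L^2 space
   over the two intervals.

   The Dirichlet form gives, for every d > 0, a constant C with
   u(x)^2 <= d <L u, u> + C |u|^2 for all u in the domain and all x.  Applied to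
   u = sum_n e_n(x) / (d lam_n + C) e_n, where the e_n are the normalised eigenfunctions, it
   yields sum_n e_n(x)^2 / (d lam_n + C) <= 1.  Integrating in x gives lam_n -> +oo, so for
   small d the tails of sum_n e_n(x)^2 / |lam_n| are uniformly small, and the bilinear series
   converges absolutely and uniformly to some symmetric kernel S.

   The difference K - S annihilates every e_n.  A nonzero symmetric continuous kernel has an
   eigenfunction with nonzero eigenvalue; for K - S it would be orthogonal to all e_n, hence
   also an eigenfunction of K and of the boundary value problem, and so a multiple of some
   e_n, which is absurd.  So S = K. *)

(* The kernel theory is carried out over an abstract [ispace], closed under just the operations that
   iterated kernels and bilinear series call for. Operator theory is avoided: the eigenfunction of a
   symmetric kernel is read off from the traces of its iterates, whose growth is governed by two
   Cauchy-Schwarz inequalities.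

   The data of the problem are complex and live on half-open intervals. Symmetry forces the
   eigenvalues to be real, uniqueness for the initial value problem kills the imaginary parts of the
   basic solutions at real parameters, and the one-sided limits at 0 close the intervals; from there
   on everything is real.

   The symmetry of L rests on a Pluecker relation: the matrix carrying the values at 0- to those at
   0+ has determinant Delta_34 / Delta_12, which the weights compensate. They are positive only
   after multiplication by the common sign of the two determinants. If that sign is -1, [norm2] is
   negative and the normalised eigenfunctions are purely imaginary, but each term of the series
   contains two of them, so only a sign survives; Green's function carries the same one. *)
Require Import Defs.
From Stdlib Require Import Reals Arith Lra Lia FunctionalExtensionality Classical ClassicalEpsilon.
From Coquelicot Require Import Coquelicot.
Open Scope R_scope.

(** * Symmetric kernels on an integration space *)

(** A model is a compact space with a finite measure of full support: [intg_eq0] expresses full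
    support, and [ckern_lim] closure under uniform limits. It asks for a single good index per
    [eps], which is all that the usual argument consumes. *)
Record ispace := ISpace {
  pt :> Type;
  intg : (pt -> R) -> R;
  cfun : (pt -> R) -> Prop;
  ckern : (pt -> pt -> R) -> Prop;
  cfun_const : forall c, cfun (fun _ => c);
  cfun_plus : forall f g, cfun f -> cfun g -> cfun (fun x => f x + g x);
  cfun_mult : forall f g, cfun f -> cfun g -> cfun (fun x => f x * g x);
  cfun_bounded : forall f, cfun f -> exists M, forall x, Rabs (f x) <= M;
  ckern_row : forall k x, ckern k -> cfun (k x);
  ckern_diag : forall k, ckern k -> cfun (fun x => k x x);
  ckern_swap : forall k, ckern k -> ckern (fun x y => k y x);
  ckern_fst : forall f, cfun f -> ckern (fun x _ => f x);
  ckern_plus : forall k l, ckern k -> ckern l -> ckern (fun x y => k x y + l x y);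
  ckern_mult : forall k l, ckern k -> ckern l -> ckern (fun x y => k x y * l x y);
  ckern_comp : forall k l, ckern k -> ckern l -> ckern (fun x y => intg (fun z => k x z * l z y));
  ckern_lim : forall (k : nat -> pt -> pt -> R) l, (forall n, ckern (k n)) ->
    (forall eps, 0 < eps -> exists n, forall x y, Rabs (k n x y - l x y) < eps) -> ckern l;
  intg_plus : forall f g, cfun f -> cfun g -> intg (fun x => f x + g x) = intg f + intg g;
  intg_scal : forall c f, cfun f -> intg (fun x => c * f x) = c * intg f;
  intg_ge0 : forall f, cfun f -> (forall x, 0 <= f x) -> 0 <= intg f;
  intg_eq0 : forall f, cfun f -> (forall x, 0 <= f x) -> intg f = 0 -> forall x, f x = 0;
  intg_fubini : forall k, ckern k ->
    intg (fun x => intg (fun y => k x y)) = intg (fun y => intg (fun x => k x y))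
}.

Arguments intg {i}. Arguments cfun {i}. Arguments ckern {i}.

Section IntegrationSpace.
Variable X : ispace.
Implicit Types (f g : X -> R) (k l : X -> X -> R).

Lemma cfun_ext f g : (forall x, f x = g x) -> cfun f -> cfun g.
Proof. intros H; replace g with f; [trivial|]; now apply functional_extensionality. Qed.

Lemma ckern_ext k l : (forall x y, k x y = l x y) -> ckern k -> ckern l.
Proof.
  intros H; replace l with k; [trivial|].
  apply functional_extensionality; intro x; apply functional_extensionality; intro y; auto.
Qed.

Lemma intg_ext f g : (forall x, f x = g x) -> intg f = intg g.
Proof. intros H; f_equal; now apply functional_extensionality. Qed.

Lemma cfun_scal c f : cfun f -> cfun (fun x => c * f x).
Proof. intros; apply cfun_mult; auto using cfun_const. Qed.

Lemma cfun_minus f g : cfun f -> cfun g -> cfun (fun x => f x - g x).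
Proof.
  intros Hf Hg; apply cfun_ext with (fun x => f x + (-1) * g x); [intros; ring|].
  auto using cfun_plus, cfun_scal.
Qed.

Lemma ckern_const c : ckern (fun _ _ : X => c).
Proof. apply (ckern_fst X (fun _ => c)), cfun_const. Qed.

Lemma ckern_snd f : cfun f -> ckern (fun _ y => f y).
Proof. intros; apply (ckern_swap X (fun x _ => f x)); now apply ckern_fst. Qed.

Lemma ckern_scal c k : ckern k -> ckern (fun x y => c * k x y).
Proof. intros; apply ckern_mult; auto using ckern_const. Qed.

Lemma ckern_minus k l : ckern k -> ckern l -> ckern (fun x y => k x y - l x y).
Proof.
  intros Hf Hg; apply ckern_ext with (fun x y => k x y + (-1) * l x y); [intros; ring|].
  auto using ckern_plus, ckern_scal.
Qed.

Lemma ckern_col k y : ckern k -> cfun (fun x => k x y).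
Proof. intros H; exact (ckern_row X _ y (ckern_swap X _ H)). Qed.

(** Composing with the constant kernel 1 gives a kernel that depends on its first variable only; its
    diagonal is the marginal. *)
Lemma cfun_intg_row k : ckern k -> cfun (fun x => intg (k x)).
Proof.
  intros H.
  apply cfun_ext with (fun x => intg (fun z => k x z * 1)).
  { intro x; apply intg_ext; intro; ring. }
  apply (ckern_diag X (fun x y => intg (fun z => k x z * 1))).
  apply (ckern_comp X k (fun _ _ => 1)); auto using ckern_const.
Qed.

Lemma intg_0 : intg (fun _ : X => 0) = 0.
Proof.
  rewrite (intg_ext _ (fun _ => 0 * 0)) by (intros; ring).
  rewrite (intg_scal X 0 (fun _ => 0)) by apply cfun_const; ring.
Qed.

Lemma intg_minus f g : cfun f -> cfun g -> intg (fun x => f x - g x) = intg f - intg g.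
Proof.
  intros Hf Hg; rewrite (intg_ext _ (fun x => f x + (-1) * g x)) by (intros; ring).
  rewrite intg_plus, intg_scal; auto using cfun_scal; ring.
Qed.

Lemma intg_le f g : cfun f -> cfun g -> (forall x, f x <= g x) -> intg f <= intg g.
Proof.
  intros Hf Hg H.
  cut (0 <= intg (fun x => g x - f x)); [rewrite intg_minus; auto; lra|].
  apply intg_ge0; [auto using cfun_minus|]; intro x; specialize (H x); lra.
Qed.

Lemma Rabs_intg_le f c : cfun f -> (forall x, Rabs (f x) <= c) ->
  Rabs (intg f) <= c * intg (fun _ : X => 1).
Proof.
  intros Hf H; rewrite <- intg_scal by apply cfun_const.
  apply Rabs_le; split.
  - replace (- intg (fun _ => c * 1)) with (intg (fun _ : X => (-1) * (c * 1))).
    + apply intg_le; auto using cfun_const. intro x; specialize (H x); apply Rabs_le_between in H; lra.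
    + rewrite (intg_scal X (-1) (fun _ => c * 1)) by apply cfun_const; ring.
  - apply intg_le; auto using cfun_const. intro x; specialize (H x); apply Rabs_le_between in H; lra.
Qed.

Lemma intg_cauchy_schwarz f g : cfun f -> cfun g ->
  (intg (fun x => f x * g x))² <= intg (fun x => (f x)²) * intg (fun x => (g x)²).
Proof.
  intros Hf Hg.
  set (P := intg (fun x => f x * g x)); set (F := intg (fun x => (f x)²));
  set (G := intg (fun x => (g x)²)).
  assert (HQ : forall s, 0 <= F - 2 * s * P + s * s * G).
  { intro s.
    replace (F - 2 * s * P + s * s * G) with (intg (fun x => (f x - s * g x)²)).
    - apply intg_ge0; [|intro; apply Rle_0_sqr].
      unfold Rsqr; apply cfun_mult; auto using cfun_minus, cfun_scal.
    - unfold F, P, G.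
      rewrite <- (intg_scal X (2 * s)), <- (intg_scal X (s * s)) by (unfold Rsqr; auto using cfun_mult).
      rewrite <- intg_minus, <- intg_plus by (unfold Rsqr; auto using cfun_mult, cfun_scal, cfun_minus).
      apply intg_ext; intro; unfold Rsqr; ring. }
  assert (HG : 0 <= G).
  { apply intg_ge0; [unfold Rsqr; auto using cfun_mult|intro; apply Rle_0_sqr]. }
  destruct (Req_dec G 0) as [E|E].
  - assert (forall x, g x = 0).
    { intro x; apply Rsqr_eq_0; revert x; apply intg_eq0; auto.
      unfold Rsqr; auto using cfun_mult. intro; apply Rle_0_sqr. }
    assert (P = 0) as ->.
    { rewrite <- intg_0; apply intg_ext; intro x; rewrite H; ring. }
    rewrite E; unfold Rsqr; lra.
  (* The minimiser of the quadratic in [s]. *)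
  - specialize (HQ (P / G)).
    replace (F - 2 * (P / G) * P + P / G * (P / G) * G) with ((F * G - P * P) / G) in HQ by (now field).
    assert (0 < G) by lra.
    assert (0 <= F * G - P * P).
    { apply (Rmult_le_reg_r (/ G)); [now apply Rinv_0_lt_compat|]. rewrite Rmult_0_l; exact HQ. }
    unfold Rsqr; lra.
Qed.

(** * Composition, powers and traces of kernels *)

Definition kcomp k l x y : R := intg (fun z => k x z * l z y).

Lemma kcomp_assoc a b c : ckern a -> ckern b -> ckern c ->
  forall x y, kcomp (kcomp a b) c x y = kcomp a (kcomp b c) x y.
Proof.
  intros Ha Hb Hc x y; unfold kcomp.
  rewrite (intg_ext _ (fun z => intg (fun z' => a x z' * b z' z * c z y))).
  2: { intro z; rewrite Rmult_comm, <- intg_scal by (apply cfun_mult; [now apply ckern_row|now apply ckern_col]).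
       apply intg_ext; intro; ring. }
  rewrite (intg_fubini X (fun z z' => a x z' * b z' z * c z y)).
  2: { apply ckern_mult; [apply ckern_mult|].
       - apply ckern_snd; now apply ckern_row.
       - now apply ckern_swap.
       - apply (ckern_fst X (fun z => c z y)); now apply ckern_col. }
  apply intg_ext; intro z'.
  rewrite <- intg_scal by (apply cfun_mult; [now apply ckern_row|now apply ckern_col]).
  apply intg_ext; intro; ring.
Qed.

(* [kpow r j] is the (j+1)-st power. *)
Fixpoint kpow k (n : nat) : X -> X -> R :=
  match n with O => k | S m => kcomp k (kpow k m) end.

Section SymmetricKernel.
Variable r : X -> X -> R.
Hypothesis r_ckern : ckern r.
Hypothesis r_sym : forall x y, r x y = r y x.

Lemma ckern_kpow n : ckern (kpow r n).
Proof. induction n; simpl; auto; now apply ckern_comp. Qed.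

(** The exponents j + 1 and n + 1 add up to j + n + 2, which has index j + n + 1. *)
Lemma kpow_add j n x y : kpow r (j + n + 1) x y = kcomp (kpow r j) (kpow r n) x y.
Proof.
  revert x y; induction j as [|j IH]; intros x y.
  - replace (0 + n + 1)%nat with (S n) by lia; reflexivity.
  - simpl kpow at 2. rewrite kcomp_assoc; auto using ckern_kpow.
    replace (S j + n + 1)%nat with (S (j + n + 1)) by lia; simpl.
    apply intg_ext; intro z; now rewrite IH.
Qed.

Lemma kpow_sym n x y : kpow r n x y = kpow r n y x.
Proof.
  revert x y; induction n as [|n IH]; intros x y; [apply r_sym|].
  simpl; unfold kcomp at 1.
  rewrite (intg_ext _ (fun z => kpow r n y z * r z x)).
  2: { intro z; rewrite (r_sym x z), (IH z y); ring. }
  change (kcomp (kpow r n) (kpow r 0) y x = kcomp r (kpow r n) y x).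
  rewrite <- kpow_add; replace (n + 0 + 1)%nat with (S n) by lia; reflexivity.
Qed.

(** The trace of the power 2n + 2, that is, the squared Hilbert-Schmidt norm of the power n + 1.
    Only even powers are traced, so the values are nonnegative. *)
Definition ktrace n : R := intg (fun x => kpow r (2 * n + 1) x x).

Lemma kpow_diag j n x : kpow r (j + n + 1) x x = intg (fun z => kpow r j x z * kpow r n x z).
Proof. rewrite kpow_add; apply intg_ext; intro z; now rewrite (kpow_sym n z x). Qed.

Lemma kpow_diag_sq n x : kpow r (2 * n + 1) x x = intg (fun z => (kpow r n x z)²).
Proof. replace (2 * n + 1)%nat with (n + n + 1)%nat by lia; now rewrite kpow_diag. Qed.

Lemma cfun_kpow_diag n : cfun (fun x => kpow r n x x).
Proof. apply ckern_diag, ckern_kpow. Qed.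

Lemma cfun_kpow_row n x : cfun (fun z => kpow r n x z).
Proof. apply (ckern_row X), ckern_kpow. Qed.

Lemma kpow_diag_ge0 n x : 0 <= kpow r (2 * n + 1) x x.
Proof.
  rewrite kpow_diag_sq; apply intg_ge0; [|intro; apply Rle_0_sqr].
  unfold Rsqr; auto using cfun_mult, cfun_kpow_row.
Qed.

Lemma ktrace_ge0 n : 0 <= ktrace n.
Proof. apply intg_ge0; [apply cfun_kpow_diag|intro; apply kpow_diag_ge0]. Qed.

(** Full support is used twice: on the diagonal of the even power, and then on each row of the
    square. *)
Lemma ktrace_eq0 n : ktrace n = 0 -> forall x y, kpow r n x y = 0.
Proof.
  intros H x.
  assert (E : kpow r (2 * n + 1) x x = 0).
  { revert x; apply intg_eq0; auto. apply cfun_kpow_diag. intro; apply kpow_diag_ge0. }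
  rewrite kpow_diag_sq in E.
  intro y; apply Rsqr_eq_0; revert y; apply intg_eq0; auto.
  - unfold Rsqr; auto using cfun_mult, cfun_kpow_row.
  - intro; apply Rle_0_sqr.
Qed.

(** The weighted inequality 2ab <= s a^2 + b^2 / s, integrated for the rows of the powers n + 1 and
    n + 3. The weight stays free until the trace has been taken. *)
Lemma kpow_diag_mean n s x : 0 < s ->
  kpow r (2 * (n + 1) + 1) x x <=
  / 2 * (s * kpow r (2 * n + 1) x x + / s * kpow r (2 * (n + 2) + 1) x x).
Proof.
  intro Hs.
  replace (2 * (n + 1) + 1)%nat with (n + (n + 2) + 1)%nat by lia.
  rewrite kpow_diag, 2!kpow_diag_sq.
  assert (H1 := cfun_kpow_row n x). assert (H2 := cfun_kpow_row (n + 2) x).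
  rewrite <- 2!intg_scal, <- intg_plus, <- intg_scal
    by (unfold Rsqr; auto using cfun_mult, cfun_scal, cfun_plus).
  apply intg_le; [auto using cfun_mult|unfold Rsqr; auto using cfun_mult, cfun_scal, cfun_plus|].
  intro z; set (a := kpow r n x z); set (b := kpow r (n + 2) x z).
  assert (0 <= / s * (s * a - b)²).
  { apply Rmult_le_pos; [left; now apply Rinv_0_lt_compat|apply Rle_0_sqr]. }
  replace (/ s * (s * a - b)²) with (s * a² + / s * b² - 2 * (a * b)) in H
    by (unfold Rsqr; field; lra).
  lra.
Qed.

Lemma ktrace_log_convex n : (ktrace (n + 1))² <= ktrace n * ktrace (n + 2).
Proof.
  set (a := ktrace n); set (b := ktrace (n + 1)); set (c := ktrace (n + 2)).
  assert (H : forall s, 0 < s -> b <= / 2 * (s * a + / s * c)).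
  { intros s Hs; unfold a, b, c, ktrace.
    rewrite <- 2!intg_scal, <- intg_plus, <- intg_scal
      by (auto using cfun_kpow_diag, cfun_scal, cfun_plus).
    apply intg_le; auto using cfun_kpow_diag, cfun_scal, cfun_plus.
    intro x; now apply kpow_diag_mean. }
  assert (Ha : 0 <= a) by apply ktrace_ge0.
  assert (Hb : 0 <= b) by apply ktrace_ge0.
  assert (Hc : 0 <= c) by apply ktrace_ge0.
  destruct (Req_dec a 0) as [Ea|Ea].
  { assert (b = 0) as ->; [|unfold Rsqr; rewrite Ea; lra].
    unfold b, ktrace; rewrite <- intg_0; apply intg_ext; intro x.
    replace (2 * (n + 1) + 1)%nat with (n + (n + 2) + 1)%nat by lia.
    rewrite kpow_diag, <- intg_0; apply intg_ext; intro z.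
    rewrite (ktrace_eq0 n Ea); ring. }
  destruct (Req_dec b 0) as [Eb|Eb].
  { rewrite Eb; unfold Rsqr; nra. }
  (* With this weight s a = b, so half of b is absorbed and b^2 <= a c remains, without the square
     root of the optimal weight. *)
  assert (Hs : 0 < b / a) by (apply Rdiv_lt_0_compat; lra).
  specialize (H _ Hs).
  replace (/ 2 * (b / a * a + / (b / a) * c)) with (/ 2 * (b + a * c / b)) in H by (now field).
  assert (Hx : b <= a * c / b) by lra.
  apply (Rmult_le_compat_r b) in Hx; [|lra].
  replace (a * c / b * b) with (a * c) in Hx by (now field).
  exact Hx.
Qed.

(** Submultiplicativity of the Hilbert-Schmidt norm: Cauchy-Schwarz bounds each squared entry of the
    composition by a product of two diagonal values. *)
Lemma ktrace_submult j n : ktrace (j + n + 1) <= ktrace j * ktrace n.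
Proof.
  unfold ktrace at 1.
  rewrite Rmult_comm; unfold ktrace at 2; rewrite <- intg_scal by apply cfun_kpow_diag.
  apply intg_le; auto using cfun_kpow_diag, cfun_scal.
  intro x; rewrite kpow_diag_sq.
  rewrite (Rmult_comm (ktrace n)); unfold ktrace; rewrite <- intg_scal by apply cfun_kpow_diag.
  apply intg_le; [unfold Rsqr; auto using cfun_mult, cfun_kpow_row|auto using cfun_kpow_diag, cfun_scal|].
  intro z; rewrite kpow_add; unfold kcomp.
  rewrite (intg_ext _ (fun y => kpow r j x y * kpow r n z y)).
  2: { intro y; now rewrite (kpow_sym n y z). }
  rewrite 2!kpow_diag_sq; apply intg_cauchy_schwarz; apply cfun_kpow_row.
Qed.

End SymmetricKernel.
End IntegrationSpace.

(** * Growth rate of a log-convex, submultiplicative sequence *)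

Lemma is_lim_seq_pow_const u l p : is_lim_seq u (Finite l) -> is_lim_seq (fun n => u n ^ p) (Finite (l ^ p)).
Proof.
  intro H; induction p as [|p IH]; simpl; [apply is_lim_seq_const|].
  now apply is_lim_seq_mult'.
Qed.

(* The rate [rho] is the limit of the increasing ratios [t (n+1) / t n]. *)
Lemma log_convex_submult_rate (t : nat -> R) : 0 < t 0%nat -> 0 < t 1%nat ->
  (forall n, 0 <= t n) ->
  (forall n, (t (n + 1)%nat)² <= t n * t (n + 2)%nat) ->
  (forall j n, t (j + n + 1)%nat <= t j * t n) ->
  exists rho, 0 < rho /\
    (forall n, 1 <= t n / rho ^ (n + 1)) /\
    (exists L, is_lim_seq (fun n => t n / rho ^ (n + 1)) (Finite L)).
Proof.
  intros H0 H1 Hge Hcvx Hsub.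
  assert (Hpos : forall n, 0 < t n).
  (* Log-convexity propagates positivity: a zero at n + 2 would force one at n + 1. *)
  { cut (forall n, 0 < t n /\ 0 < t (n + 1)%nat); [intros H n; apply H|].
    induction n as [|n [IH1 IH2]]; [split; assumption|].
    replace (S n) with (n + 1)%nat by lia; split; [assumption|].
    replace (n + 1 + 1)%nat with (n + 2)%nat by lia.
    specialize (Hcvx n); specialize (Hge (n + 2)%nat); unfold Rsqr in Hcvx.
    destruct Hge as [G|G]; [exact G|]. rewrite <- G in Hcvx. nra. }
  set (q := fun n => t (n + 1)%nat / t n).
  assert (Hq : forall n, 0 < q n) by (intro; apply Rdiv_lt_0_compat; auto).
  assert (Hinc : forall n, q n <= q (S n)).
  { intro n; unfold q; replace (S n + 1)%nat with (n + 2)%nat by lia.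
    replace (S n) with (n + 1)%nat by lia.
    apply (Rmult_le_reg_r (t n * t (n + 1)%nat)); [apply Rmult_lt_0_compat; auto|].
    specialize (Hcvx n); unfold Rsqr in Hcvx.
    assert (A := Hpos n). assert (B := Hpos (n + 1)%nat).
    replace (t (n + 1)%nat / t n * (t n * t (n + 1)%nat)) with (t (n + 1)%nat * t (n + 1)%nat) by (field; lra).
    replace (t (n + 2)%nat / t (n + 1)%nat * (t n * t (n + 1)%nat)) with (t n * t (n + 2)%nat) by (field; lra).
    exact Hcvx. }
  (* Submultiplicativity with j = 0 bounds the ratios, so they converge. *)
  assert (Hbd : forall n, q n <= t 0%nat).
  { intro n; unfold q; apply (Rmult_le_reg_r (t n)); auto.
    unfold Rdiv; rewrite Rmult_assoc, Rinv_l, Rmult_1_r by (apply Rgt_not_eq, Hpos).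
    exact (Hsub 0%nat n). }
  destruct (ex_finite_lim_seq_incr q (t 0%nat) Hinc Hbd) as [rho Hrho].
  assert (Hle : forall n, q n <= rho) by (apply is_lim_seq_incr_compare; auto).
  assert (Hr : 0 < rho) by (apply Rlt_le_trans with (q 0%nat); auto).
  exists rho; split; [exact Hr|].
  assert (Hstep : forall n, t (S n) <= rho * t n).
  { intro n; specialize (Hle n); unfold q in Hle.
    apply (Rmult_le_compat_r (t n)) in Hle; [|auto].
    replace (t (n + 1)%nat / t n * t n) with (t (S n)) in Hle; [exact Hle|].
    replace (n + 1)%nat with (S n) by lia. field. apply Rgt_not_eq, Hpos. }
  assert (Hpw : forall n, 0 < rho ^ n) by (intro; now apply pow_lt).
  assert (Hone : forall n, 1 <= t n / rho ^ (n + 1)).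
  { intro k.
    assert (Hk : rho ^ (k + 1) <= t k).
    (* Increasing ratios give q_J^(k+1) t_J <= t_(J+k+1), and submultiplicativity bounds this by t_k
       t_J. Cancel t_J and let J tend to infinity. *)
    { apply (is_lim_seq_le (fun J => q J ^ (k + 1)) (fun _ => t k) (Finite (rho ^ (k + 1))) (Finite (t k))).
      - intro J.
        assert (Hm : forall p, q J ^ p * t J <= t (J + p)%nat).
        { assert (Hmon : forall p, q J <= q (J + p)%nat).
          { induction p; [rewrite Nat.add_0_r; lra|].
            replace (J + S p)%nat with (S (J + p)) by lia. eapply Rle_trans; [exact IHp|apply Hinc]. }
          induction p as [|p IH]; simpl; [rewrite Nat.add_0_r; lra|].
          specialize (Hmon p). unfold q in Hmon at 2.
          apply (Rmult_le_compat_r (t (J + p)%nat)) in Hmon; [|auto].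
          replace (t (J + p + 1)%nat / t (J + p)%nat * t (J + p)%nat) with (t (J + S p)%nat) in Hmon.
          - eapply Rle_trans; [|exact Hmon]. rewrite Rmult_assoc.
            apply Rmult_le_compat_l; [left; auto|exact IH].
          - replace (J + p + 1)%nat with (J + S p)%nat by lia. field. apply Rgt_not_eq, Hpos. }
        apply (Rmult_le_reg_r (t J)); auto.
        eapply Rle_trans; [apply Hm|].
        replace (J + (k + 1))%nat with (k + J + 1)%nat by lia. apply Hsub.
      - now apply is_lim_seq_pow_const.
      - apply is_lim_seq_const. }
    apply (Rmult_le_reg_r (rho ^ (k + 1))); auto.
    unfold Rdiv; rewrite Rmult_assoc, Rinv_l, Rmult_1_r, Rmult_1_l by (apply Rgt_not_eq, Hpw).
    exact Hk. }
  split; [exact Hone|].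
  (* All ratios are at most [rho], so the normalised sequence decreases; it is bounded below by
     1. *)
  destruct (ex_finite_lim_seq_decr (fun n => t n / rho ^ (n + 1)) 1) as [L HL].
  - intro n. apply (Rmult_le_reg_r (rho ^ (S n + 1))); auto.
    replace (t (S n) / rho ^ (S n + 1) * rho ^ (S n + 1)) with (t (S n)) by (field; apply Rgt_not_eq, Hpw).
    replace (t n / rho ^ (n + 1) * rho ^ (S n + 1)) with (rho * t n); [apply Hstep|].
    replace (S n + 1)%nat with (S (n + 1)) by lia; simpl. field. apply Rgt_not_eq, Hpw.
  - exact Hone.
  - now exists L.
Qed.

(** * Existence of an eigenfunction of a nonzero symmetric kernel *)

Section Eigenfunction.
Variable X : ispace.
Variable r : X -> X -> R.
Hypothesis r_ckern : ckern r.
Hypothesis r_sym : forall x y, r x y = r y x.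

Let p := kpow X r.
Let pC2 := ckern_kpow X r r_ckern.

(* Two Cauchy-Schwarz estimates: composing with [r] on both sides turns
   Hilbert-Schmidt convergence into uniform convergence. *)
Lemma kcomp_sandwich_sq (e : X -> X -> R) x y : ckern e ->
  (kcomp X r (kcomp X e r) x y)² <=
  p 1 x x * p 1 y y * intg (fun z => intg (fun w => (e z w)²)).
Proof.
  intros He.
  assert (HD : forall v, p 1 v v = intg (fun z => (r v z)²)).
  { intro v; apply (kpow_diag_sq X r r_ckern r_sym 0). }
  assert (HeR : ckern (kcomp X e r)) by now apply ckern_comp.
  assert (He2 : ckern (fun z w => (e z w)²)) by (unfold Rsqr; now apply ckern_mult).
  eapply Rle_trans; [apply intg_cauchy_schwarz; [now apply ckern_row|now apply ckern_col]|].
  rewrite <- HD, Rmult_assoc.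
  apply Rmult_le_compat_l; [apply (kpow_diag_ge0 X r r_ckern r_sym 0)|].
  rewrite <- intg_scal by now apply cfun_intg_row.
  apply intg_le; [unfold Rsqr; apply cfun_mult; now apply ckern_col|apply cfun_scal; now apply cfun_intg_row|].
  intro z; rewrite HD, Rmult_comm; unfold kcomp.
  rewrite (intg_ext X _ (fun w => e z w * r y w)).
  2: { intro w; now rewrite (r_sym w y). }
  apply intg_cauchy_schwarz; now apply ckern_row.
Qed.

Lemma intg_pow_mult k l : intg (fun z => intg (fun w => p (2 * k + 1) z w * p (2 * l + 1) z w))
  = ktrace X r (k + l + 1).
Proof.
  unfold ktrace; apply intg_ext; intro z; unfold p.
  rewrite <- kpow_diag by assumption. f_equal; lia.
Qed.

(** Expanding the square leaves nothing but traces, so convergence of the normalised traces alone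
    makes the normalised iterates Cauchy in the Hilbert-Schmidt norm. *)
Lemma hs_distance k l (a b : R) :
  intg (fun z => intg (fun w => (a * p (2 * k + 1) z w - b * p (2 * l + 1) z w)²)) =
  a * a * ktrace X r (2 * k + 1) + b * b * ktrace X r (2 * l + 1)
    - 2 * a * b * ktrace X r (k + l + 1).
Proof.
  assert (Hd : forall i, ktrace X r (2 * i + 1) =
    intg (fun z => intg (fun w => p (2 * i + 1) z w * p (2 * i + 1) z w))).
  { intro i; rewrite intg_pow_mult; f_equal; lia. }
  rewrite 2!Hd, <- intg_pow_mult.
  assert (HCC : forall i j, ckern (fun z w => p (2 * i + 1) z w * p (2 * j + 1) z w)).
  { intros i j; apply ckern_mult; apply pC2. }
  assert (Hrow : forall i j, cfun (fun z : X => intg (fun w : X => p (2 * i + 1) z w * p (2 * j + 1) z w))).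
  { intros; apply (cfun_intg_row X (fun z w => p (2 * i + 1) z w * p (2 * j + 1) z w)); auto. }
  rewrite <- 3!intg_scal, <- intg_plus, <- intg_minus by auto using cfun_plus, cfun_scal.
  apply intg_ext; intro z.
  assert (HC3 : forall i j, cfun (fun w => p (2 * i + 1) z w * p (2 * j + 1) z w)).
  { intros; apply (ckern_row X (fun z w => p (2 * i + 1) z w * p (2 * j + 1) z w)); auto. }
  rewrite <- 3!intg_scal, <- intg_plus, <- intg_minus by auto using cfun_plus, cfun_scal.
  apply intg_ext; intro w; unfold Rsqr; ring.
Qed.

(** If the second trace were zero, r o r would vanish identically; but the integral of its diagonal
    is the first trace. *)
Lemma ktrace_pos : (exists x y, r x y <> 0) -> 0 < ktrace X r 0 /\ 0 < ktrace X r 1.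
Proof.
  intros [x [y Hxy]].
  assert (H0 : 0 < ktrace X r 0).
  { destruct (ktrace_ge0 X r r_ckern r_sym 0) as [H|H]; [exact H|].
    symmetry in H. now destruct Hxy; apply (ktrace_eq0 X r r_ckern r_sym 0). }
  split; [exact H0|].
  destruct (ktrace_ge0 X r r_ckern r_sym 1) as [H|H]; [exact H|].
  symmetry in H. assert (H1 := ktrace_eq0 X r r_ckern r_sym 1 H).
  unfold ktrace in H0; simpl Nat.mul in H0; simpl Nat.add in H0.
  rewrite (intg_ext X _ (fun _ => 0)) in H0 by (intro; apply H1).
  rewrite intg_0 in H0; lra.
Qed.

Lemma uniform_cauchy_limit (k : nat -> X -> X -> R) : (forall n, ckern (k n)) ->
  (forall eps, 0 < eps -> exists N, forall n m, (N <= n)%nat -> (N <= m)%nat ->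
     forall x y, Rabs (k n x y - k m x y) < eps) ->
  exists l, ckern l /\ forall eps, 0 < eps -> exists N, forall n, (N <= n)%nat ->
     forall x y, Rabs (k n x y - l x y) < eps.
Proof.
  intros HC HU.
  set (l := fun x y => real (Lim_seq (fun n => k n x y))).
  assert (Hl : forall x y, is_lim_seq (fun n => k n x y) (Finite (l x y))).
  { intros x y; apply Lim_seq_correct', ex_lim_seq_cauchy_corr.
    intros eps; destruct (HU eps (cond_pos eps)) as [N HN].
    exists N; intros; now apply HN. }
  assert (HL : forall eps, 0 < eps -> exists N, forall n, (N <= n)%nat ->
     forall x y, Rabs (k n x y - l x y) < eps).
  (* Letting m tend to infinity in the Cauchy estimate costs strictness, hence eps / 2. *)
  { intros eps He; destruct (HU (eps / 2)) as [N HN]; [lra|].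
    exists N; intros n Hn x y.
    assert (Hx : Rabs (k n x y - l x y) <= eps / 2); [|lra].
    apply (is_lim_seq_le_loc (fun m => Rabs (k n x y - k m x y)) (fun _ => eps / 2)
             (Finite (Rabs (k n x y - l x y))) (Finite (eps / 2))).
    - exists N; intros m Hm; left; now apply HN.
    - apply (is_lim_seq_abs _ (Finite (k n x y - l x y))).
      apply is_lim_seq_minus'; [apply is_lim_seq_const|apply Hl].
    - apply is_lim_seq_const. }
  exists l; split; [|exact HL].
  apply (ckern_lim X k l HC).
  intros eps He; destruct (HL eps He) as [N HN]; exists N; intros; now apply HN.
Qed.

(* H. A. Schwarz's iteration: with the trace rate [rho], the normalised even iterates of [r]
   converge uniformly, and traces [>= 1] keep the limit, an eigenkernel of [r o r], nonzero. *)
Theorem symmetric_kernel_eigenfunction : (exists x y, r x y <> 0) ->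
  exists (nu : R) (g : X -> R), nu <> 0 /\ cfun g /\ (exists x, g x <> 0) /\
    forall x, intg (fun y => r x y * g y) = nu * g x.
Proof.
  intros Hne; destruct (ktrace_pos Hne) as [H0 H1].
  destruct (log_convex_submult_rate (ktrace X r) H0 H1)
    as [rho [Hr [Hone [L HL]]]].
  { now apply ktrace_ge0. }
  { now apply ktrace_log_convex. }
  { now apply ktrace_submult. }
  set (a := fun n => ktrace X r n / rho ^ (n + 1)) in HL.
  assert (Hpw : forall n, 0 < rho ^ n) by (intro; now apply pow_lt).
  (* Index 2n + 3 is the power 2n + 4, that is r o r^(2n+2) o r. The outer factors serve the
     sandwich estimate; the normalisation is that of the inner power. *)
  set (z := fun n x y => / rho ^ (n + 1) * p (2 * n + 3) x y).
  assert (HzC : forall n, ckern (z n)) by (intro; apply ckern_scal, pC2).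
  destruct (cfun_bounded X (fun x => p 1 x x)) as [M HM].
  { apply ckern_diag, pC2. }
  assert (HM0 : 0 < M * M + 1) by nra.
  assert (Hzz : forall n m x y, (z n x y - z m x y)² <= M * M *
     (a (2 * n + 1)%nat + a (2 * m + 1)%nat - 2 * a (n + m + 1)%nat)).
  { intros n m x y.
    set (e := fun x y => / rho ^ (n + 1) * p (2 * n + 1) x y - / rho ^ (m + 1) * p (2 * m + 1) x y).
    assert (HeC : ckern e) by (unfold e; auto using ckern_minus, ckern_scal, pC2).
    assert (Hs := kcomp_sandwich_sq e x y HeC).
    assert (E1 : kcomp X r (kcomp X e r) x y = z n x y - z m x y).
    { assert (Hp : forall i u v, p (2 * i + 3) u v = kcomp X r (kcomp X (p (2 * i + 1)) r) u v).
      { intros i u v; replace (2 * i + 3)%nat with (S (2 * i + 1 + 0 + 1)) by lia.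
        unfold p; simpl. apply intg_ext; intro w. f_equal. now apply kpow_add. }
      unfold z; rewrite 2!Hp; unfold kcomp at 1 3 5.
      assert (HkC : forall i, ckern (kcomp X (p (2 * i + 1)) r)) by (intro; apply ckern_comp; auto; apply pC2).
      rewrite <- 2!intg_scal, <- intg_minus
        by auto 6 using cfun_scal, cfun_mult, ckern_row, ckern_col.
      apply intg_ext; intro w; unfold kcomp, e.
      rewrite (intg_ext X _ (fun v => / rho ^ (n + 1) * (p (2 * n + 1) w v * r v y) -
         / rho ^ (m + 1) * (p (2 * m + 1) w v * r v y))) by (intro; ring).
      assert (HqC : forall i, cfun (fun v => p (2 * i + 1) w v * r v y)).
      { intro; apply cfun_mult; [apply (ckern_row X), pC2|now apply ckern_col]. }
      rewrite intg_minus, 2!intg_scal by auto using cfun_scal. ring. }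
    rewrite <- E1; eapply Rle_trans; [exact Hs|].
    unfold e; rewrite hs_distance.
    match goal with |- _ * ?u <= _ * ?v => assert (E2 : u = v) end.
    { unfold a. replace (2 * n + 1 + 1)%nat with (n + 1 + (n + 1))%nat by lia.
      replace (2 * m + 1 + 1)%nat with (m + 1 + (m + 1))%nat by lia.
      replace (n + m + 1 + 1)%nat with (n + 1 + (m + 1))%nat by lia.
      assert (rho <> 0) by lra.
      rewrite !pow_add. field. repeat split; auto using pow_nonzero. }
    rewrite <- E2. apply Rmult_le_compat_r.
    - rewrite <- hs_distance.
      assert (HC : ckern (fun z w => (/ rho ^ (n + 1) * p (2 * n + 1) z w - / rho ^ (m + 1) * p (2 * m + 1) z w)²)).
      { unfold Rsqr; apply ckern_mult; exact HeC. }
      apply intg_ge0; [now apply (cfun_intg_row X _ HC)|].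
      intro v; apply intg_ge0; [now apply (ckern_row X _ v HC)|intro; apply Rle_0_sqr].
    - assert (A := HM x). assert (B := HM y).
      assert (A0 := kpow_diag_ge0 X r r_ckern r_sym 0 x).
      assert (B0 := kpow_diag_ge0 X r r_ckern r_sym 0 y).
      rewrite Rabs_pos_eq in A, B by assumption.
      apply Rmult_le_compat; assumption. }
  destruct (uniform_cauchy_limit z HzC) as [Z [HZC HZ]].
  { intros eps He.
    (* Normalised traces within d of their limit make the combination a + a - 2a in [Hzz] smaller
       than 4d. *)
    assert (Hd : 0 < eps * eps / (4 * (M * M + 1))) by (apply Rdiv_lt_0_compat; nra).
    apply is_lim_seq_spec in HL; destruct (HL (mkposreal _ Hd)) as [N HN]; simpl in HN.
    exists N; intros n m Hn Hm x y.
    assert (A1 := HN (2 * n + 1)%nat ltac:(lia)). assert (A2 := HN (2 * m + 1)%nat ltac:(lia)).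
    assert (A3 := HN (n + m + 1)%nat ltac:(lia)).
    apply Rabs_lt_between in A1, A2, A3.
    assert (A := Hzz n m x y).
    set (d := eps * eps / (4 * (M * M + 1))) in *.
    assert (Ed : 4 * ((M * M + 1) * d) = eps * eps) by (unfold d; field; lra).
    assert (B : (z n x y - z m x y)² < eps²).
    { eapply Rle_lt_trans; [exact A|]. unfold Rsqr at 1. rewrite <- Ed.
      apply Rle_lt_trans with (M * M * (4 * d)); [apply Rmult_le_compat_l; nra|nra]. }
    apply Rsqr_lt_abs_0 in B. now rewrite (Rabs_pos_eq eps) in B by lra. }
  (* [p 1] is r o r: composing with it raises the power by two, that is n by one, at the price of
     one factor [rho]. *)
  assert (HAZ : forall n x y, kcomp X (p 1) (z n) x y = rho * z (S n) x y).
  { intros n x y; unfold z, kcomp.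
    rewrite (intg_ext X _ (fun v => / rho ^ (n + 1) * (p 1 x v * p (2 * n + 3) v y))) by (intro; ring).
    rewrite intg_scal by (apply cfun_mult; [apply (ckern_row X), pC2|apply ckern_col, pC2]).
    change (intg (fun v => p 1 x v * p (2 * n + 3) v y)) with (kcomp X (p 1) (p (2 * n + 3)) x y).
    unfold p; rewrite <- kpow_add by assumption.
    replace (1 + (2 * n + 3) + 1)%nat with (2 * S n + 3)%nat by lia.
    replace (S n + 1)%nat with (S (n + 1)) by lia. simpl pow. field.
    assert (rho <> 0) by lra. repeat split; auto using pow_nonzero. }
  assert (HpZ : forall x y, kcomp X (p 1) Z x y = rho * Z x y).
  { intros x y; apply cond_eq; intros eps He.
    destruct (cfun_bounded X (p 1 x)) as [B HB]; [apply (ckern_row X), pC2|].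
    assert (HB0 : 0 <= B) by (eapply Rle_trans; [apply Rabs_pos|apply (HB x)]).
    set (W := intg (fun _ : X => 1)).
    assert (HW : 0 <= W) by (apply intg_ge0; [apply cfun_const|intro; lra]).
    set (d := eps / (B * W + rho + 1)).
    assert (HBW : 0 <= B * W) by now apply Rmult_le_pos.
    assert (Hd : 0 < d) by (apply Rdiv_lt_0_compat; lra).
    assert (Ed : d * (B * W + rho + 1) = eps) by (unfold d; field; lra).
    destruct (HZ d Hd) as [N HN].
    replace (kcomp X (p 1) Z x y - rho * Z x y) with
      ((kcomp X (p 1) Z x y - kcomp X (p 1) (z N) x y) + rho * (z (S N) x y - Z x y))
      by (rewrite HAZ; ring).
    eapply Rle_lt_trans; [apply Rabs_triang|].
    apply Rle_lt_trans with (B * d * W + rho * d); [|nra].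
    apply Rplus_le_compat.
    - unfold kcomp.
      rewrite <- intg_minus by (apply cfun_mult; [apply (ckern_row X), pC2|apply ckern_col; auto]).
      apply Rabs_intg_le.
      + apply cfun_minus; apply cfun_mult; try (apply (ckern_row X), pC2); apply ckern_col; auto.
      + intro v. rewrite <- Rmult_minus_distr_l, Rabs_mult.
        apply Rmult_le_compat; auto using Rabs_pos.
        rewrite Rabs_minus_sym; left; apply HN; lia.
    - rewrite Rabs_mult, (Rabs_pos_eq rho) by lra.
      apply Rmult_le_compat_l; [lra|]. left; apply HN; lia. }
  (* The trace of [z N] is rho times a normalised trace, hence at least rho, whereas a limit with
     zero diagonal would make it arbitrarily small. *)
  assert (Hx0 : exists x, Z x x <> 0).
  { apply not_all_not_ex; intro Hall.
    assert (HZ0 : forall x, Z x x = 0).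
    { intro x; apply NNPP; apply (Hall x). }
    set (W := intg (fun _ : X => 1)).
    assert (HW : 0 <= W) by (apply intg_ge0; [apply cfun_const|intro; lra]).
    set (d := rho / (W + 1)).
    assert (Hd : 0 < d) by (apply Rdiv_lt_0_compat; lra).
    assert (Ed : d * (W + 1) = rho) by (unfold d; field; lra).
    destruct (HZ d Hd) as [N HN].
    assert (A : Rabs (intg (fun x => z N x x)) <= d * W).
    { apply Rabs_intg_le; [apply ckern_diag; auto|].
      intro x; rewrite <- (Rminus_0_r (z N x x)), <- (HZ0 x); left; apply HN; lia. }
    assert (B : intg (fun x => z N x x) = rho * a (S N)).
    { unfold z. rewrite (intg_scal X _ (fun x => p (2 * N + 3) x x)) by (apply ckern_diag, pC2).
      unfold a, ktrace. replace (2 * S N + 1)%nat with (2 * N + 3)%nat by lia.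
      replace (S N + 1)%nat with (S (N + 1)) by lia. unfold p; simpl pow. field.
      assert (rho <> 0) by lra. repeat split; auto using pow_nonzero. }
    specialize (Hone (S N)); fold (a (S N)) in Hone.
    rewrite B, Rabs_mult, (Rabs_pos_eq rho), (Rabs_pos_eq (a (S N))) in A by lra.
    nra. }
  destruct Hx0 as [x0 Hx0].
  set (g0 := fun x => Z x x0).
  assert (Hg0 : cfun g0) by (apply ckern_col; auto).
  set (mu := sqrt rho).
  assert (Hmu : 0 < mu) by now apply sqrt_lt_R0.
  assert (Hmu2 : mu * mu = rho) by (apply sqrt_sqrt; lra).
  set (rg := fun x => intg (fun y => r x y * g0 y)).
  assert (Hrg : forall x, intg (fun y => r x y * rg y) = rho * g0 x).
  { intro x; unfold g0; rewrite <- HpZ.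
    exact (eq_sym (kcomp_assoc X r r Z r_ckern r_ckern HZC x x0)). }
  assert (HrgC : cfun rg) by (apply (ckern_col X (kcomp X r Z) x0); now apply ckern_comp).
  (* Since (r - mu)(r + mu) g0 = 0, either (r + mu) g0 is an eigenfunction for mu, or it is zero and
     g0 is one for -mu. *)
  destruct (classic (exists x, rg x + mu * g0 x <> 0)) as [Hn|Hz].
  - exists mu, (fun x => rg x + mu * g0 x).
    split; [lra|]; split; [auto using cfun_plus, cfun_scal|]; split; [exact Hn|].
    intro x.
    rewrite (intg_ext X _ (fun y => r x y * rg y + mu * (r x y * g0 y))) by (intro; ring).
    assert (Hrx := ckern_row X r x r_ckern).
    rewrite intg_plus, intg_scal, Hrg by auto using cfun_mult, cfun_scal.
    fold (rg x). rewrite <- Hmu2; ring.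
  - exists (- mu), g0. split; [lra|]; split; [exact Hg0|]; split; [now exists x0|].
    intro x; fold (rg x).
    assert (rg x + mu * g0 x = 0); [|lra].
    apply NNPP; intro; apply Hz; now exists x.
Qed.

End Eigenfunction.

(** * The bilinear series of a symmetric kernel *)

Lemma sum_n_ext_R (a b : nat -> R) N : (forall n, a n = b n) -> sum_n a N = sum_n b N.
Proof. apply sum_n_ext. Qed.

Lemma sum_n_scal_R (c : R) (a : nat -> R) N : c * sum_n a N = sum_n (fun i => c * a i) N.
Proof. exact (eq_sym (sum_n_mult_l (K := R_Ring) c a N)). Qed.

Lemma sum_n_plus_R (a b : nat -> R) N : sum_n a N + sum_n b N = sum_n (fun i => a i + b i) N.
Proof. exact (eq_sym (sum_n_plus a b N)). Qed.

Lemma sum_n_m_ge0 (a : nat -> R) n m : (forall i, 0 <= a i) -> 0 <= sum_n_m a n m.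
Proof.
  intro H; apply Rle_trans with (sum_n_m (fun _ => zero) n m).
  - rewrite sum_n_m_const_zero; right; reflexivity.
  - apply sum_n_m_le; exact H.
Qed.

Lemma sum_n_m_le_sum_n (a : nat -> R) n m : (forall i, 0 <= a i) -> sum_n_m a n m <= sum_n a m.
Proof.
  intro H; unfold sum_n; destruct n as [|n]; [right; reflexivity|].
  destruct (le_dec (S n) m) as [Hnm|Hnm].
  - rewrite (sum_n_m_Chasles a 0 n m) by lia.
    assert (0 <= sum_n_m a 0 n) by now apply sum_n_m_ge0.
    set (u := sum_n_m a 0 n) in *; set (v := sum_n_m a (S n) m).
    change (v <= u + v); lra.
  - rewrite sum_n_m_zero by lia. now apply sum_n_m_ge0.
Qed.

Section Expansion.
Variable X : ispace.
Variable e : nat -> X -> R.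
Variable lam : nat -> R.
Variable K : X -> X -> R.
Hypothesis e_cfun : forall n, cfun (e n).
Hypothesis e_orthonormal : forall m n,
  intg (fun x => e m x * e n x) = if Nat.eq_dec m n then 1 else 0.
Hypothesis lam_neq0 : forall n, lam n <> 0.
Hypothesis K_ckern : ckern K.
Hypothesis K_sym : forall x y, K x y = K y x.
Hypothesis K_eigen : forall n x, intg (fun y => K x y * e n y) = / lam n * e n x.
(** For u = sum c_i e_i the right side is d <L u, u> + C |u|^2. Stated on coefficients, the estimate
    does not mention L or its domain. *)
Hypothesis e_coercive : forall d, 0 < d -> exists C, forall (c : nat -> R) N x,
  (sum_n (fun i => c i * e i x) N)² <= sum_n (fun i => c i * c i * (d * lam i + C)) N.
Hypothesis e_complete : forall nu g, nu <> 0 -> cfun g ->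
  (forall x, intg (fun y => K x y * g y) = nu * g x) ->
  (forall n, intg (fun x => g x * e n x) = 0) -> forall x, g x = 0.

Lemma cfun_sum_n (f : nat -> X -> R) N : (forall i, cfun (f i)) -> cfun (fun x => sum_n (fun i => f i x) N).
Proof.
  intro H; induction N as [|N IH].
  - apply cfun_ext with (f O); [|auto]. intro x; now rewrite sum_O.
  - apply cfun_ext with (fun x => sum_n (fun i => f i x) N + f (S N) x); [|auto using cfun_plus].
    intro x; now rewrite sum_Sn.
Qed.

Lemma ckern_sum_n (f : nat -> X -> X -> R) N : (forall i, ckern (f i)) ->
  ckern (fun x y => sum_n (fun i => f i x y) N).
Proof.
  intro H; induction N as [|N IH].
  - apply ckern_ext with (f O); [|auto]. intros x y; now rewrite sum_O.
  - apply ckern_ext with (fun x y => sum_n (fun i => f i x y) N + f (S N) x y); [|auto using ckern_plus].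
    intros x y; now rewrite sum_Sn.
Qed.

Lemma intg_sum_n (f : nat -> X -> R) N : (forall i, cfun (f i)) ->
  intg (fun x => sum_n (fun i => f i x) N) = sum_n (fun i => intg (f i)) N.
Proof.
  intro H; induction N as [|N IH].
  - rewrite sum_O; apply intg_ext; intro; now rewrite sum_O.
  - rewrite sum_Sn, <- IH.
    rewrite (intg_ext X _ (fun x => sum_n (fun i => f i x) N + f (S N) x)) by (intro; now rewrite sum_Sn).
    rewrite intg_plus; auto using cfun_sum_n.
Qed.

Lemma sum_n_indicator (j N : nat) (f : nat -> R) : (j <= N)%nat ->
  (forall i, i <> j -> f i = 0) -> sum_n f N = f j.
Proof.
  induction N as [|N IH]; intros Hj H.
  - replace j with 0%nat by lia; apply sum_O.
  - rewrite sum_Sn; destruct (Nat.eq_dec j (S N)) as [->|Hne].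
    + rewrite (sum_n_ext_loc f (fun _ => 0)), sum_n_const.
      * unfold plus; simpl; ring.
      * intros; apply H; lia.
    + rewrite IH, (H (S N)) by (auto; lia). unfold plus; simpl; ring.
Qed.

Lemma intg_sum_mult (a b : nat -> R) N :
  intg (fun x => sum_n (fun i => a i * e i x) N * sum_n (fun j => b j * e j x) N) =
  sum_n (fun i => a i * b i) N.
Proof.
  assert (HC : cfun (fun x => sum_n (fun j => b j * e j x) N)).
  { apply (cfun_sum_n (fun j x => b j * e j x)); auto using cfun_scal. }
  rewrite (intg_ext X _ (fun x => sum_n (fun i => a i * (e i x * sum_n (fun j => b j * e j x) N)) N)).
  2: { intro x; rewrite Rmult_comm, <- (sum_n_mult_l (K := R_Ring)).
       apply sum_n_ext_R; intro i. change (sum_n (fun j => b j * e j x) N * (a i * e i x) =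
         a i * (e i x * sum_n (fun j => b j * e j x) N)); ring. }
  rewrite (intg_sum_n (fun i x => a i * (e i x * sum_n (fun j => b j * e j x) N)))
    by (auto using cfun_scal, cfun_mult).
  apply sum_n_ext_loc; intros i Hi.
  rewrite intg_scal by auto using cfun_mult. f_equal.
  rewrite (intg_ext X _ (fun x => sum_n (fun j => b j * (e i x * e j x)) N)).
  2: { intro x; rewrite <- (sum_n_mult_l (K := R_Ring)).
       apply sum_n_ext_R; intro j. change (e i x * (b j * e j x) = b j * (e i x * e j x)); ring. }
  rewrite (intg_sum_n (fun j x => b j * (e i x * e j x))) by auto using cfun_scal, cfun_mult.
  rewrite (sum_n_indicator i N); [|exact Hi|].
  - rewrite intg_scal, e_orthonormal by auto using cfun_mult. destruct (Nat.eq_dec i i); [ring|easy].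
  - intros j Hj; rewrite intg_scal, e_orthonormal by auto using cfun_mult.
    destruct (Nat.eq_dec i j); [congruence|ring].
Qed.

Lemma eigenfunction_bound d C : 0 < d ->
  (forall (c : nat -> R) N x,
    (sum_n (fun i => c i * e i x) N)² <= sum_n (fun i => c i * c i * (d * lam i + C)) N) ->
  (forall n, 0 < d * lam n + C) /\
  (forall N x, sum_n (fun i => e i x * e i x / (d * lam i + C)) N <= 1).
Proof.
  intros Hd HC.
  assert (Hpos : forall n, 0 < d * lam n + C).
  { intro n.
    (* Coercivity for the single function [e n]. A nonpositive right side would force [e n] to
       vanish, against its norm 1. *)
    assert (H : forall x, (e n x)² <= d * lam n + C).
    { intro x; specialize (HC (fun i => if Nat.eq_dec i n then 1 else 0) n x).
      rewrite 2!(sum_n_indicator n n) in HC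
        by (lia || (intros i Hi; destruct (Nat.eq_dec i n); [easy|ring])).
      destruct (Nat.eq_dec n n) as [_|]; [|easy].
      now rewrite !Rmult_1_l in HC. }
    apply Rnot_le_lt; intro Hle.
    assert (Hz : forall x, e n x * e n x = 0).
    { intro x; specialize (H x); unfold Rsqr in H. assert (0 <= e n x * e n x) by apply Rle_0_sqr. lra. }
    specialize (e_orthonormal n n); destruct (Nat.eq_dec n n) as [_|]; [|easy].
    rewrite (intg_ext X _ (fun _ => 0)), intg_0 in e_orthonormal by exact Hz. lra. }
  split; [exact Hpos|].
  (* With these coefficients, evaluated at the same x, both sides reduce to the same sum s: s^2 <=
     s, hence s <= 1. *)
  intros N x; specialize (HC (fun i => e i x / (d * lam i + C)) N x).
  set (s := sum_n (fun i => e i x * e i x / (d * lam i + C)) N).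
  rewrite (sum_n_ext_R _ (fun i => e i x * e i x / (d * lam i + C))) in HC
    by (intro; unfold Rdiv; ring).
  fold s in HC.
  rewrite (sum_n_ext_R _ (fun i => e i x * e i x / (d * lam i + C))) in HC.
  2: { intro i;  field. apply Rgt_not_eq, Hpos. }
  fold s in HC; unfold Rsqr in HC. nra.
Qed.

(* Choosing [d] small, the coercivity estimate bounds the tails of the diagonal
   series once [d * lam i] dominates the constant [C]. *)
Lemma diagonal_tail eta : 0 < eta -> exists N0, forall n m x, (N0 <= n)%nat ->
  sum_n_m (fun i => e i x * e i x * / Rabs (lam i)) n m <= eta.
Proof.
  (* The tail will be at most 2d times a sum bounded by 1. *)
  intro He. set (d := eta / 2). assert (Hd : 0 < d) by (unfold d; lra).
  destruct (e_coercive d Hd) as [C HC].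
  destruct (eigenfunction_bound d C Hd HC) as [Hpos H1].
  set (mu := fun i => d * lam i + C) in *.
  set (W := intg (fun _ : X => 1)).
  (* The pointwise bound by 1, integrated with |e_i| = 1: the sum of 1 / mu_i converges, so mu_i
     tends to infinity. *)
  assert (HW : forall N, sum_n (fun i => / mu i) N <= W).
  { intro N.
    replace (sum_n (fun i => / mu i) N) with
      (intg (fun x => sum_n (fun i => / mu i * (e i x * e i x)) N)).
    - apply intg_le; [apply cfun_sum_n; auto using cfun_scal, cfun_mult|apply cfun_const|].
      intro x; rewrite (sum_n_ext_R _ (fun i => e i x * e i x / mu i)) by (intro; unfold Rdiv; ring).
      apply H1.
    - rewrite (intg_sum_n (fun i x => / mu i * (e i x * e i x))) by auto using cfun_scal, cfun_mult.
      apply sum_n_ext_R; intro i; rewrite intg_scal, e_orthonormal by auto using cfun_mult.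
      destruct (Nat.eq_dec i i); [ring|easy]. }
  assert (Hser : ex_finite_lim_seq (sum_n (fun i => / mu i))).
  { apply ex_finite_lim_seq_incr with W; [|exact HW].
    intro n; rewrite sum_Sn. assert (0 < / mu (S n)) by apply Rinv_0_lt_compat, Hpos.
    unfold plus; simpl; lra. }
  assert (Hlim : is_lim_seq (fun i => / mu i) (Finite 0)).
  { destruct Hser as [l Hl]. apply (ex_series_lim_0 (fun i => / mu i)). now exists l. }
  apply is_lim_seq_spec in Hlim.
  (* 1 / mu_i below this threshold means mu_i > 2|C| + 1, so C takes up at most half of mu_i and
     mu_i <= 2 d lam_i. *)
  assert (HCp : 0 < / (2 * Rabs C + 1)).
  { apply Rinv_0_lt_compat. assert (0 <= Rabs C) by apply Rabs_pos. lra. }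
  destruct (Hlim (mkposreal _ HCp)) as [N0 HN0]; simpl in HN0.
  exists N0; intros n m x Hn.
  (* [sum_n_m_le] compares terms at all indices, so those below [N0] are set to zero. *)
  set (b := fun i => if le_dec N0 i then e i x * e i x * / Rabs (lam i) else 0).
  rewrite (sum_n_m_ext_loc _ b).
  2: { intros k Hk; unfold b; destruct (le_dec N0 k); [easy|lia]. }
  apply Rle_trans with (sum_n_m (fun i => 2 * d * (e i x * e i x / mu i)) n m).
  - apply sum_n_m_le; intro i; unfold b.
    assert (Hmu := Hpos i); fold (mu i) in Hmu.
    assert (Hee : 0 <= e i x * e i x) by apply Rle_0_sqr.
    assert (Hi : 0 < / mu i) by now apply Rinv_0_lt_compat.
    destruct (le_dec N0 i) as [Hi0|]; [|unfold Rdiv; apply Rmult_le_pos; [lra|apply Rmult_le_pos; lra]].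
    specialize (HN0 i Hi0). rewrite Rminus_0_r, Rabs_pos_eq in HN0 by lra.
    apply Rinv_lt_cancel in HN0; [|exact Hmu].
    assert (HC1 := Rle_abs C).
    assert (Hl : mu i <= 2 * (d * lam i)) by (unfold mu in *; lra).
    assert (Hl0 : 0 < lam i) by nra.
    rewrite Rabs_pos_eq by lra.
    replace (2 * d * (e i x * e i x / mu i)) with (e i x * e i x * (/ mu i * (2 * d))) by (field; lra).
    apply Rmult_le_compat_l; [exact Hee|].
    apply (Rmult_le_reg_r (lam i * mu i)); [now apply Rmult_lt_0_compat|].
    replace (/ lam i * (lam i * mu i)) with (mu i) by (field; lra).
    replace (/ mu i * (2 * d) * (lam i * mu i)) with (2 * (d * lam i)) by (field; lra).
    exact Hl.
  - rewrite (sum_n_m_ext _ (fun i => scal (2 * d) (e i x * e i x / mu i))) by (intro; reflexivity).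
    rewrite sum_n_m_scal_l. unfold scal; simpl; unfold mult; simpl.
    replace eta with (2 * d * 1) by (unfold d; field).
    apply Rmult_le_compat_l; [lra|].
    apply Rle_trans with (2 := H1 m x).
    apply (sum_n_m_le_sum_n (fun i => e i x * e i x / mu i)); intro i.
    unfold Rdiv; apply Rmult_le_pos; [apply Rle_0_sqr|left; apply Rinv_0_lt_compat, Hpos].
Qed.

Definition bilinear_term x y n : R := / lam n * e n x * e n y.

(** The inequality 2|ab| <= a^2 + b^2 reduces the mixed series to the diagonal series at x and at
    y. *)
Lemma bilinear_tail eta : 0 < eta -> exists N0, forall n m x y, (N0 <= n)%nat ->
  sum_n_m (fun i => Rabs (bilinear_term x y i)) n m <= eta.
Proof.
  intro He; destruct (diagonal_tail eta He) as [N0 HN0].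
  exists N0; intros n m x y Hn.
  apply Rle_trans with (sum_n_m (fun i => plus (scal (/ 2) (e i x * e i x * / Rabs (lam i)))
    (scal (/ 2) (e i y * e i y * / Rabs (lam i)))) n m).
  - apply sum_n_m_le; intro i; unfold bilinear_term, plus, scal; simpl; unfold mult; simpl.
    rewrite !Rabs_mult, Rabs_inv.
    assert (Hl : 0 < / Rabs (lam i)) by (apply Rinv_0_lt_compat, Rabs_pos_lt; auto).
    assert (H := Rle_0_sqr (Rabs (e i x) - Rabs (e i y))).
    assert (Ex : Rabs (e i x) * Rabs (e i x) = e i x * e i x) by apply (eq_sym (Rsqr_abs _)).
    assert (Ey : Rabs (e i y) * Rabs (e i y) = e i y * e i y) by apply (eq_sym (Rsqr_abs _)).
    unfold Rsqr in H. nra.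
  - rewrite sum_n_m_plus, 2!sum_n_m_scal_l.
    assert (A := HN0 n m x Hn). assert (B := HN0 n m y Hn).
    set (u := sum_n_m _ n m) in A; set (v := sum_n_m _ n m) in B.
    change (/ 2 * u + / 2 * v <= eta); lra.
Qed.

Let S_ N x y := sum_n (bilinear_term x y) N.

Lemma partial_sum_ckern N : ckern (S_ N).
Proof.
  apply (ckern_sum_n (fun i x y => bilinear_term x y i)); intro i; unfold bilinear_term.
  apply ckern_mult; [apply (ckern_fst X (fun x => / lam i * e i x))|apply ckern_snd];
    auto using cfun_scal.
Qed.

Lemma partial_sum_cauchy eps : 0 < eps -> exists N, forall n m, (N <= n)%nat -> (N <= m)%nat ->
  forall x y, Rabs (S_ n x y - S_ m x y) < eps.
Proof.
  intro He; destruct (bilinear_tail (eps / 2)) as [N HN]; [lra|].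
  assert (Hle : forall n m, (N <= n)%nat -> (n <= m)%nat ->
    forall x y, Rabs (S_ m x y - S_ n x y) < eps).
  { intros n m Hn Hnm x y; unfold S_, sum_n.
    assert (E : sum_n_m (bilinear_term x y) 0 m - sum_n_m (bilinear_term x y) 0 n =
      sum_n_m (bilinear_term x y) (S n) m).
    { rewrite (sum_n_m_Chasles (bilinear_term x y) 0 n m) by lia.
      set (u := sum_n_m _ 0 n); set (v := sum_n_m _ (S n) m). change (u + v - u = v); ring. }
    rewrite E.
    eapply Rle_lt_trans; [apply (norm_sum_n_m (K := R_AbsRing) (V := R_NormedModule))|].
    eapply Rle_lt_trans; [apply HN; lia|lra]. }
  exists N; intros n m Hn Hm x y.
  destruct (le_ge_dec n m); [rewrite Rabs_minus_sym|]; now apply Hle.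
Qed.

(** Eventual constancy is the case that occurs: the partial sums, applied to some [e n] or to a
    function orthogonal to all of them, stop changing. *)
Lemma intg_kernel_lim (k : nat -> X -> X -> R) l f x v : (forall n, ckern (k n)) -> ckern l -> cfun f ->
  (forall eps, 0 < eps -> exists N, forall n, (N <= n)%nat -> forall x y, Rabs (k n x y - l x y) < eps) ->
  (exists n0, forall n, (n0 <= n)%nat -> intg (fun y => k n x y * f y) = v) ->
  intg (fun y => l x y * f y) = v.
Proof.
  intros Hk Hl Hf Hlim [n0 Hn0]; apply cond_eq; intros eps He.
  destruct (cfun_bounded X f Hf) as [B HB].
  set (W := intg (fun _ : X => 1)).
  assert (HW : 0 <= W) by (apply intg_ge0; [apply cfun_const|intro; lra]).
  set (B1 := Rabs B).
  assert (HB1 : 0 <= B1) by apply Rabs_pos.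
  assert (HBW : 0 <= B1 * W) by now apply Rmult_le_pos.
  set (d := eps / (B1 * W + 1)).
  assert (Hd : 0 < d) by (apply Rdiv_lt_0_compat; lra).
  assert (Ed : d * (B1 * W + 1) = eps) by (unfold d; field; lra).
  destruct (Hlim d Hd) as [N HN].
  rewrite <- (Hn0 (max n0 N)) by lia.
  rewrite <- intg_minus by (apply cfun_mult; auto; apply (ckern_row X); auto).
  apply Rle_lt_trans with (d * B1 * W); [|nra].
  apply Rabs_intg_le.
  - apply cfun_minus; apply cfun_mult; auto; apply (ckern_row X); auto.
  - intro y; rewrite <- Rmult_minus_distr_r, Rabs_mult.
    apply Rmult_le_compat; auto using Rabs_pos.
    + rewrite Rabs_minus_sym; left; apply HN; lia.
    + eapply Rle_trans; [apply HB|apply Rle_abs].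
Qed.

Lemma partial_sum_apply N f x : cfun f ->
  intg (fun y => S_ N x y * f y) = sum_n (fun i => / lam i * e i x * intg (fun y => f y * e i y)) N.
Proof.
  intro Hf.
  rewrite (intg_ext X _ (fun y => sum_n (fun i => / lam i * e i x * (f y * e i y)) N)).
  - rewrite (intg_sum_n (fun i y => / lam i * e i x * (f y * e i y))) by auto using cfun_scal, cfun_mult.
    apply sum_n_ext_R; intro i; apply (intg_scal X _ (fun y => f y * e i y)); auto using cfun_mult.
  - intro y; unfold S_; rewrite Rmult_comm.
    rewrite <- (sum_n_mult_l (K := R_Ring) (f y)).
    apply sum_n_ext_R; intro i; unfold bilinear_term, mult; simpl; ring.
Qed.

Theorem bilinear_expansion :
  (forall eps, 0 < eps -> exists N, forall n, (N <= n)%nat ->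
     forall x y, Rabs (S_ n x y - K x y) < eps).
Proof.
  destruct (uniform_cauchy_limit X S_ partial_sum_ckern partial_sum_cauchy) as [l [Hl Hlim]].
  assert (Hlsym : forall x y, l x y = l y x).
  { intros x y; apply cond_eq; intros eps He.
    destruct (Hlim (eps / 2)) as [N HN]; [lra|].
    assert (A := HN N (le_n N) x y). assert (B := HN N (le_n N) y x).
    assert (E : S_ N x y = S_ N y x).
    { unfold S_; apply sum_n_ext_R; intro i; unfold bilinear_term; ring. }
    rewrite E in A. apply Rabs_lt_between in A, B. apply Rabs_lt_between; lra. }
  assert (Hle : forall n x, intg (fun y => l x y * e n y) = / lam n * e n x).
  { intros n x; apply (intg_kernel_lim S_ l (e n) x); auto using partial_sum_ckern.
    exists n; intros N HN; rewrite partial_sum_apply by auto.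
    rewrite (sum_n_indicator n N); [|exact HN|].
    2: { intros i Hi; rewrite e_orthonormal. destruct (Nat.eq_dec n i); [congruence|ring]. }
    rewrite e_orthonormal; destruct (Nat.eq_dec n n); [ring|easy]. }
  set (r := fun x y => K x y - l x y).
  assert (HrC : ckern r) by (unfold r; auto using ckern_minus).
  assert (Hrsym : forall x y, r x y = r y x).
  { intros x y; unfold r; now rewrite K_sym, Hlsym. }
  assert (Hre : forall n x, intg (fun y => r x y * e n y) = 0).
  { intros n x; unfold r.
    rewrite (intg_ext X _ (fun y => K x y * e n y - l x y * e n y)) by (intro; ring).
    rewrite intg_minus, K_eigen, Hle by (apply cfun_mult; auto; now apply (ckern_row X)). ring. }
  destruct (classic (exists x y, r x y <> 0)) as [Hne|Heq].
  - exfalso.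
    destruct (symmetric_kernel_eigenfunction X r HrC Hrsym Hne) as [nu [g [Hnu [Hg [[x0 Hx0] Hrg]]]]].
    (* nu <g, e_n> = <r g, e_n> = <g, r e_n> = 0, by Fubini and the symmetry of r. *)
    assert (Horth : forall n, intg (fun x => g x * e n x) = 0).
    { intro n; apply (Rmult_eq_reg_l nu); [|exact Hnu].
      rewrite Rmult_0_r, <- intg_scal by auto using cfun_mult.
      rewrite (intg_ext X _ (fun x => intg (fun y => r x y * g y * e n x))).
      2: { intro x; rewrite <- Rmult_assoc, <- Hrg, Rmult_comm, <- intg_scal
             by (apply cfun_mult; auto; now apply (ckern_row X)).
           apply intg_ext; intro; ring. }
      rewrite (intg_fubini X (fun x y => r x y * g y * e n x)).
      2: { apply ckern_mult; [apply ckern_mult; auto using ckern_snd|now apply ckern_fst]. }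
      rewrite <- (intg_0 X); apply intg_ext; intro y.
      rewrite (intg_ext X _ (fun x => g y * (r y x * e n x))) by (intro x; rewrite (Hrsym x y); ring).
      rewrite intg_scal, Hre by (apply cfun_mult; auto; now apply (ckern_row X)). ring. }
    apply Hx0, (e_complete nu g Hnu Hg); [|exact Horth].
    (* By orthogonality the series kernel annihilates g, so r g = K g. *)
    intro x; rewrite <- Hrg; unfold r.
    rewrite (intg_ext X (fun y => (K x y - l x y) * g y) (fun y => K x y * g y - l x y * g y)) by (intro; ring).
    rewrite intg_minus by (apply cfun_mult; auto; now apply (ckern_row X)).
    rewrite (intg_kernel_lim S_ l g x 0); auto using partial_sum_ckern; [ring|].
    exists 0%nat; intros N _; rewrite partial_sum_apply by auto.
    rewrite (sum_n_ext_R _ (fun _ => 0)) by (intro; rewrite Horth; ring).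
    rewrite sum_n_const; ring.
  - intros eps He; destruct (Hlim eps He) as [N HN]; exists N; intros n Hn x y.
    replace (K x y) with (l x y); [now apply HN|].
    assert (r x y = 0); [|unfold r in *; lra].
    apply NNPP; intro; apply Heq; now exists x, y.
Qed.

End Expansion.

(** * Continuous functions and kernels on two intervals *)

Lemma continuous_R_iff (f : R -> R) x :
  continuous f x <-> forall eps, 0 < eps -> exists d, 0 < d /\ forall y, Rabs (y - x) < d -> Rabs (f y - f x) < eps.
Proof.
  split.
  - intros H eps He.
    assert (H1 := proj1 (filterlim_locally f (f x)) H (mkposreal eps He)).
    destruct H1 as [d Hd]; exists d; split; [apply cond_pos|]; intros y Hy; exact (Hd y Hy).
  - intros H; apply filterlim_locally; intros [eps He].
    destruct (H eps He) as [d [Hd0 Hd]]; exists (mkposreal d Hd0); intros y Hy; exact (Hd y Hy).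
Qed.

Lemma continuous_ex_RInt (f : R -> R) a b : (forall x, continuous f x) -> ex_RInt f a b.
Proof. intros H; apply (ex_RInt_continuous (V := R_CompleteNormedModule)); auto. Qed.

Lemma RInt_ext_R (f g : R -> R) a b : (forall x, f x = g x) -> RInt f a b = RInt g a b.
Proof. intro H; apply (RInt_ext (V := R_CompleteNormedModule)); intros; apply H. Qed.

Lemma RInt_ext_Ioo (f g : R -> R) a b : a <= b -> (forall x, a < x < b -> f x = g x) ->
  RInt f a b = RInt g a b.
Proof.
  intros Hab H; apply (RInt_ext (V := R_CompleteNormedModule)); intros x Hx.
  rewrite Rmin_left, Rmax_right in Hx by exact Hab. now apply H.
Qed.

Lemma RInt_nonneg_eq0 (f : R -> R) a b : a < b -> (forall x, continuous f x) ->
  (forall x, a <= x <= b -> 0 <= f x) -> RInt f a b = 0 -> forall x, a <= x <= b -> f x = 0.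
Proof.
  intros Hab Hc Hp Hi x Hx.
  destruct (Hp x Hx) as [Hlt|E]; [exfalso|easy].
  destruct (proj1 (continuous_R_iff f x) (Hc x) (f x) Hlt) as [d [Hd0 Hd]].
  set (u := Rmax a (x - d / 2)); set (v := Rmin b (x + d / 2)).
  assert (Hu : a <= u < v /\ v <= b /\ x - d < u /\ v < x + d).
  { unfold u, v, Rmax, Rmin; destruct (Rle_dec a (x - d / 2)), (Rle_dec b (x + d / 2)); lra. }
  assert (Hex : forall y z, ex_RInt f y z) by (intros; now apply continuous_ex_RInt).
  assert (E : RInt f a b = RInt f a u + (RInt f u v + RInt f v b)).
  { rewrite <- (RInt_Chasles f a u b), <- (RInt_Chasles f u v b) by auto. reflexivity. }
  assert (0 <= RInt f a u) by (apply RInt_ge_0; auto; [lra|intros; apply Hp; lra]).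
  assert (0 <= RInt f v b) by (apply RInt_ge_0; auto; [lra|intros; apply Hp; lra]).
  assert (0 < RInt f u v).
  { apply RInt_gt_0; auto; [lra|]. intros y Hy.
    assert (Hy2 : Rabs (y - x) < d) by (apply Rabs_lt_between; lra).
    specialize (Hd y Hy2). apply Rabs_lt_between in Hd; lra. }
  lra.
Qed.

Lemma continuous_bounded (f : R -> R) a b : a <= b -> (forall x, continuous f x) ->
  exists M, forall x, a <= x <= b -> Rabs (f x) <= M.
Proof.
  intros Hab Hc.
  assert (Hc2 : forall c, a <= c <= b -> continuity_pt (fun x => Rabs (f x)) c).
  { intros c _; apply continuity_pt_filterlim.
    apply (continuous_comp f Rabs); [apply Hc|apply continuous_Rabs]. }
  destruct (continuity_ab_maj _ a b Hab Hc2) as [m [Hm _]].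
  now exists (Rabs (f m)).
Qed.

Lemma continuity_2d_pt_iff (f : R -> R -> R) x y :
  continuity_2d_pt f x y <-> forall eps, 0 < eps -> exists d, 0 < d /\
    forall u v, Rabs (u - x) < d -> Rabs (v - y) < d -> Rabs (f u v - f x y) < eps.
Proof.
  split.
  - intros H eps He; destruct (H (mkposreal eps He)) as [d Hd]; exists d; split; [apply cond_pos|exact Hd].
  - intros H [eps He]; destruct (H eps He) as [d [Hd0 Hd]]; exists (mkposreal d Hd0); exact Hd.
Qed.

Lemma continuity_2d_row f x y : continuity_2d_pt f x y -> continuous (f x) y.
Proof.
  rewrite continuity_2d_pt_iff, continuous_R_iff; intros H eps He.
  destruct (H eps He) as [d [Hd0 Hd]]; exists d; split; [exact Hd0|].
  intros v Hv; apply Hd; [|exact Hv]. now rewrite Rminus_diag, Rabs_R0.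
Qed.

Lemma continuity_2d_swap f x y : continuity_2d_pt f x y -> continuity_2d_pt (fun u v => f v u) y x.
Proof.
  rewrite 2!continuity_2d_pt_iff; intros H eps He.
  destruct (H eps He) as [d [Hd0 Hd]]; exists d; split; [exact Hd0|]; auto.
Qed.

Lemma continuity_2d_col f x y : continuity_2d_pt f x y -> continuous (fun u => f u y) x.
Proof. intro H; now apply (continuity_2d_row (fun u v => f v u)), continuity_2d_swap. Qed.

Lemma continuity_2d_fst (f : R -> R) x y : continuous f x -> continuity_2d_pt (fun u _ => f u) x y.
Proof.
  rewrite continuity_2d_pt_iff, continuous_R_iff; intros H eps He.
  destruct (H eps He) as [d [Hd0 Hd]]; exists d; split; [exact Hd0|]; auto.
Qed.

(** Uniform continuity along the compact segment over [s0], which makes [d] independent of z. *)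
Lemma tube (k : R -> R -> R) a b s0 : (forall s z, continuity_2d_pt k s z) ->
  forall eps, 0 < eps -> exists d, 0 < d /\ forall s z, Rabs (s - s0) < d -> a <= z <= b ->
    Rabs (k s z - k s0 z) < eps.
Proof.
  intros Hk eps He.
  destruct (uniform_continuity_2d_1d' k a b s0 ltac:(auto) (mkposreal eps He)) as [d Hd].
  exists d; split; [apply cond_pos|]; intros s z Hs Hz.
  assert (H0 := cond_pos d).
  apply Rabs_lt_between in Hs.
  apply Hd; auto; try lra. now rewrite Rminus_diag, Rabs_R0.
Qed.

Lemma Rabs_RInt_le (f : R -> R) a b c : a <= b -> (forall x, continuous f x) ->
  (forall x, a <= x <= b -> Rabs (f x) <= c) -> Rabs (RInt f a b) <= (b - a) * c.
Proof.
  intros Hab Hc H. apply (norm_RInt_le_const (V := R_NormedModule) f a b _ c); auto.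
  exact (RInt_correct (V := R_CompleteNormedModule) f a b (continuous_ex_RInt f a b Hc)).
Qed.

Lemma continuity_2d_RInt_comp (k l : R -> R -> R) a b : a <= b ->
  (forall s z, continuity_2d_pt k s z) -> (forall z t, continuity_2d_pt l z t) ->
  forall s t, continuity_2d_pt (fun s t => RInt (fun z => k s z * l z t) a b) s t.
Proof.
  intros Hab Hk Hl s0 t0; apply continuity_2d_pt_iff; intros eps He.
  assert (Hkr : forall s z, continuous (k s) z) by (intros; now apply continuity_2d_row).
  assert (Hlc : forall t z, continuous (fun z => l z t) z) by (intros; now apply continuity_2d_col).
  destruct (continuous_bounded (k s0) a b Hab (Hkr s0)) as [M HM].
  destruct (continuous_bounded (fun z => l z t0) a b Hab (Hlc t0)) as [N HN].
  assert (HM0 : 0 <= M) by (eapply Rle_trans; [apply Rabs_pos|apply (HM a); lra]).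
  assert (HN0 : 0 <= N) by (eapply Rle_trans; [apply Rabs_pos|apply (HN a); lra]).
  set (B := (b - a) * (M + N + 1) + 1).
  assert (HB : 0 < B) by (unfold B; assert (0 <= (b - a) * (M + N + 1)) by (apply Rmult_le_pos; lra); lra).
  (* The bound h <= 1 linearises the product of the two increments: the integrand then changes by at
     most h (1 + N + M). *)
  set (h := Rmin 1 (eps / (2 * B))).
  assert (Hh : 0 < h) by (apply Rmin_pos; [lra|apply Rdiv_lt_0_compat; lra]).
  assert (Hh1 : h <= 1) by apply Rmin_l.
  assert (Hh2 : h * B <= eps / 2).
  { replace (eps / 2) with (eps / (2 * B) * B) by (field; lra).
    apply Rmult_le_compat_r; [lra|apply Rmin_r]. }
  destruct (tube k a b s0 Hk h Hh) as [d1 [Hd1 H1]].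
  destruct (tube (fun t z => l z t) a b t0 (fun t z => continuity_2d_swap l z t (Hl z t)) h Hh) as [d2 [Hd2 H2]].
  exists (Rmin d1 d2); split; [now apply Rmin_pos|].
  intros s t Hs Ht.
  assert (Hs1 : Rabs (s - s0) < d1) by (eapply Rlt_le_trans; [exact Hs|apply Rmin_l]).
  assert (Ht1 : Rabs (t - t0) < d2) by (eapply Rlt_le_trans; [exact Ht|apply Rmin_r]).
  assert (Hcont : forall s t z, continuous (fun z => k s z * l z t) z).
  { intros; now apply (continuous_mult (K := R_AbsRing)). }
  rewrite <- (RInt_minus (V := R_CompleteNormedModule)) by (apply continuous_ex_RInt; auto).
  apply Rle_lt_trans with ((b - a) * (h * (M + N + 1))).
  - apply Rabs_RInt_le; auto.
    + intro z; now apply (continuous_minus (K := R_AbsRing) (V := R_NormedModule)).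
    + intros z Hz.
      specialize (H1 s z Hs1 Hz). specialize (H2 t z Ht1 Hz). specialize (HM z Hz). specialize (HN z Hz).
      simpl in H2, HN.
      change (Rabs (k s z * l z t - k s0 z * l z t0) <= h * (M + N + 1)).
      replace (k s z * l z t - k s0 z * l z t0) with
        ((k s z - k s0 z) * (l z t - l z t0) + ((k s z - k s0 z) * l z t0 + k s0 z * (l z t - l z t0)))
        by ring.
      eapply Rle_trans; [apply Rabs_triang|].
      eapply Rle_trans; [apply Rplus_le_compat_l, Rabs_triang|].
      rewrite !Rabs_mult.
      assert (A1 := Rabs_pos (k s z - k s0 z)). assert (A2 := Rabs_pos (l z t - l z t0)).
      assert (A3 := Rabs_pos (l z t0)). assert (A4 := Rabs_pos (k s0 z)).
      assert (Rabs (k s z - k s0 z) * Rabs (l z t - l z t0) <= h * 1) by (apply Rmult_le_compat; lra).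
      assert (Rabs (k s z - k s0 z) * Rabs (l z t0) <= h * N) by (apply Rmult_le_compat; lra).
      assert (Rabs (k s0 z) * Rabs (l z t - l z t0) <= M * h) by (apply Rmult_le_compat; lra).
      lra.
  - unfold B in Hh2. nra.
Qed.

Lemma continuous_RInt_row (k : R -> R -> R) a b : a <= b -> (forall s z, continuity_2d_pt k s z) ->
  forall s, continuous (fun s => RInt (k s) a b) s.
Proof.
  intros Hab Hk s.
  apply continuous_ext with (fun s => RInt (fun z => k s z * 1) a b).
  - intro u; apply RInt_ext_R; intros; ring.
  - apply (continuity_2d_col (fun s t => RInt (fun z => k s z * 1) a b) s 0).
    apply (continuity_2d_RInt_comp k (fun _ _ => 1)); auto.
    intros; apply continuity_2d_pt_const.
Qed.

Lemma is_derive_RInt_upper (f : R -> R) a x : (forall x, continuous f x) ->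
  is_derive (fun x => RInt f a x) x (f x).
Proof.
  intro H; apply (is_derive_RInt (V := R_NormedModule) f (fun x => RInt f a x) a x); auto.
  exists posreal_one; intros y _.
  exact (RInt_correct (V := R_CompleteNormedModule) f a y (continuous_ex_RInt f a y H)).
Qed.

(** As functions of the upper limit x in place of b, both sides vanish at a and have the same
    derivative; one of them is differentiated under the integral sign. *)
Lemma RInt_fubini (f : R -> R -> R) a b c d : a < b -> c <= d -> (forall s t, continuity_2d_pt f s t) ->
  RInt (fun s => RInt (fun t => f s t) c d) a b = RInt (fun t => RInt (fun s => f s t) a b) c d.
Proof.
  intros Hab Hcd Hf.
  assert (Hcol : forall t s, continuous (fun s => f s t) s) by (intros; now apply continuity_2d_col).
  set (G := fun x => RInt (fun t => RInt (fun s => f s t) a x) c d : R).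
  set (H := fun x => RInt (fun s => RInt (fun t => f s t) c d) a x : R).
  assert (HG : forall x, a <= x -> is_derive G x (RInt (fun t => f x t) c d)).
  { intros x Hx.
    assert (Ht : forall t u, is_derive (fun x => RInt (fun s => f s t) a x) u (f u t)).
    { intros t u; now apply (is_derive_RInt_upper (fun s => f s t)). }
    rewrite (RInt_ext_R _ (fun t => Derive (fun u => RInt (fun s => f s t) a u) x)).
    2: { intro t; symmetry; now apply is_derive_unique. }
    apply (is_derive_RInt_param (fun x t => RInt (fun s => f s t) a x)).
    - exists posreal_one; intros y _ t _; eexists; apply Ht.
    - intros t _; apply continuity_2d_pt_ext with f; [|apply Hf].
      intros u v; symmetry; now apply is_derive_unique.
    - exists posreal_one; intros y _. apply continuous_ex_RInt; intro t.
      (* Differentiation at x = a also involves points y to the left of a. *)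
      destruct (Rle_dec a y) as [Hy|Hy].
      + apply (continuous_RInt_row (fun t s => f s t)); auto using continuity_2d_swap.
      + apply continuous_ext with (fun t => - RInt (fun s => f s t) y a).
        * intro u. rewrite <- (opp_RInt_swap (fun s => f s u)); [apply Ropp_involutive|].
          now apply continuous_ex_RInt.
        * apply (continuous_opp (K := R_AbsRing) (V := R_NormedModule)).
          apply (continuous_RInt_row (fun t s => f s t)); [lra|auto using continuity_2d_swap]. }
  assert (HH : forall x, is_derive H x (RInt (fun t => f x t) c d)).
  { intro x; apply (is_derive_RInt_upper (fun s => RInt (fun t => f s t) c d)).
    now apply (continuous_RInt_row (fun s t => f s t)). }
  assert (E : G a - H a = G b - H b).
  { apply (eq_is_derive (V := R_NormedModule) (fun x => minus (G x) (H x)) a b); [|exact Hab]. intros x Hx.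
    assert (Hd := is_derive_minus (V := R_NormedModule) G H x _ _ (HG x (proj1 Hx)) (HH x)).
    now rewrite minus_eq_zero in Hd. }
  assert (Ea : G a - H a = 0).
  { unfold G, H; rewrite RInt_point.
    rewrite (RInt_ext_R _ (fun _ => 0)) by (intros; apply (RInt_point (V := R_CompleteNormedModule))).
    rewrite RInt_const. change ((d - c) * 0 - 0 = 0); ring. }
  change (H b = G b). lra.
Qed.

Lemma continuity_2d_lim (k : nat -> R -> R -> R) l x y : (forall n, continuity_2d_pt (k n) x y) ->
  (forall eps, 0 < eps -> exists n, forall u v, Rabs (k n u v - l u v) < eps) ->
  continuity_2d_pt l x y.
Proof.
  intros Hk Hl; apply continuity_2d_pt_iff; intros eps He.
  destruct (Hl (eps / 3)) as [n Hn]; [lra|].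
  destruct (proj1 (continuity_2d_pt_iff _ _ _) (Hk n) (eps / 3)) as [d [Hd0 Hd]]; [lra|].
  exists d; split; [exact Hd0|]; intros u v Hu Hv.
  specialize (Hd u v Hu Hv). assert (A := Hn u v). assert (B := Hn x y).
  apply Rabs_lt_between in Hd, A, B. apply Rabs_lt_between; lra.
Qed.

(** * The integration space of two weighted intervals *)

Section TwoIntervals.
Variables lo hi w : bool -> R.
Hypothesis lo_lt_hi : forall b, lo b < hi b.
Hypothesis w_pos : forall b, 0 < w b.

Definition clamp b t := Rmax (lo b) (Rmin (hi b) t).

Lemma clamp_in b t : lo b <= clamp b t <= hi b.
Proof.
  unfold clamp, Rmax, Rmin; specialize (lo_lt_hi b).
  destruct (Rle_dec (hi b) t);
  repeat match goal with |- context [Rle_dec ?a ?c] => destruct (Rle_dec a c) end; lra.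
Qed.

Lemma clamp_id b t : lo b <= t <= hi b -> clamp b t = t.
Proof.
  unfold clamp, Rmax, Rmin; intros [H1 H2].
  destruct (Rle_dec (hi b) t);
  repeat match goal with |- context [Rle_dec ?a ?c] => destruct (Rle_dec a c) end; lra.
Qed.

Lemma clamp_idem b t : clamp b (clamp b t) = clamp b t.
Proof. apply clamp_id, clamp_in. Qed.

Lemma clamp_continuous b t : continuous (clamp b) t.
Proof.
  apply continuous_R_iff; intros eps He; exists eps; split; [exact He|]; intros u Hu.
  eapply Rle_lt_trans; [|exact Hu].
  unfold clamp, Rmax, Rmin, Rabs; specialize (lo_lt_hi b).
  destruct (Rle_dec (hi b) t), (Rle_dec (hi b) u);
  repeat match goal with |- context [Rle_dec ?a ?c] => destruct (Rle_dec a c)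
    | |- context [Rcase_abs ?a] => destruct (Rcase_abs a) end; lra.
Qed.

(** The tag keeps the intervals apart: a common endpoint becomes two points, later 0- and 0+, and
    each piece can be closed. *)
Let X := (bool * R)%type.

(* Functions are extended constantly beyond the endpoints, so that they are
   continuous on all of R. *)
Definition pc_fun (f : X -> R) : Prop :=
  (forall b t, continuous (fun t => f (b, t)) t) /\ (forall b t, f (b, clamp b t) = f (b, t)).

Definition pc_kern (k : X -> X -> R) : Prop :=
  (forall b b' s t, continuity_2d_pt (fun s t => k (b, s) (b', t)) s t) /\
  (forall b b' s t, k (b, clamp b s) (b', clamp b' t) = k (b, s) (b', t)).

Definition pc_intg (f : X -> R) : R :=
  w true * RInt (fun t => f (true, t)) (lo true) (hi true) +
  w false * RInt (fun t => f (false, t)) (lo false) (hi false).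

Lemma pc_kern_clamp_l k b s y : pc_kern k -> k (b, clamp b s) y = k (b, s) y.
Proof.
  destruct y as [b' t]; intros [_ H].
  rewrite <- (H b b' (clamp b s) t), <- (H b b' s t). now rewrite clamp_idem.
Qed.

Lemma pc_kern_clamp_r k x b t : pc_kern k -> k x (b, clamp b t) = k x (b, t).
Proof.
  destruct x as [b' s]; intros [_ H].
  rewrite <- (H b' b s (clamp b t)), <- (H b' b s t). now rewrite clamp_idem.
Qed.

Lemma pc_fun_const c : pc_fun (fun _ => c).
Proof. split; auto. intros; apply continuous_const. Qed.

Lemma pc_fun_plus f g : pc_fun f -> pc_fun g -> pc_fun (fun x => f x + g x).
Proof.
  intros [Hf Hf'] [Hg Hg']; split; intros b t; [|now rewrite Hf', Hg'].
  now apply (continuous_plus (K := R_AbsRing) (V := R_NormedModule)).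
Qed.

Lemma pc_fun_mult f g : pc_fun f -> pc_fun g -> pc_fun (fun x => f x * g x).
Proof.
  intros [Hf Hf'] [Hg Hg']; split; intros b t; [|now rewrite Hf', Hg'].
  now apply (continuous_mult (K := R_AbsRing)).
Qed.

Lemma pc_fun_bounded f : pc_fun f -> exists M, forall x, Rabs (f x) <= M.
Proof.
  intros [Hf Hf'].
  assert (Hb : forall b, exists M, forall t, Rabs (f (b, t)) <= M).
  { intro b. destruct (continuous_bounded (fun t => f (b, t)) (lo b) (hi b)) as [M HM].
    - left; auto.
    - auto.
    - exists M; intro t; rewrite <- Hf'; apply HM, clamp_in. }
  destruct (Hb true) as [M HM], (Hb false) as [N HN].
  exists (Rmax M N); intros [[|] t].
  - eapply Rle_trans; [apply HM|apply Rmax_l].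
  - eapply Rle_trans; [apply HN|apply Rmax_r].
Qed.

Lemma pc_kern_row k x : pc_kern k -> pc_fun (k x).
Proof.
  destruct x as [b s]; intro H; split; intros b' t.
  - apply (continuity_2d_row (fun s t => k (b, s) (b', t))), H.
  - now apply pc_kern_clamp_r.
Qed.

Lemma pc_kern_swap k : pc_kern k -> pc_kern (fun x y => k y x).
Proof.
  intro H; split; intros b b' s t.
  - apply (continuity_2d_swap (fun t s => k (b', t) (b, s))), H.
  - apply H.
Qed.

Lemma pc_kern_diag k : pc_kern k -> pc_fun (fun x => k x x).
Proof.
  intros [H1 H2]; split; intros b t; [|apply H2].
  apply continuous_R_iff; intros eps He.
  destruct (proj1 (continuity_2d_pt_iff _ _ _) (H1 b b t t) eps He) as [d [Hd0 Hd]].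
  exists d; split; auto.
Qed.

Lemma pc_kern_fst f : pc_fun f -> pc_kern (fun x _ => f x).
Proof. intros [H1 H2]; split; intros; [|apply H2]. now apply continuity_2d_fst. Qed.

Lemma pc_kern_plus k l : pc_kern k -> pc_kern l -> pc_kern (fun x y => k x y + l x y).
Proof.
  intros [H1 H2] [H3 H4]; split; intros; [|now rewrite H2, H4].
  now apply continuity_2d_pt_plus.
Qed.

Lemma pc_kern_mult k l : pc_kern k -> pc_kern l -> pc_kern (fun x y => k x y * l x y).
Proof.
  intros [H1 H2] [H3 H4]; split; intros; [|now rewrite H2, H4].
  now apply continuity_2d_pt_mult.
Qed.

Lemma pc_kern_comp k l : pc_kern k -> pc_kern l ->
  pc_kern (fun x y => pc_intg (fun z => k x z * l z y)).
Proof.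
  intros Hk Hl; split; intros b b' s t.
  - unfold pc_intg; apply continuity_2d_pt_plus; apply continuity_2d_pt_mult;
      try apply continuity_2d_pt_const;
      match goal with |- continuity_2d_pt (fun s t => RInt _ (lo ?c) _) _ _ =>
      apply (continuity_2d_RInt_comp (fun s z => k (b, s) (c, z)) (fun z t => l (c, z) (b', t))) end;
      solve [left; auto|intros; apply Hk|intros; apply Hl].
  - f_equal; apply functional_extensionality; intro z.
    now rewrite (pc_kern_clamp_l k), (pc_kern_clamp_r l).
Qed.

Lemma pc_kern_lim (k : nat -> X -> X -> R) l : (forall n, pc_kern (k n)) ->
  (forall eps, 0 < eps -> exists n, forall x y, Rabs (k n x y - l x y) < eps) -> pc_kern l.
Proof.
  intros Hk Hl; split; intros b b' s t.
  - apply (continuity_2d_lim (fun n s t => k n (b, s) (b', t))); [intro n; apply Hk|].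
    intros eps He; destruct (Hl eps He) as [n Hn]; exists n; auto.
  - apply cond_eq; intros eps He.
    destruct (Hl (eps / 2)) as [n Hn]; [lra|].
    assert (A := Hn (b, clamp b s) (b', clamp b' t)). assert (B := Hn (b, s) (b', t)).
    rewrite (proj2 (Hk n)) in A.
    apply Rabs_lt_between in A, B. apply Rabs_lt_between; lra.
Qed.

Lemma pc_intg_plus f g : pc_fun f -> pc_fun g ->
  pc_intg (fun x => f x + g x) = pc_intg f + pc_intg g.
Proof.
  intros [Hf _] [Hg _]; unfold pc_intg.
  rewrite 2!(RInt_plus (V := R_CompleteNormedModule)) by (apply continuous_ex_RInt; auto).
  unfold plus; simpl; ring.
Qed.

Lemma pc_intg_scal c f : pc_fun f -> pc_intg (fun x => c * f x) = c * pc_intg f.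
Proof.
  intros [Hf _]; unfold pc_intg.
  rewrite 2!(RInt_scal (V := R_CompleteNormedModule)) by (apply continuous_ex_RInt; auto).
  unfold scal; simpl; unfold mult; simpl; ring.
Qed.

Lemma pc_RInt_ge0 f b : pc_fun f -> (forall x, 0 <= f x) ->
  0 <= w b * RInt (fun t => f (b, t)) (lo b) (hi b).
Proof.
  intros [Hf _] H; apply Rmult_le_pos; [left; auto|].
  apply RInt_ge_0; auto; [left; auto|now apply continuous_ex_RInt].
Qed.

Lemma pc_intg_ge0 f : pc_fun f -> (forall x, 0 <= f x) -> 0 <= pc_intg f.
Proof. intros Hf H; apply Rplus_le_le_0_compat; now apply pc_RInt_ge0. Qed.

(** The integral sees the intervals only; the constant extension carries the conclusion to all
    tagged points. *)
Lemma pc_intg_eq0 f : pc_fun f -> (forall x, 0 <= f x) -> pc_intg f = 0 -> forall x, f x = 0.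
Proof.
  intros Hf H E [b t]; rewrite <- (proj2 Hf).
  assert (Hb : w b * RInt (fun t => f (b, t)) (lo b) (hi b) = 0).
  { assert (A := pc_RInt_ge0 f true Hf H). assert (B := pc_RInt_ge0 f false Hf H).
    unfold pc_intg in E. destruct b; lra. }
  apply (RInt_nonneg_eq0 (fun t => f (b, t)) (lo b) (hi b)); auto.
  - apply Hf.
  - apply (Rmult_eq_reg_l (w b)); [lra|apply Rgt_not_eq, w_pos].
  - apply clamp_in.
Qed.

Lemma pc_fubini k : pc_kern k ->
  pc_intg (fun x => pc_intg (fun y => k x y)) = pc_intg (fun y => pc_intg (fun x => k x y)).
Proof.
  intros [Hk _].
  assert (Hlin : forall (f g : R -> R) c d b, (forall t, continuous f t) -> (forall t, continuous g t) ->
    RInt (fun t => c * f t + d * g t) (lo b) (hi b) =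
    c * RInt f (lo b) (hi b) + d * RInt g (lo b) (hi b)).
  { intros f g c d b Hf Hg.
    rewrite (RInt_plus (V := R_CompleteNormedModule) (fun t => c * f t) (fun t => d * g t)).
    - rewrite 2!(RInt_scal (V := R_CompleteNormedModule)) by (apply continuous_ex_RInt; auto).
      reflexivity.
    - apply continuous_ex_RInt; intro t; now apply (continuous_scal_r (K := R_AbsRing) (V := R_NormedModule)).
    - apply continuous_ex_RInt; intro t; now apply (continuous_scal_r (K := R_AbsRing) (V := R_NormedModule)). }
  unfold pc_intg.
  (* The double integral splits into four rectangles, one for each pair of intervals. *)
  set (F := fun b b' s => RInt (fun t => k (b, s) (b', t)) (lo b') (hi b') : R).
  set (G := fun b b' t => RInt (fun s => k (b, s) (b', t)) (lo b) (hi b) : R).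
  assert (HF : forall b b' s, continuous (F b b') s).
  { intros b b' s; apply (continuous_RInt_row (fun s t => k (b, s) (b', t))); [left; auto|intros; apply Hk]. }
  assert (HG : forall b b' t, continuous (G b b') t).
  { intros b b' t; apply (continuous_RInt_row (fun t s => k (b, s) (b', t))); [left; auto|].
    intros; apply (continuity_2d_swap (fun s t => k (b, s) (b', t))), Hk. }
  assert (HFG : forall b b', RInt (F b b') (lo b) (hi b) = RInt (G b b') (lo b') (hi b')).
  { intros b b'; apply (RInt_fubini (fun s t => k (b, s) (b', t))); auto. left; auto. }
  change (w true * RInt (fun t => w true * F true true t + w false * F true false t) (lo true) (hi true) +
    w false * RInt (fun t => w true * F false true t + w false * F false false t) (lo false) (hi false) =
    w true * RInt (fun t => w true * G true true t + w false * G false true t) (lo true) (hi true) +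
    w false * RInt (fun t => w true * G true false t + w false * G false false t) (lo false) (hi false)).
  rewrite (Hlin (F true true) (F true false)), (Hlin (F false true) (F false false)),
    (Hlin (G true true) (G false true)), (Hlin (G true false) (G false false)), 4!HFG by auto.
  ring.
Qed.

Definition two_interval_space : ispace := {|
  pt := X; intg := pc_intg; cfun := pc_fun; ckern := pc_kern;
  cfun_const := pc_fun_const; cfun_plus := pc_fun_plus; cfun_mult := pc_fun_mult;
  cfun_bounded := pc_fun_bounded; ckern_row := pc_kern_row; ckern_diag := pc_kern_diag;
  ckern_swap := pc_kern_swap; ckern_fst := pc_kern_fst; ckern_plus := pc_kern_plus;
  ckern_mult := pc_kern_mult; ckern_comp := pc_kern_comp; ckern_lim := pc_kern_lim;
  intg_plus := pc_intg_plus; intg_scal := pc_intg_scal; intg_ge0 := pc_intg_ge0;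
  intg_eq0 := pc_intg_eq0; intg_fubini := pc_fubini |}.

Lemma pc_fun_clamp (f : bool -> R -> R) : (forall b t, continuous (f b) t) ->
  pc_fun (fun x => f (fst x) (clamp (fst x) (snd x))).
Proof.
  intro Hf; split; intros b t; simpl; [|now rewrite clamp_idem].
  apply (continuous_comp (clamp b) (f b)); [apply clamp_continuous|apply Hf].
Qed.

Lemma pc_kern_clamp (k : bool -> bool -> R -> R -> R) :
  (forall b b' s t, continuity_2d_pt (k b b') s t) ->
  pc_kern (fun x y => k (fst x) (fst y) (clamp (fst x) (snd x)) (clamp (fst y) (snd y))).
Proof.
  intro Hk; split; intros b b' s t; simpl; [|now rewrite !clamp_idem].
  apply continuity_2d_pt_iff; intros eps He.
  destruct (proj1 (continuity_2d_pt_iff _ _ _) (Hk b b' (clamp b s) (clamp b' t)) eps He) as [d [Hd0 Hd]].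
  destruct (proj1 (continuous_R_iff _ _) (clamp_continuous b s) d Hd0) as [d1 [Hd1 H1]].
  destruct (proj1 (continuous_R_iff _ _) (clamp_continuous b' t) d Hd0) as [d2 [Hd2 H2]].
  exists (Rmin d1 d2); split; [now apply Rmin_pos|]; intros u v Hu Hv.
  apply Hd; [apply H1|apply H2]; (eapply Rlt_le_trans; [eassumption|]); [apply Rmin_l|apply Rmin_r].
Qed.

End TwoIntervals.

(** * Twice continuously differentiable functions *)

Lemma der_eq (f : R -> R) (x a b : R) : is_derive f x a -> a = b -> is_derive f x b.
Proof. now intros H <-. Qed.

Lemma der_plus (f g : R -> R) (x a b : R) : is_derive f x a -> is_derive g x b ->
  is_derive (fun t => f t + g t) x (a + b).
Proof. exact (is_derive_plus (V := R_NormedModule) f g x a b). Qed.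

Lemma der_mult (f g : R -> R) (x a b : R) : is_derive f x a -> is_derive g x b ->
  is_derive (fun t => f t * g t) x (a * g x + f x * b).
Proof. intros; apply (is_derive_mult (K := R_AbsRing) f g x a b); auto. exact Rmult_comm. Qed.

Lemma der_const (c x : R) : is_derive (fun _ : R => c) x 0.
Proof. exact (is_derive_const (V := R_NormedModule) c x). Qed.

Lemma der_scal (f : R -> R) (c x a : R) : is_derive f x a -> is_derive (fun t => c * f t) x (c * a).
Proof. intro H; eapply der_eq; [apply der_mult; [apply der_const|exact H]|cbv beta; ring]. Qed.

Lemma der_continuous (f : R -> R) x a : is_derive f x a -> continuous f x.
Proof. intro H; apply (ex_derive_continuous (V := R_NormedModule)); now exists a. Qed.

Lemma con_plus (f g : R -> R) x : continuous f x -> continuous g x -> continuous (fun t => f t + g t) x.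
Proof. exact (continuous_plus (K := R_AbsRing) (V := R_NormedModule) f g x). Qed.

Lemma con_mult (f g : R -> R) x : continuous f x -> continuous g x -> continuous (fun t => f t * g t) x.
Proof. exact (continuous_mult (K := R_AbsRing) f g x). Qed.

Lemma con_const (c x : R) : continuous (fun _ : R => c) x.
Proof. apply continuous_const. Qed.

Lemma RInt_der (f df : R -> R) a b : (forall x, is_derive f x (df x)) -> (forall x, continuous df x) ->
  RInt df a b = f b - f a.
Proof.
  intros H Hc; apply is_RInt_unique.
  apply (is_RInt_derive (V := R_CompleteNormedModule) f df a b); auto.
Qed.

Lemma RInt_plus_R (f g : R -> R) a b : (forall x, continuous f x) -> (forall x, continuous g x) ->
  RInt (fun t => f t + g t) a b = RInt f a b + RInt g a b.
Proof. intros; apply (RInt_plus (V := R_CompleteNormedModule)); now apply continuous_ex_RInt. Qed.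

Lemma RInt_scal_R c (f : R -> R) a b : (forall x, continuous f x) ->
  RInt (fun t => c * f t) a b = c * RInt f a b.
Proof. intros; apply (RInt_scal (V := R_CompleteNormedModule)); now apply continuous_ex_RInt. Qed.

Lemma RInt_le_R (f g : R -> R) a b : a <= b -> (forall x, continuous f x) -> (forall x, continuous g x) ->
  (forall x, a <= x <= b -> f x <= g x) -> RInt f a b <= RInt g a b.
Proof.
  intros Hab Hf Hg H; apply RInt_le; auto; try now apply continuous_ex_RInt.
  intros; apply H; lra.
Qed.

Lemma RInt_ge0_R (f : R -> R) a b : a <= b -> (forall x, continuous f x) ->
  (forall x, a <= x <= b -> 0 <= f x) -> 0 <= RInt f a b.
Proof.
  intros Hab Hf H; apply RInt_ge_0; auto; try now apply continuous_ex_RInt.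
  intros; apply H; lra.
Qed.

Lemma RInt_Chasles_R (f : R -> R) a b c : (forall x, continuous f x) ->
  RInt f a b + RInt f b c = RInt f a c.
Proof. intros; apply (RInt_Chasles (V := R_CompleteNormedModule)); now apply continuous_ex_RInt. Qed.

(** Derivatives are bundled and total, so calculus has no side conditions on domains; differential
    equations are imposed separately, on the closed intervals. *)
Record c2 := MkC2 {
  v0 : R -> R; v1 : R -> R; v2 : R -> R;
  v0_der : forall x, is_derive v0 x (v1 x);
  v1_der : forall x, is_derive v1 x (v2 x);
  v2_con : forall x, continuous v2 x }.

Lemma v0_con f x : continuous (v0 f) x.
Proof. exact (der_continuous _ _ _ (v0_der f x)). Qed.

Lemma v1_con f x : continuous (v1 f) x.
Proof. exact (der_continuous _ _ _ (v1_der f x)). Qed.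

Ltac con := lazymatch goal with
  | |- continuous (fun t => @?f t + @?g t) _ => apply (con_plus f g); cbv beta; con
  | |- continuous (fun t => @?f t * @?g t) _ => apply (con_mult f g); cbv beta; con
  | |- continuous (fun _ => ?c) _ => apply con_const
  | |- continuous (fun t => v0 ?f t) _ => apply v0_con
  | |- continuous (fun t => v1 ?f t) _ => apply v1_con
  | |- continuous (fun t => v2 ?f t) _ => apply v2_con
  | |- continuous (v0 ?f) _ => apply v0_con
  | |- continuous (v1 ?f) _ => apply v1_con
  | |- continuous (v2 ?f) _ => apply v2_con
  | |- _ => try solve [auto]
  end.

Ltac der := lazymatch goal with
  | |- is_derive (fun t => @?f t + @?g t) _ _ => eapply (der_plus f g); cbv beta; der
  | |- is_derive (fun t => @?f t * @?g t) _ _ => eapply (der_mult f g); cbv beta; der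
  | |- is_derive (fun _ => ?c) _ _ => eapply der_const
  | |- is_derive (fun t => v0 ?f t) _ _ => apply v0_der
  | |- is_derive (fun t => v1 ?f t) _ _ => apply v1_der
  | |- is_derive (v0 ?f) _ _ => apply v0_der
  | |- is_derive (v1 ?f) _ _ => apply v1_der
  | |- _ => eauto
  end.

Definition c2_lin (a : R) (f : c2) (b : R) (g : c2) : c2.
Proof.
  refine (MkC2 (fun x => a * v0 f x + b * v0 g x) (fun x => a * v1 f x + b * v1 g x)
            (fun x => a * v2 f x + b * v2 g x) _ _ _); intro x.
  - eapply der_eq; [der|cbv beta; ring].
  - eapply der_eq; [der|cbv beta; ring].
  - con.
Defined.

Lemma RInt_by_parts (f g : c2) a b :
  RInt (fun t => v2 f t * v0 g t) a b =
  (v1 f b * v0 g b - v1 f a * v0 g a) - RInt (fun t => v1 f t * v1 g t) a b.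
Proof.
  assert (E : RInt (fun t => v2 f t * v0 g t + v1 f t * v1 g t) a b = v1 f b * v0 g b - v1 f a * v0 g a).
  { apply (RInt_der (fun t => v1 f t * v0 g t) (fun t => v2 f t * v0 g t + v1 f t * v1 g t)); intro x; [|con].
    eapply der_eq; [der|cbv beta; ring]. }
  rewrite RInt_plus_R in E by (intro; con). lra.
Qed.

(** A one-dimensional Sobolev inequality: f(t)^2 - f(s)^2 is the integral of 2 f f', estimated by
    eps f'^2 + f^2 / eps. Averaging over s contributes the term with 1 / (b - a). *)
Lemma sup_sq_le (f : c2) a b eps t : a < b -> 0 < eps -> a <= t <= b ->
  (v0 f t)² <= eps * RInt (fun t => (v1 f t)²) a b + (/ eps + / (b - a)) * RInt (fun t => (v0 f t)²) a b.
Proof.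
  intros Hab He Ht.
  set (h := fun t => eps * (v1 f t)² + / eps * (v0 f t)²).
  assert (Hsq : forall x, continuous (fun t => (v0 f t)²) x) by (intro; unfold Rsqr; con).
  assert (Hsq1 : forall x, continuous (fun t => (v1 f t)²) x) by (intro; unfold Rsqr; con).
  assert (Hh : forall x, continuous h x) by (intro; unfold h; con).
  assert (Hhp : forall x, 0 <= h x).
  { intro x; unfold h; assert (A := Rle_0_sqr (v1 f x)). assert (B := Rle_0_sqr (v0 f x)).
    assert (0 < / eps) by now apply Rinv_0_lt_compat. apply Rplus_le_le_0_compat; apply Rmult_le_pos; lra. }
  assert (Hhab : forall x, Rabs (2 * (v0 f x * v1 f x)) <= h x).
  { intro x; unfold h. set (u := v0 f x); set (v := v1 f x).
    assert (Hi : 0 < / eps) by now apply Rinv_0_lt_compat.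
    assert (A : 0 <= / eps * (eps * v - u)²) by (apply Rmult_le_pos; [lra|apply Rle_0_sqr]).
    assert (B : 0 <= / eps * (eps * v + u)²) by (apply Rmult_le_pos; [lra|apply Rle_0_sqr]).
    replace (/ eps * (eps * v - u)²) with (eps * v² + / eps * u² - 2 * (u * v)) in A by (unfold Rsqr; field; lra).
    replace (/ eps * (eps * v + u)²) with (eps * v² + / eps * u² + 2 * (u * v)) in B by (unfold Rsqr; field; lra).
    apply Rabs_le; lra. }
  set (J := RInt h a b).
  assert (Hder : forall s t, s <= t -> RInt (fun x => 2 * (v0 f x * v1 f x)) s t = (v0 f t)² - (v0 f s)²).
  { intros s u _; apply (RInt_der (fun t => (v0 f t)²) (fun x => 2 * (v0 f x * v1 f x))); intro x; [|con].
    unfold Rsqr; eapply der_eq; [der|cbv beta; ring]. }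
  assert (Hsub : forall s u, a <= s -> s <= u -> u <= b -> RInt h s u <= J).
  { intros s u H1 H2 H3; unfold J.
    rewrite <- (RInt_Chasles_R h a s b), <- (RInt_Chasles_R h s u b) by auto.
    assert (0 <= RInt h a s) by (apply RInt_ge0_R; auto).
    assert (0 <= RInt h u b) by (apply RInt_ge0_R; auto). lra. }
  assert (Hst : forall s, a <= s <= b -> (v0 f t)² <= (v0 f s)² + J).
  { intros s Hs; destruct (Rle_dec s t) as [Hle|Hle].
    - assert (A := Hder s t Hle). assert (B := Hsub s t (proj1 Hs) Hle (proj2 Ht)).
      assert (RInt (fun x => 2 * (v0 f x * v1 f x)) s t <= RInt h s t); [|lra].
      apply RInt_le_R; auto; [intro; con|]. intros x _; specialize (Hhab x). apply Rabs_le_between in Hhab; lra.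
    - assert (Hle' : t <= s) by lra.
      assert (A := Hder t s Hle'). assert (B := Hsub t s (proj1 Ht) Hle' (proj2 Hs)).
      assert (RInt (fun x => (-1) * (2 * (v0 f x * v1 f x))) t s <= RInt h t s).
      { apply RInt_le_R; auto; [intro; con|]. intros x _; specialize (Hhab x). apply Rabs_le_between in Hhab; lra. }
      rewrite RInt_scal_R in H by (intro; con). lra. }
  (* Average over s. *)
  assert (A : RInt (fun _ => (v0 f t)²) a b <= RInt (fun s => (v0 f s)² + J) a b).
  { apply RInt_le_R; auto; [lra|intro; con|intro; con]. }
  rewrite RInt_plus_R, 2!RInt_const in A by (auto; intro; con).
  change ((b - a) * (v0 f t)² <= RInt (fun t => (v0 f t)²) a b + (b - a) * J) in A.
  assert (EJ : J = eps * RInt (fun t => (v1 f t)²) a b + / eps * RInt (fun t => (v0 f t)²) a b).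
  { unfold J, h; rewrite RInt_plus_R, 2!RInt_scal_R by (intro; con). reflexivity. }
  assert (0 < b - a) by lra.
  apply (Rmult_le_reg_l (b - a)); [lra|].
  eapply Rle_trans; [exact A|]. rewrite EJ. right; field; lra.
Qed.

Lemma nonneg_derive_le (f df : R -> R) a b : a <= b -> (forall x, is_derive f x (df x)) ->
  (forall x, a <= x <= b -> 0 <= df x) -> f a <= f b.
Proof.
  intros Hab Hd Hp. destruct (MVT_gen f a b df) as [c [Hc E]].
  - intros x _; apply Hd.
  - intros x _; apply continuity_pt_filterlim. exact (der_continuous _ _ _ (Hd x)).
  - rewrite Rmin_left, Rmax_right in Hc by lra.
    assert (0 <= df c * (b - a)) by (apply Rmult_le_pos; [auto|lra]). lra.
Qed.

(* Gronwall: [|E'| <= N E] for [E = u^2 + u'^2]. *)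
Lemma linear_ode_unique (f : c2) (p lam : R) (q : R -> R) a b t0 : 0 < p -> a <= t0 <= b ->
  (forall x, continuous q x) ->
  (forall x, a <= x <= b -> - p * v2 f x + q x * v0 f x = lam * v0 f x) ->
  v0 f t0 = 0 -> v1 f t0 = 0 -> forall x, a <= x <= b -> v0 f x = 0 /\ v1 f x = 0.
Proof.
  intros Hp Ht0 Hq Hode H0 H1.
  destruct (continuous_bounded (fun x => / p * (q x + - lam)) a b) as [M HM]; [lra|intro; con|].
  assert (HM0 : 0 <= M) by (eapply Rle_trans; [apply Rabs_pos|apply (HM a); lra]).
  set (E := fun x => v0 f x * v0 f x + v1 f x * v1 f x).
  set (dE := fun x => 2 * (v0 f x * v1 f x) + 2 * (v1 f x * v2 f x)).
  set (N := 1 + M).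
  assert (HE : forall x, is_derive E x (dE x)).
  { intro x; unfold E, dE; eapply der_eq; [der|cbv beta; ring]. }
  assert (HEp : forall x, 0 <= E x).
  { intro x; unfold E; assert (A := Rle_0_sqr (v0 f x)); assert (B := Rle_0_sqr (v1 f x)); unfold Rsqr in *; lra. }
  assert (HdE : forall x, a <= x <= b -> Rabs (dE x) <= N * E x).
  { intros x Hx; unfold dE, N, E.
    assert (Hv2 : v2 f x = / p * (q x + - lam) * v0 f x).
    { apply (Rmult_eq_reg_l p); [|lra]. specialize (Hode x Hx).
      replace (p * (/ p * (q x + - lam) * v0 f x)) with ((q x + - lam) * v0 f x) by (field; lra). lra. }
    rewrite Hv2. specialize (HM x Hx). set (r := / p * (q x + - lam)) in *.
    set (u := v0 f x); set (v := v1 f x).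
    apply Rabs_le_between in HM.
    assert (A := Rle_0_sqr (u - v)). assert (B := Rle_0_sqr (u + v)). unfold Rsqr in A, B.
    assert (A2 : 2 * (u * v) <= u * u + v * v) by lra.
    assert (B2 : - (u * u + v * v) <= 2 * (u * v)) by lra.
    replace (2 * (u * v) + 2 * (v * (r * u))) with (2 * (u * v) + r * (2 * (u * v))) by ring.
    set (z := 2 * (u * v)) in *; set (s := u * u + v * v) in *.
    assert (Hrz : Rabs (r * z) <= M * s).
    { rewrite Rabs_mult; apply Rmult_le_compat; try apply Rabs_pos; apply Rabs_le; lra. }
    apply Rabs_le_between in Hrz. apply Rabs_le; lra. }
  assert (Hexp : forall k x, is_derive (fun t => exp (k * t)) x (k * exp (k * x))).
  { intros k x; auto_derive; [easy|ring]. }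
  assert (HG : forall k x, is_derive (fun t => exp (k * t) * E t) x (exp (k * x) * (k * E x + dE x))).
  { intros k x; eapply der_eq; [apply (der_mult (fun t => exp (k * t)) E); [apply Hexp|apply HE]|cbv beta; ring]. }
  assert (E0 : E t0 = 0) by (unfold E; rewrite H0, H1; ring).
  assert (HEz : forall x, a <= x <= b -> E x = 0).
  { intros x Hx; apply Rle_antisym; [|apply HEp].
    (* Right of [t0] the function exp(-N t) E is nonincreasing, left of it exp(N t) E is
       nondecreasing; both vanish at [t0]. *)
    destruct (Rle_dec t0 x) as [Hle|Hle].
    - apply (Rmult_le_reg_l (exp (- N * x))); [apply exp_pos|]. rewrite Rmult_0_r.
      assert (A := nonneg_derive_le (fun t => (-1) * (exp (- N * t) * E t))
          (fun t => (-1) * (exp (- N * t) * (- N * E t + dE t))) t0 x Hle).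
      cbv beta in A; rewrite E0 in A.
      enough (-1 * (exp (- N * t0) * 0) <= -1 * (exp (- N * x) * E x)) by lra.
      apply A; [intro y; apply (der_scal (fun t => exp (- N * t) * E t)), HG|].
      intros y Hy. assert (B := HdE y ltac:(lra)). apply Rabs_le_between in B.
      assert (C := exp_pos (- N * y)). nra.
    - assert (Hle' : x <= t0) by lra.
      apply (Rmult_le_reg_l (exp (N * x))); [apply exp_pos|]. rewrite Rmult_0_r.
      assert (A := nonneg_derive_le (fun t => exp (N * t) * E t)
          (fun t => exp (N * t) * (N * E t + dE t)) x t0 Hle').
      cbv beta in A; rewrite E0, Rmult_0_r in A.
      apply A; [intro y; apply HG|].
      intros y Hy. assert (B := HdE y ltac:(lra)). apply Rabs_le_between in B.
      assert (C := exp_pos (N * y)). nra. }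
  intros x Hx; specialize (HEz x Hx); unfold E in HEz.
  assert (A := Rle_0_sqr (v0 f x)); assert (B := Rle_0_sqr (v1 f x)).
  split; apply Rsqr_0_uniq; unfold Rsqr in *; lra.
Qed.

(** * The Sturm-Liouville problem with transmission conditions *)

(* The index [true] stands for the interval left of 0 and [false] for the one right of 0;
   [tA], ..., [tD] express the values at 0+ by those at 0-. *)
Record sl_data := SLData {
  sl_lo : bool -> R; sl_hi : bool -> R; pc : bool -> R; mc : bool -> R; qc : bool -> R -> R;
  ca : R; sa : R; cb : R; sb : R;
  tA : R; tB : R; tC : R; tD : R;
  lo_lt_hi : forall b, sl_lo b < sl_hi b;
  pc_pos : forall b, 0 < pc b;
  mc_pos : forall b, 0 < mc b;
  qc_con : forall b x, continuous (qc b) x;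
  casa : ca <> 0 \/ sa <> 0;
  cbsb : cb <> 0 \/ sb <> 0;
  t_det : mc false * (tA * tD - tB * tC) = mc true }.

Section SturmLiouville.
Variable P : sl_data.
Let lo := sl_lo P. Let hi := sl_hi P. Let p := pc P. Let m := mc P. Let q := qc P.
Let Hlh := lo_lt_hi P. Let Hp := pc_pos P. Let Hm := mc_pos P. Let Hq := qc_con P.

(** With this weight the leading term of L contributes -m u'', so the boundary terms of Green's
    formula carry the constants m, which [t_det] relates to the transmission matrix. *)
Definition wt b := m b / p b.

Lemma wt_pos b : 0 < wt b.
Proof. apply Rdiv_lt_0_compat; [apply Hm|apply Hp]. Qed.

Definition bc_left (u v : R) := ca P * u + sa P * v = 0.
Definition bc_right (u v : R) := cb P * u + sb P * v = 0.
Definition transm (u v u' v' : R) := u' = tA P * u + tB P * v /\ v' = tC P * u + tD P * v.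

Definition dom (U : bool -> c2) : Prop :=
  bc_left (v0 (U true) (lo true)) (v1 (U true) (lo true)) /\
  bc_right (v0 (U false) (hi false)) (v1 (U false) (hi false)) /\
  transm (v0 (U true) (hi true)) (v1 (U true) (hi true))
         (v0 (U false) (lo false)) (v1 (U false) (lo false)).

Definition lop (U : bool -> c2) b x := - p b * v2 (U b) x + q b x * v0 (U b) x.

Definition ip (f g : bool -> R -> R) :=
  wt true * RInt (fun t => f true t * g true t) (lo true) (hi true) +
  wt false * RInt (fun t => f false t * g false t) (lo false) (hi false).

Definition val (U : bool -> c2) b := v0 (U b).

Definition lin (a : R) (U : bool -> c2) (c : R) (V : bool -> c2) b := c2_lin a (U b) c (V b).

Lemma dom_lin a U c V : dom U -> dom V -> dom (lin a U c V).
Proof.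
  unfold dom, bc_left, bc_right, transm; simpl; intros [H1 [H2 [H3 H4]]] [H5 [H6 [H7 H8]]].
  repeat split.
  - replace 0 with (a * 0 + c * 0) by ring. rewrite <- H1 at 1; rewrite <- H5; ring.
  - replace 0 with (a * 0 + c * 0) by ring. rewrite <- H2 at 1; rewrite <- H6; ring.
  - rewrite H3, H7; ring.
  - rewrite H4, H8; ring.
Qed.

Lemma lop_lin a U c V b x : lop (lin a U c V) b x = a * lop U b x + c * lop V b x.
Proof. unfold lop; simpl; ring. Qed.

Definition bdry (U V : bool -> c2) b :=
  m b * (v1 (U b) (hi b) * v0 (V b) (hi b) - v1 (U b) (lo b) * v0 (V b) (lo b)).

Definition energy (U V : bool -> c2) b :=
  m b * RInt (fun t => v1 (U b) t * v1 (V b) t) (lo b) (hi b) +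
  wt b * RInt (fun t => q b t * (v0 (U b) t * v0 (V b) t)) (lo b) (hi b).

Lemma ip_lop U V : ip (lop U) (val V) =
  energy U V true - bdry U V true + (energy U V false - bdry U V false).
Proof.
  assert (H : forall b, wt b * RInt (fun t => lop U b t * val V b t) (lo b) (hi b) = energy U V b - bdry U V b).
  { intro b.
    rewrite (RInt_ext_R _ (fun t => - p b * (v2 (U b) t * v0 (V b) t) + q b t * (v0 (U b) t * v0 (V b) t)))
      by (intro; unfold lop, val; ring).
    rewrite RInt_plus_R, RInt_scal_R, RInt_by_parts by (intro; con).
    unfold energy, bdry, wt. field. apply Rgt_not_eq, Hp. }
  unfold ip; now rewrite 2!H.
Qed.

(** Two vectors in the kernel of the same nonzero linear form on the plane are proportional. *)
Lemma robin_wronskian c s u v u' v' : c <> 0 \/ s <> 0 ->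
  c * u + s * v = 0 -> c * u' + s * v' = 0 -> v * u' = v' * u.
Proof.
  intros [Hc|Hs] H1 H2.
  - apply (Rmult_eq_reg_l c); [|exact Hc].
    replace (c * (v * u')) with (v * (c * u' + s * v') - v' * (c * u + s * v) + c * (v' * u)) by ring.
    rewrite H1, H2; ring.
  - apply (Rmult_eq_reg_l s); [|exact Hs].
    replace (s * (v * u')) with (u' * (c * u + s * v) - u * (c * u' + s * v') + s * (v' * u)) by ring.
    rewrite H1, H2; ring.
Qed.

Lemma ip_comm f g : ip f g = ip g f.
Proof. unfold ip; f_equal; f_equal; apply RInt_ext_R; intro; ring. Qed.

(** What integration by parts leaves over are Wronskians. They vanish at the outer ends; crossing 0
    multiplies them by the determinant of the transmission matrix, which the weights m cancel by
    [t_det]. *)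
Lemma lop_symmetric U V : dom U -> dom V -> ip (lop U) (val V) = ip (val U) (lop V).
Proof.
  intros [HU1 [HU2 [HU3 HU4]]] [HV1 [HV2 [HV3 HV4]]].
  rewrite (ip_comm (val U)), 2!ip_lop.
  assert (HE : forall b, energy U V b = energy V U b).
  { intro b; unfold energy; f_equal; f_equal; apply RInt_ext_R; intro; ring. }
  rewrite 2!HE.
  assert (E1 := robin_wronskian _ _ _ _ _ _ (casa P) HU1 HV1).
  assert (E2 := robin_wronskian _ _ _ _ _ _ (cbsb P) HU2 HV2).
  unfold bdry. rewrite E1, E2, HU3, HU4, HV3, HV4.
  assert (D := t_det P). fold m in D. rewrite <- D. ring.
Qed.

(** For a Dirichlet condition u = 0 and the boundary term disappears; otherwise the slope is -(c /
    s) u. *)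
Lemma robin_bound c s : c <> 0 \/ s <> 0 ->
  exists k, 0 <= k /\ forall u v, c * u + s * v = 0 -> Rabs (v * u) <= k * u².
Proof.
  intros H; destruct (Req_dec s 0) as [Hs|Hs].
  - exists 0; split; [lra|]; intros u v E.
    assert (u = 0) as ->.
    { rewrite Hs in E. destruct H as [Hc|Hc]; [|easy]. apply (Rmult_eq_reg_l c); [lra|exact Hc]. }
    rewrite Rmult_0_r, Rabs_R0, Rmult_0_l; lra.
  - exists (Rabs (c / s)); split; [apply Rabs_pos|]; intros u v E.
    replace v with (- (c / s) * u).
    + rewrite !Rabs_mult, Rabs_Ropp, Rmult_assoc, <- Rabs_mult. right; f_equal.
      apply Rabs_pos_eq, Rle_0_sqr.
    + apply (Rmult_eq_reg_l s); [|exact Hs]. replace (s * (- (c / s) * u)) with (- (c * u)) by (now field). lra.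
Qed.

(* If [tB <> 0] the slope is determined by the two one-sided values; if [tB = 0]
   the determinant condition cancels the mixed term. *)
Lemma transm_bound : exists k, 0 <= k /\ forall u v u' v', transm u v u' v' ->
  m true * (v * u) - m false * (v' * u') <= k * (u² + u'²).
Proof.
  assert (D := t_det P). fold m in D. unfold transm.
  set (A := tA P) in *; set (B := tB P) in *; set (C := tC P) in *; set (D' := tD P) in *.
  destruct (Req_dec B 0) as [HB|HB].
  - exists (Rabs (m false * (A * C))); split; [apply Rabs_pos|].
    intros u v u' v' [-> ->]. rewrite HB in *.
    replace (m true * (v * u) - m false * ((C * u + D' * v) * (A * u + 0 * v)))
      with (- (m false * (A * C)) * u²) by (rewrite <- D; unfold Rsqr; ring).
    assert (H := Rle_abs (- (m false * (A * C)))). rewrite Rabs_Ropp in H.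
    set (r := Rabs (m false * (A * C))) in *.
    assert (0 <= r) by apply Rabs_pos.
    assert (0 <= u²) by apply Rle_0_sqr. assert (0 <= (A * u + 0 * v)²) by apply Rle_0_sqr. nra.
  - assert (Hq2 : forall a b c, exists k, 0 <= k /\
      forall x y, a * (x * x) + b * (x * y) + c * (y * y) <= k * (x² + y²)).
    { intros a b c; exists (Rabs a + Rabs b + Rabs c); split.
      - assert (H1 := Rabs_pos a); assert (H2 := Rabs_pos b); assert (H3 := Rabs_pos c); lra.
      - intros x y. assert (H1 := Rle_abs a); assert (H2 := Rle_abs b); assert (H3 := Rle_abs c).
        assert (H4 := Rle_abs (- b)). rewrite Rabs_Ropp in H4.
        assert (Ha := Rabs_pos a); assert (Hb := Rabs_pos b); assert (Hc := Rabs_pos c).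
        assert (X := Rle_0_sqr x). assert (Y := Rle_0_sqr y).
        assert (S1 := Rle_0_sqr (x - y)). assert (S2 := Rle_0_sqr (x + y)). unfold Rsqr in *.
        assert (b * (x * y) <= Rabs b * (x * x + y * y)).
        { apply Rle_trans with (Rabs (b * (x * y))); [apply Rle_abs|]. rewrite Rabs_mult.
          apply Rmult_le_compat_l; [exact Hb|]. apply Rabs_le; lra. }
        nra. }
    destruct (Hq2 (- m true * A / B)
       (m true / B - m false * (C - D' * A / B)) (- m false * D' / B)) as [k1 [Hk1 K1]].
    exists k1; split; [exact Hk1|]. intros u v u' v' [E1 E2].
    assert (Ev : v = (u' - A * u) / B) by (rewrite E1; field; exact HB).
    eapply Rle_trans; [|apply (K1 u u')].
    right. rewrite E2, Ev. unfold Rsqr. field. exact HB.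
Qed.


Lemma ip_sq_ge U : ip (val U) (val U) =
  wt true * RInt (fun t => (v0 (U true) t)²) (lo true) (hi true) +
  wt false * RInt (fun t => (v0 (U false) t)²) (lo false) (hi false).
Proof. reflexivity. Qed.

Lemma ip_lin_l k l f g h : (forall b x, continuous (f b) x) -> (forall b x, continuous (g b) x) ->
  (forall b x, continuous (h b) x) ->
  ip (fun b t => k * f b t + l * g b t) h = k * ip f h + l * ip g h.
Proof.
  intros Hf Hg Hh.
  assert (H : forall b, RInt (fun t => (k * f b t + l * g b t) * h b t) (lo b) (hi b) =
    k * RInt (fun t => f b t * h b t) (lo b) (hi b) + l * RInt (fun t => g b t * h b t) (lo b) (hi b)).
  { intro b; rewrite (RInt_ext_R _ (fun t => k * (f b t * h b t) + l * (g b t * h b t))) by (intro; ring).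
    rewrite RInt_plus_R, 2!RInt_scal_R by (intro; con). reflexivity. }
  unfold ip; rewrite 2!H; ring.
Qed.

Lemma ip_ext f g f' g' : (forall b t, lo b <= t <= hi b -> f b t * g b t = f' b t * g' b t) ->
  ip f g = ip f' g'.
Proof.
  intro H; unfold ip; f_equal; f_equal; (apply RInt_ext_Ioo; [left; apply Hlh|]); intros t Ht;
    apply H; split; apply Rlt_le, Ht.
Qed.

Lemma ip_ge0 U : 0 <= ip (val U) (val U).
Proof.
  rewrite ip_sq_ge. assert (A := wt_pos true). assert (B := wt_pos false).
  apply Rplus_le_le_0_compat; (apply Rmult_le_pos; [lra|]); (apply RInt_ge0_R;
    [left; apply Hlh|intro; unfold Rsqr; con|intros; apply Rle_0_sqr]).
Qed.

Lemma ip_eq0 U : ip (val U) (val U) = 0 -> forall b t, lo b <= t <= hi b -> v0 (U b) t = 0.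
Proof.
  rewrite ip_sq_ge; intros H b t Ht.
  assert (A : forall b, 0 <= wt b * RInt (fun t => (v0 (U b) t)²) (lo b) (hi b)).
  { intro c; apply Rmult_le_pos; [left; apply wt_pos|]. apply RInt_ge0_R;
    [left; apply Hlh|intro; unfold Rsqr; con|intros; apply Rle_0_sqr]. }
  assert (B : wt b * RInt (fun t => (v0 (U b) t)²) (lo b) (hi b) = 0).
  { assert (A1 := A true). assert (A2 := A false). destruct b; lra. }
  apply Rsqr_0_uniq, (RInt_nonneg_eq0 (fun t => (v0 (U b) t)²) (lo b) (hi b)).
  - apply Hlh.
  - intro; unfold Rsqr; con.
  - intros; apply Rle_0_sqr.
  - apply (Rmult_eq_reg_l (wt b)); [lra|apply Rgt_not_eq, wt_pos].
  - exact Ht.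
Qed.

(** The boundary terms of the Dirichlet form are controlled by squares of point values. By
    [sup_sq_le] such a square costs an arbitrarily small part of the integral of u'^2, and the rest
    goes into C. *)
Lemma coercive d : 0 < d -> exists C, forall U b t, dom U -> lo b <= t <= hi b ->
  (v0 (U b) t)² <= d * ip (lop U) (val U) + C * ip (val U) (val U).
Proof.
  intro Hd.
  destruct transm_bound as [k [Hk K]].
  destruct (robin_bound _ _ (casa P)) as [k1 [Hk1 K1]].
  destruct (robin_bound _ _ (cbsb P)) as [k2 [Hk2 K2]].
  assert (HT := Hlh true). assert (HF := Hlh false). fold lo hi in HT, HF.
  destruct (continuous_bounded (q true) (lo true) (hi true)) as [QT HQT]; [lra|apply Hq|].
  destruct (continuous_bounded (q false) (lo false) (hi false)) as [QF HQF]; [lra|apply Hq|].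
  assert (HQT0 : 0 <= QT) by (eapply Rle_trans; [apply Rabs_pos|apply (HQT (lo true)); lra]).
  assert (HQF0 : 0 <= QF) by (eapply Rle_trans; [apply Rabs_pos|apply (HQF (lo false)); lra]).
  assert (HmT := Hm true). assert (HmF := Hm false). fold m in HmT, HmF.
  assert (HwT := wt_pos true). assert (HwF := wt_pos false).
  (* The total of the boundary constants: the transmission bound involves two point values, each
     outer end one; the 1 ensures positivity. *)
  set (kap := 2 * k + m true * k1 + m false * k2 + 1).
  assert (Hkap : 0 < kap).
  { unfold kap. assert (0 <= m true * k1) by (apply Rmult_le_pos; lra).
    assert (0 <= m false * k2) by (apply Rmult_le_pos; lra). lra. }
  set (mm := Rmin (m true) (m false)).
  assert (Hmm : 0 < mm) by now apply Rmin_pos.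
  set (wm := Rmin (wt true) (wt false)).
  assert (Hwm : 0 < wm) by now apply Rmin_pos.
  set (l := / (hi true - lo true) + / (hi false - lo false)).
  assert (Hl1 : 0 < / (hi true - lo true)) by (apply Rinv_0_lt_compat; lra).
  assert (Hl2 : 0 < / (hi false - lo false)) by (apply Rinv_0_lt_compat; lra).
  (* So that kap * e1 = mm / 2: the boundary terms use up half of the integral of u'^2. *)
  set (e1 := mm / (2 * kap)).
  assert (He1 : 0 < e1) by (apply Rdiv_lt_0_compat; lra).
  (* The surviving half, multiplied by d, dominates the final sup estimate. *)
  set (e2 := d * mm / 2).
  assert (He2 : 0 < e2) by (unfold e2; assert (0 < d * mm) by (now apply Rmult_lt_0_compat); lra).
  set (C0 := wt true * QT + wt false * QF + kap * (/ e1 + l)).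
  assert (Hi1 : 0 < / e1) by now apply Rinv_0_lt_compat.
  assert (Hi2 : 0 < / e2) by now apply Rinv_0_lt_compat.
  assert (HC0 : 0 <= C0).
  { unfold C0, l. repeat apply Rplus_le_le_0_compat; apply Rmult_le_pos; lra. }
  (* Division by the smaller weight passes from the unweighted to the weighted L^2 norm. *)
  exists ((d * C0 + (/ e2 + l)) / wm).
  intros U b t HU Ht.
  rewrite ip_sq_ge.
  set (PT := RInt (fun t => (v1 (U true) t)²) (lo true) (hi true)).
  set (PF := RInt (fun t => (v1 (U false) t)²) (lo false) (hi false)).
  set (ZT := RInt (fun t => (v0 (U true) t)²) (lo true) (hi true)).
  set (ZF := RInt (fun t => (v0 (U false) t)²) (lo false) (hi false)).
  assert (Hs0 : forall b x, continuous (fun t => (v0 (U b) t)²) x) by (intros; unfold Rsqr; con).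
  assert (Hs1 : forall b x, continuous (fun t => (v1 (U b) t)²) x) by (intros; unfold Rsqr; con).
  assert (HPT : 0 <= PT) by (apply RInt_ge0_R; [lra|apply Hs1|intros; apply Rle_0_sqr]).
  assert (HPF : 0 <= PF) by (apply RInt_ge0_R; [lra|apply Hs1|intros; apply Rle_0_sqr]).
  assert (HZT : 0 <= ZT) by (apply RInt_ge0_R; [lra|apply Hs0|intros; apply Rle_0_sqr]).
  assert (HZF : 0 <= ZF) by (apply RInt_ge0_R; [lra|apply Hs0|intros; apply Rle_0_sqr]).
  assert (Hsup : forall e b t, 0 < e -> lo b <= t <= hi b ->
    (v0 (U b) t)² <= e * (PT + PF) + (/ e + l) * (ZT + ZF)).
  { intros e c s He Hs.
    assert (A := sup_sq_le (U c) (lo c) (hi c) e s (Hlh c) He Hs).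
    assert (Hi : 0 < / e) by now apply Rinv_0_lt_compat.
    assert (B1 : 0 <= (/ e + l) * ZT) by (apply Rmult_le_pos; unfold l; lra).
    assert (B2 : 0 <= (/ e + l) * ZF) by (apply Rmult_le_pos; unfold l; lra).
    assert (B3 : 0 <= e * PT) by (apply Rmult_le_pos; lra).
    assert (B4 : 0 <= e * PF) by (apply Rmult_le_pos; lra).
    destruct c; fold PT PF ZT ZF in A.
    - assert ((/ e + / (hi true - lo true)) * ZT <= (/ e + l) * ZT) by (apply Rmult_le_compat_r; unfold l; lra). lra.
    - assert ((/ e + / (hi false - lo false)) * ZF <= (/ e + l) * ZF) by (apply Rmult_le_compat_r; unfold l; lra). lra. }
  set (S := e1 * (PT + PF) + (/ e1 + l) * (ZT + ZF)).
  assert (HS : forall b t, lo b <= t <= hi b -> (v0 (U b) t)² <= S) by (intros; now apply Hsup).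
  assert (HB : bdry U U true + bdry U U false <= kap * S).
  { destruct HU as [HU1 [HU2 HU3]]. unfold bdry.
    assert (A1 := K _ _ _ _ HU3). assert (A2 := K1 _ _ HU1). assert (A3 := K2 _ _ HU2).
    apply Rabs_le_between in A2, A3.
    assert (S1 := HS true (lo true) ltac:(lra)). assert (S2 := HS true (hi true) ltac:(lra)).
    assert (S3 := HS false (lo false) ltac:(lra)). assert (S4 := HS false (hi false) ltac:(lra)).
    assert (S0 : 0 <= S) by (eapply Rle_trans; [apply Rle_0_sqr|apply S1]).
    assert (T1 : k1 * (v0 (U true) (lo true))² <= k1 * S) by (apply Rmult_le_compat_l; lra).
    assert (T2 : k2 * (v0 (U false) (hi false))² <= k2 * S) by (apply Rmult_le_compat_l; lra).
    assert (T3 : k * ((v0 (U true) (hi true))² + (v0 (U false) (lo false))²) <= k * (2 * S)) by (apply Rmult_le_compat_l; lra).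
    assert (T4 : m true * - (v1 (U true) (lo true) * v0 (U true) (lo true)) <= m true * (k1 * S)) by (apply Rmult_le_compat_l; lra).
    assert (T5 : m false * (v1 (U false) (hi false) * v0 (U false) (hi false)) <= m false * (k2 * S)) by (apply Rmult_le_compat_l; lra).
    unfold kap. lra. }
  assert (HE : forall b M, 0 <= M -> (forall x, lo b <= x <= hi b -> Rabs (q b x) <= M) ->
    m b * RInt (fun t => (v1 (U b) t)²) (lo b) (hi b) - wt b * (M * RInt (fun t => (v0 (U b) t)²) (lo b) (hi b))
      <= energy U U b).
  { intros c M HM HqM; unfold energy.
    change (RInt (fun t => v1 (U c) t * v1 (U c) t) (lo c) (hi c)) with (RInt (fun t => (v1 (U c) t)²) (lo c) (hi c)).
    assert (A : RInt (fun t => - M * (v0 (U c) t)²) (lo c) (hi c) <= RInt (fun t => q c t * (v0 (U c) t * v0 (U c) t)) (lo c) (hi c)).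
    { apply RInt_le_R; [left; apply Hlh|intro; unfold Rsqr; con|intro; con|].
      intros x Hx; specialize (HqM x Hx); apply Rabs_le_between in HqM.
      assert (Z := Rle_0_sqr (v0 (U c) x)). change (- M * (v0 (U c) x)² <= q c x * (v0 (U c) x)²); apply Rmult_le_compat_r; lra. }
    rewrite RInt_scal_R in A by apply Hs0.
    apply (Rmult_le_compat_l (wt c)) in A; [|left; apply wt_pos]. lra. }
  assert (ET := HE true QT HQT0 HQT). assert (EF := HE false QF HQF0 HQF).
  fold PT ZT in ET. fold PF ZF in EF.
  rewrite ip_lop.
  set (Q := energy U U true - bdry U U true + (energy U U false - bdry U U false)).
  assert (Hm1 : mm * PT <= m true * PT) by (apply Rmult_le_compat_r; [lra|apply Rmin_l]).
  assert (Hm2 : mm * PF <= m false * PF) by (apply Rmult_le_compat_r; [lra|apply Rmin_r]).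
  assert (HQ : mm / 2 * (PT + PF) <= Q + C0 * (ZT + ZF)).
  { unfold Q, C0.
    assert (Ek : kap * S = mm / 2 * (PT + PF) + kap * (/ e1 + l) * (ZT + ZF)).
    { unfold S. rewrite Rmult_plus_distr_l, <- !Rmult_assoc. f_equal. f_equal. unfold e1; field; lra. }
    rewrite Ek in HB.
    assert (0 <= wt true * QT * ZF) by (apply Rmult_le_pos; [apply Rmult_le_pos|]; lra).
    assert (0 <= wt false * QF * ZT) by (apply Rmult_le_pos; [apply Rmult_le_pos|]; lra).
    lra. }
  eapply Rle_trans; [apply (Hsup e2 b t He2 Ht)|].
  assert (F1 : e2 * (PT + PF) <= d * (Q + C0 * (ZT + ZF))).
  { replace (e2 * (PT + PF)) with (d * (mm / 2 * (PT + PF))) by (unfold e2; field).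
    apply Rmult_le_compat_l; lra. }
  assert (Hw1 : wm * ZT <= wt true * ZT) by (apply Rmult_le_compat_r; [lra|apply Rmin_l]).
  assert (Hw2 : wm * ZF <= wt false * ZF) by (apply Rmult_le_compat_r; [lra|apply Rmin_r]).
  assert (HCC : 0 <= (d * C0 + (/ e2 + l)) / wm).
  { apply Rmult_le_pos; [|left; now apply Rinv_0_lt_compat].
    assert (0 <= d * C0) by (apply Rmult_le_pos; lra). unfold l; lra. }
  assert (F2 : (d * C0 + (/ e2 + l)) * (ZT + ZF) <= (d * C0 + (/ e2 + l)) / wm * (wt true * ZT + wt false * ZF)).
  { replace ((d * C0 + (/ e2 + l)) * (ZT + ZF)) with ((d * C0 + (/ e2 + l)) / wm * (wm * (ZT + ZF))) by (field; lra).
    apply Rmult_le_compat_l; lra. }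
  lra.
Qed.

End SturmLiouville.

(** * Green's kernel and its eigenfunction expansion *)

Ltac eqR := match goal with |- ?x = ?y => change (@eq R x y) end.

Lemma continuity_2d_Rmin x y : continuity_2d_pt Rmin x y.
Proof.
  apply continuity_2d_pt_iff; intros eps He; exists eps; split; [exact He|]; intros u v Hu Hv.
  apply Rabs_lt_between in Hu, Hv. apply Rabs_lt_between.
  unfold Rmin; destruct (Rle_dec u v), (Rle_dec x y); lra.
Qed.

Lemma continuity_2d_Rmax x y : continuity_2d_pt Rmax x y.
Proof.
  apply continuity_2d_pt_iff; intros eps He; exists eps; split; [exact He|]; intros u v Hu Hv.
  apply Rabs_lt_between in Hu, Hv. apply Rabs_lt_between.
  unfold Rmax; destruct (Rle_dec u v), (Rle_dec x y); lra.
Qed.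

(** Variation of parameters. Phi' = w phi f and Psi' = -w chi f make chi Phi' + phi Psi' vanish, so
    a Wronskian term appears only in the second derivative. [Phi0] and [Psi0] will hold the
    contributions from elsewhere. *)
Definition var_param (phi chi : c2) (f : R -> R) (Hf : forall x, continuous f x)
  (a w Phi0 Psi0 c : R) : c2.
Proof.
  set (Phi := fun x => Phi0 + w * RInt (fun t => v0 phi t * f t) a x).
  set (Psi := fun x => Psi0 + - w * RInt (fun t => v0 chi t * f t) a x).
  assert (HPhi : forall x, is_derive Phi x (w * (v0 phi x * f x))).
  { intro x; unfold Phi. eapply der_eq; [apply der_plus; [apply der_const|apply der_scal]|apply Rplus_0_l].
    apply (is_derive_RInt_upper (fun t => v0 phi t * f t)); intro; con. }
  assert (HPsi : forall x, is_derive Psi x (- w * (v0 chi x * f x))).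
  { intro x; unfold Psi. eapply der_eq; [apply der_plus; [apply der_const|apply der_scal]|apply Rplus_0_l].
    apply (is_derive_RInt_upper (fun t => v0 chi t * f t)); intro; con. }
  refine (MkC2 (fun x => - / c * (v0 chi x * Phi x + v0 phi x * Psi x))
    (fun x => - / c * (v1 chi x * Phi x + v1 phi x * Psi x))
    (fun x => - / c * (v2 chi x * Phi x + v2 phi x * Psi x) +
              - / c * (w * ((v1 chi x * v0 phi x + - v1 phi x * v0 chi x) * f x))) _ _ _); intro x.
  - eapply der_eq; [der|cbv beta; ring].
  - eapply der_eq; [der|cbv beta; ring].
  - assert (continuous Phi x) by exact (der_continuous _ _ _ (HPhi x)).
    assert (continuous Psi x) by exact (der_continuous _ _ _ (HPsi x)).
    assert (continuous (fun t => - v1 phi t) x).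
    { apply (continuous_opp (V := R_NormedModule)), v1_con. }
    con.
Defined.

Section GreenKernel.
Variable P : sl_data.
Let lo := sl_lo P. Let hi := sl_hi P. Let p := pc P. Let m := mc P. Let q := qc P.
Let Hlh := lo_lt_hi P. Let Hp := pc_pos P. Let Hm := mc_pos P. Let Hq := qc_con P.

Variables (phi chi : bool -> c2) (c : R).
Hypothesis phi_lop : forall b t, lo b <= t <= hi b -> lop P phi b t = 0.
Hypothesis chi_lop : forall b t, lo b <= t <= hi b -> lop P chi b t = 0.
Hypothesis phi_bc : bc_left P (v0 (phi true) (lo true)) (v1 (phi true) (lo true)).
Hypothesis chi_bc : bc_right P (v0 (chi false) (hi false)) (v1 (chi false) (hi false)).
Hypothesis phi_tr : transm P (v0 (phi true) (hi true)) (v1 (phi true) (hi true))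
  (v0 (phi false) (lo false)) (v1 (phi false) (lo false)).
Hypothesis chi_tr : transm P (v0 (chi true) (hi true)) (v1 (chi true) (hi true))
  (v0 (chi false) (lo false)) (v1 (chi false) (lo false)).
Hypothesis wronskian : forall b t, lo b <= t <= hi b ->
  m b * (v0 (phi b) t * v1 (chi b) t - v1 (phi b) t * v0 (chi b) t) = c.
Hypothesis c_neq0 : c <> 0.

(** The classical -phi(min) chi(max) / c, every point of the [true] interval counting as left of the
    [false] one. The minus sign makes it invert L, whose leading coefficient is negative. *)
Definition gkern (b b' : bool) (s t : R) : R :=
  match b, b' with
  | true, false => - / c * (v0 (phi true) s * v0 (chi false) t)
  | false, true => - / c * (v0 (chi false) s * v0 (phi true) t)
  | _, _ => - / c * (v0 (phi b) (Rmin s t) * v0 (chi b) (Rmax s t))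
  end.

Lemma gkern_continuous b b' s t : continuity_2d_pt (gkern b b') s t.
Proof.
  assert (Hv : forall (f g : c2) (h k : R -> R -> R), continuity_2d_pt h s t -> continuity_2d_pt k s t ->
    continuity_2d_pt (fun s t => - / c * (v0 f (h s t) * v0 g (k s t))) s t).
  { intros f g h k Hh Hk. apply continuity_2d_pt_mult; [apply continuity_2d_pt_const|].
    apply continuity_2d_pt_mult; apply continuity_1d_2d_pt_comp; auto;
      apply continuity_pt_filterlim, v0_con. }
  destruct b, b'; unfold gkern.
  - apply (Hv (phi true) (chi true) Rmin Rmax); [apply continuity_2d_Rmin|apply continuity_2d_Rmax].
  - apply (Hv (phi true) (chi false) (fun s _ => s) (fun _ t => t));
      [apply continuity_2d_pt_id1|apply continuity_2d_pt_id2].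
  - apply (Hv (chi false) (phi true) (fun s _ => s) (fun _ t => t));
      [apply continuity_2d_pt_id1|apply continuity_2d_pt_id2].
  - apply (Hv (phi false) (chi false) Rmin Rmax); [apply continuity_2d_Rmin|apply continuity_2d_Rmax].
Qed.

Lemma gkern_sym b b' s t : gkern b b' s t = gkern b' b t s.
Proof. destruct b, b'; unfold gkern; rewrite ?(Rmin_comm s t), ?(Rmax_comm s t); ring. Qed.

Definition gapply (f : bool -> R -> R) b s : R :=
  wt P true * RInt (fun t => gkern b true s t * f true t) (lo true) (hi true) +
  wt P false * RInt (fun t => gkern b false s t * f false t) (lo false) (hi false).

(** The integral from s upwards is written as a total minus the part below s, to match [var_param],
    whose integrals all start at the left end. *)
Lemma gkern_split b f s : (forall x, continuous f x) -> lo b <= s <= hi b ->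
  RInt (fun t => gkern b b s t * f t) (lo b) (hi b) =
  - / c * (v0 (chi b) s * RInt (fun t => v0 (phi b) t * f t) (lo b) s +
           v0 (phi b) s * (RInt (fun t => v0 (chi b) t * f t) (lo b) (hi b) -
                           RInt (fun t => v0 (chi b) t * f t) (lo b) s)).
Proof.
  intros Hf Hs.
  assert (Hk : forall x, continuous (fun t => gkern b b s t * f t) x).
  { intro x; apply con_mult; [|apply Hf]. apply continuity_2d_row, gkern_continuous. }
  rewrite <- (RInt_Chasles_R (fun t => gkern b b s t * f t) (lo b) s (hi b) Hk).
  rewrite <- (RInt_Chasles_R (fun t => v0 (chi b) t * f t) (lo b) s (hi b)) by (intro; con).
  assert (E1 : RInt (fun t => gkern b b s t * f t) (lo b) s =
    RInt (fun t => - / c * v0 (chi b) s * (v0 (phi b) t * f t)) (lo b) s).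
  { apply RInt_ext_Ioo; [lra|intros t Ht].
    unfold gkern; destruct b; rewrite (Rmin_right s t), (Rmax_left s t) by lra;
      ring. }
  assert (E2 : RInt (fun t => gkern b b s t * f t) s (hi b) =
    RInt (fun t => - / c * v0 (phi b) s * (v0 (chi b) t * f t)) s (hi b)).
  { apply RInt_ext_Ioo; [lra|intros t Ht].
    unfold gkern; destruct b; rewrite (Rmin_left s t), (Rmax_right s t) by lra;
      ring. }
  rewrite E1, E2, 2!RInt_scal_R by (intro; con). eqR; ring.
Qed.

Lemma gapply_solves (f : bool -> R -> R) : (forall b x, continuous (f b) x) ->
  exists U, dom P U /\ (forall b t, lo b <= t <= hi b -> lop P U b t = f b t) /\
    (forall b t, lo b <= t <= hi b -> v0 (U b) t = gapply f b t).
Proof.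
  intro Hf.
  set (IphiT := wt P true * RInt (fun t => v0 (phi true) t * f true t) (lo true) (hi true)).
  set (IchiT := wt P true * RInt (fun t => v0 (chi true) t * f true t) (lo true) (hi true)).
  set (IchiF := wt P false * RInt (fun t => v0 (chi false) t * f false t) (lo false) (hi false)).
  (* Phi runs from 0 at the far left and Psi comes down to 0 at the far right, both continuous
     across 0. So U is a multiple of phi at the left end and of chi at the right end, and at 0 the
     same combination of both on either side: all conditions are inherited. *)
  set (U := fun b : bool => var_param (phi b) (chi b) (f b) (Hf b) (lo b) (wt P b)
    (if b then 0 else IphiT) (if b then IchiT + IchiF else IchiF) c).
  assert (Hpt : forall g a, RInt g a a = 0) by (intros; apply (RInt_point (V := R_CompleteNormedModule))).
  exists U; split; [|split].
  - unfold dom, bc_left, bc_right, transm in *; simpl; fold lo hi.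
    rewrite !Hpt; fold IphiT IchiT IchiF.
    destruct phi_tr as [E1 E2]; destruct chi_tr as [E3 E4].
    repeat split.
    + transitivity (- / c * (IchiT + IchiF) *
        (ca P * v0 (phi true) (lo true) + sa P * v1 (phi true) (lo true))); [ring|rewrite phi_bc; ring].
    + transitivity (- / c * (IphiT + wt P false * RInt (fun t => v0 (phi false) t * f false t) (lo false) (hi false)) *
        (cb P * v0 (chi false) (hi false) + sb P * v1 (chi false) (hi false))); [unfold IchiF; ring|rewrite chi_bc; ring].
    + rewrite E1, E3. unfold IchiT; ring.
    + rewrite E2, E4. unfold IchiT; ring.
  - intros b t Ht. assert (A := phi_lop b t Ht). assert (B := chi_lop b t Ht). assert (W := wronskian b t Ht).
    unfold lop in *; simpl.
    set (Phi := _ + wt P b * RInt _ _ _). set (Psi := _ + - wt P b * RInt _ _ _).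
    fold p q in A, B |- *.
    (* The Wronskian term contributes exactly f, because wt * p = m. *)
    replace (v1 (chi b) t * v0 (phi b) t + - v1 (phi b) t * v0 (chi b) t) with (c / m b).
    2: { rewrite <- W. field. apply Rgt_not_eq, Hm. }
    assert (Hpb : p b <> 0) by apply Rgt_not_eq, Hp. assert (Hmb : m b <> 0) by apply Rgt_not_eq, Hm.
    unfold wt. fold m p.
    replace (f b t) with (- / c * ((- p b * v2 (chi b) t + q b t * v0 (chi b) t) * Phi +
      (- p b * v2 (phi b) t + q b t * v0 (phi b) t) * Psi) + f b t) at 2 by (rewrite A, B; ring).
    field. auto.
  - intros b t Ht; unfold gapply; destruct b.
    + rewrite (gkern_split true (f true)) by auto. simpl; fold lo hi.
      rewrite (RInt_ext_R (fun t0 => - / c * (v0 (phi true) t * v0 (chi false) t0) * f false t0)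
        (fun t0 => - / c * v0 (phi true) t * (v0 (chi false) t0 * f false t0)))
        by (intro; ring).
      rewrite RInt_scal_R by (intro; con). unfold IchiT, IchiF; ring.
    + rewrite (gkern_split false (f false)) by auto. simpl; fold lo hi.
      rewrite (RInt_ext_R (fun t0 => - / c * (v0 (chi false) t * v0 (phi true) t0) * f true t0)
        (fun t0 => - / c * v0 (chi false) t * (v0 (phi true) t0 * f true t0)))
        by (intro; ring).
      rewrite RInt_scal_R by (intro; con). unfold IphiT, IchiF; ring.
Qed.

Hypothesis trivial_kernel : forall U, dom P U -> (forall b t, lo b <= t <= hi b -> lop P U b t = 0) ->
  forall b t, lo b <= t <= hi b -> v0 (U b) t = 0.

Variables (ev : nat -> bool -> c2) (lam : nat -> R).
Hypothesis ev_dom : forall n, dom P (ev n).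
Hypothesis ev_lop : forall n b t, lo b <= t <= hi b -> lop P (ev n) b t = lam n * v0 (ev n b) t.
Hypothesis lam_neq0 : forall n, lam n <> 0.
Hypothesis lam_inj : forall i j, lam i = lam j -> i = j.
Hypothesis ev_norm : forall n, ip P (val (ev n)) (val (ev n)) = 1.
Hypothesis ev_complete : forall U mu, dom P U ->
  (forall b t, lo b <= t <= hi b -> lop P U b t = mu * v0 (U b) t) ->
  (exists b t, lo b <= t <= hi b /\ v0 (U b) t <> 0) ->
  exists n k, forall b t, lo b <= t <= hi b -> v0 (U b) t = k * v0 (ev n b) t.

Let X := two_interval_space lo hi (wt P) Hlh (wt_pos P).
Let cl := clamp lo hi.
Let e (n : nat) (x : X) : R := v0 (ev n (fst x)) (cl (fst x) (snd x)).
Let K (x y : X) : R := gkern (fst x) (fst y) (cl (fst x) (snd x)) (cl (fst y) (snd y)).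

Lemma intg_point_ext (f g : X -> R) : (forall b t, lo b <= t <= hi b -> f (b, t) = g (b, t)) -> intg f = intg g.
Proof.
  intro H; simpl; unfold pc_intg; f_equal; f_equal; (apply RInt_ext_Ioo; [left; apply Hlh|]); intros t Ht;
    apply H; split; apply Rlt_le, Ht.
Qed.

Lemma intg_ip (f g : bool -> R -> R) (h : X -> R) :
  (forall b t, lo b <= t <= hi b -> h (b, t) = f b t * g b t) -> intg h = ip P f g.
Proof. exact (intg_point_ext h (fun x => f (fst x) (snd x) * g (fst x) (snd x))). Qed.

Lemma ip_lop_ev i j : ip P (lop P (ev i)) (val (ev j)) = lam i * ip P (val (ev i)) (val (ev j)).
Proof.
  rewrite (ip_ext P _ _ (fun b t => lam i * val (ev i) b t + 0 * val (ev i) b t) (val (ev j))).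
  - rewrite ip_lin_l by (intros; apply v0_con); ring.
  - intros b t Ht; rewrite ev_lop by exact Ht; unfold val; ring.
Qed.

Lemma ev_orthogonal i j : i <> j -> ip P (val (ev i)) (val (ev j)) = 0.
Proof.
  intro Hij. assert (A := lop_symmetric P (ev i) (ev j) (ev_dom i) (ev_dom j)).
  rewrite (ip_comm P (val (ev i))), 2!ip_lop_ev, (ip_comm P (val (ev j))) in A.
  apply (Rmult_eq_reg_l (lam i - lam j)); [lra|].
  intro H; apply Hij, lam_inj; lra.
Qed.

(** Realises a finite combination as one element of the domain, to which [coercive] applies. *)
Lemma c2_sum (c0 : nat -> R) N : exists U, dom P U /\
  (forall b t, v0 (U b) t = sum_n (fun i => c0 i * v0 (ev i b) t) N) /\
  (forall b t, lop P U b t = sum_n (fun i => c0 i * lop P (ev i) b t) N).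
Proof.
  induction N as [|N [U [H1 [H2 H3]]]].
  - exists (lin (c0 0%nat) (ev 0%nat) 0 (ev 0%nat)); split; [apply dom_lin; auto|]; split; intros b t.
    + rewrite sum_O; simpl; ring.
    + rewrite sum_O, lop_lin; ring.
  - exists (lin 1 U (c0 (S N)) (ev (S N))); split; [apply dom_lin; auto|]; split; intros b t.
    + rewrite sum_Sn; simpl; rewrite H2. change (1 * sum_n (fun i => c0 i * v0 (ev i b) t) N + c0 (S N) * v0 (ev (S N) b) t =
        sum_n (fun i => c0 i * v0 (ev i b) t) N + c0 (S N) * v0 (ev (S N) b) t); ring.
    + rewrite sum_Sn, lop_lin, H3. change (1 * sum_n (fun i => c0 i * lop P (ev i) b t) N + c0 (S N) * lop P (ev (S N)) b t =
        sum_n (fun i => c0 i * lop P (ev i) b t) N + c0 (S N) * lop P (ev (S N)) b t); ring.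
Qed.

Lemma e_cfun n : cfun (e n).
Proof. apply (pc_fun_clamp lo hi Hlh (fun b => v0 (ev n b))); intros; apply v0_con. Qed.

Lemma e_orthonormal i j : intg (fun x => e i x * e j x) = if Nat.eq_dec i j then 1 else 0.
Proof.
  rewrite (intg_ip (val (ev i)) (val (ev j))).
  - destruct (Nat.eq_dec i j) as [<-|H]; [apply ev_norm|now apply ev_orthogonal].
  - intros b t Ht; unfold e; simpl. unfold cl; now rewrite clamp_id.
Qed.

Lemma K_sym x y : K x y = K y x.
Proof. apply gkern_sym. Qed.

Lemma K_ckern : ckern K.
Proof. apply (pc_kern_clamp lo hi Hlh gkern), gkern_continuous. Qed.

Lemma intg_gapply (g : X -> R) b s : lo b <= s <= hi b ->
  intg (fun y => K (b, s) y * g y) = gapply (fun b t => g (b, t)) b s.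
Proof.
  intros Hs.
  change (gapply (fun b t => g (b, t)) b s) with (ip P (fun b' t => gkern b b' s t) (fun b t => g (b, t))).
  apply (intg_ip (fun b' t => gkern b b' s t) (fun b t => g (b, t)) (fun y => K (b, s) y * g y)).
  intros b' t Ht; unfold K, cl; simpl. now rewrite 2!clamp_id.
Qed.

(** Both sides solve L u = e_n in the domain, so their difference lies in the trivial kernel of
    L. *)
Lemma gapply_ev n b s : lo b <= s <= hi b -> gapply (val (ev n)) b s = / lam n * v0 (ev n b) s.
Proof.
  intro Hs.
  destruct (gapply_solves (val (ev n))) as [U [HU [HL HV]]]; [intros; apply v0_con|].
  rewrite <- HV by exact Hs.
  assert (A := trivial_kernel (lin 1 U (- / lam n) (ev n))).
  simpl in A. enough (1 * v0 (U b) s + - / lam n * v0 (ev n b) s = 0) by lra.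
  apply A; auto using dom_lin.
  intros b' t Ht; rewrite lop_lin, HL, ev_lop by exact Ht. unfold val; field; apply lam_neq0.
Qed.

Lemma K_eigen n x : intg (fun y => K x y * e n y) = / lam n * e n x.
Proof.
  destruct x as [b s].
  assert (Hin := clamp_in lo hi Hlh b s).
  unfold e at 2; simpl; fold cl.
  rewrite <- gapply_ev by exact Hin.
  rewrite <- (intg_gapply (fun x => val (ev n) (fst x) (snd x))) by exact Hin.
  apply intg_point_ext; intros b' t Ht.
  unfold K, e, cl, val; simpl. now rewrite clamp_idem, (clamp_id _ _ b' t).
Qed.

(** By orthonormality <L u, u> and |u|^2 become the sums of a_i^2 lam_i and of a_i^2. *)
Lemma e_coercive d : 0 < d -> exists C, forall (a : nat -> R) N x,
  (sum_n (fun i => a i * e i x) N)² <= sum_n (fun i => a i * a i * (d * lam i + C)) N.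
Proof.
  intro Hd; destruct (coercive P d Hd) as [C HC]; exists C; intros a N [b s].
  destruct (c2_sum a N) as [U [HU [H1 H2]]].
  assert (A := HC U b (cl b s) HU (clamp_in lo hi Hlh b s)).
  rewrite H1 in A. unfold e; simpl.
  eapply Rle_trans; [exact A|right].
  rewrite <- (intg_ip (lop P U) (val U) (fun x => sum_n (fun i => a i * lam i * e i x) N * sum_n (fun j => a j * e j x) N)).
  2: { intros b' t Ht; unfold e, val; simpl; unfold cl; rewrite clamp_id by exact Ht.
       rewrite H1, H2; f_equal. apply sum_n_ext_R; intro i. rewrite ev_lop by exact Ht; ring. }
  rewrite <- (intg_ip (val U) (val U) (fun x => sum_n (fun i => a i * e i x) N * sum_n (fun j => a j * e j x) N)).
  2: { intros b' t Ht; unfold e, val; simpl; unfold cl; rewrite clamp_id by exact Ht. now rewrite H1. }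
  rewrite (intg_sum_mult X e e_cfun e_orthonormal (fun i => a i * lam i)), (intg_sum_mult X e e_cfun e_orthonormal).
  rewrite 2!sum_n_scal_R, sum_n_plus_R. apply sum_n_ext_R; intro i; ring.
Qed.

(** A merely continuous g gains regularity from K g = nu g: nu g coincides with a domain element U,
    and L U = g = U / nu. *)
Lemma e_complete nu (g : X -> R) : nu <> 0 -> cfun g ->
  (forall x, intg (fun y => K x y * g y) = nu * g x) ->
  (forall n, intg (fun x => g x * e n x) = 0) -> forall x, g x = 0.
Proof.
  intros Hnu [Hg Hgc] HK Horth [b0 s0].
  destruct (gapply_solves (fun b t => g (b, t)) Hg) as [U [HU [HL HV]]].
  assert (HVg : forall b t, lo b <= t <= hi b -> v0 (U b) t = nu * g (b, t)).
  { intros b t Ht; rewrite HV, <- intg_gapply by exact Ht; apply HK. }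
  rewrite <- Hgc. assert (Hin := clamp_in lo hi Hlh b0 s0). set (t0 := clamp lo hi b0 s0) in *.
  apply NNPP; intro Hne.
  destruct (ev_complete U (/ nu)) as [n [k Hk]]; [exact HU| | |].
  - intros b t Ht; rewrite HL, HVg by exact Ht. field; exact Hnu.
  - exists b0, t0; split; [exact Hin|]. rewrite HVg by exact Hin. now apply Rmult_integral_contrapositive.
  - assert (k = 0) as Hk0.
    { assert (A := Horth n).
      rewrite (intg_ip (fun b t => / nu * k * val (ev n) b t + 0 * val (ev n) b t) (val (ev n))) in A.
      - rewrite ip_lin_l, ev_norm in A by (intros; apply v0_con).
        apply (Rmult_eq_reg_l (/ nu)); [lra|now apply Rinv_neq_0_compat].
      - intros b t Ht; unfold e, cl, val; simpl; rewrite clamp_id by exact Ht.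
        assert (B := Hk b t Ht); rewrite HVg in B by exact Ht.
        replace (g (b, t)) with (/ nu * (k * v0 (ev n b) t)) by (rewrite <- B; field; exact Hnu). ring. }
    assert (A := Hk b0 t0 Hin). rewrite Hk0, HVg in A by exact Hin.
    apply Hne, (Rmult_eq_reg_l nu); [lra|exact Hnu].
Qed.

Theorem green_expansion eps : 0 < eps -> exists N, forall n, (N <= n)%nat ->
  forall b b' s t, lo b <= s <= hi b -> lo b' <= t <= hi b' ->
  Rabs (sum_n (fun i => / lam i * v0 (ev i b) s * v0 (ev i b') t) n - gkern b b' s t) < eps.
Proof.
  intro He.
  destruct (bilinear_expansion X e lam K e_cfun e_orthonormal lam_neq0 K_ckern K_sym K_eigen
    e_coercive e_complete eps He) as [N HN].
  exists N; intros n Hn b b' s t Hs Ht.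
  assert (A := HN n Hn (b, s) (b', t)).
  unfold bilinear_term, e, K, cl in A; simpl in A. now rewrite 2!clamp_id in A.
Qed.

Theorem green_expansion_tail eta : 0 < eta -> exists N0, forall n n' b b' s t, (N0 <= n)%nat ->
  lo b <= s <= hi b -> lo b' <= t <= hi b' ->
  sum_n_m (fun i => Rabs (/ lam i * v0 (ev i b) s * v0 (ev i b') t)) n n' <= eta.
Proof.
  intro He.
  destruct (bilinear_tail X e lam e_cfun e_orthonormal lam_neq0 e_coercive eta He) as [N HN].
  exists N; intros n n' b b' s t Hn Hs Ht.
  assert (A := HN n n' (b, s) (b', t) Hn).
  unfold bilinear_term, e, cl in A; simpl in A. now rewrite 2!clamp_id in A.
Qed.

End GreenKernel.

(** * From complex solutions to real ones *)

Lemma filterlim_Re (Fl : (R -> Prop) -> Prop) (y : R -> C) (l : C) {HF : Filter Fl} :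
  filterlim y Fl (locally l) -> filterlim (fun x => Re (y x)) Fl (locally (Re l)).
Proof.
  intros H; eapply filterlim_comp; [exact H|].
  intros Q [eps He]; exists eps; intros z [H1 H2]; apply He, H1.
Qed.

Lemma filterlim_Im (Fl : (R -> Prop) -> Prop) (y : R -> C) (l : C) {HF : Filter Fl} :
  filterlim y Fl (locally l) -> filterlim (fun x => Im (y x)) Fl (locally (Im l)).
Proof.
  intros H; eapply filterlim_comp; [exact H|].
  intros Q [eps He]; exists eps; intros z [H1 H2]; apply He, H2.
Qed.

Lemma locally_Ioo (a b x : R) : a < x < b -> locally x (fun t => a < t < b).
Proof.
  intros Hx. assert (Hd : 0 < Rmin (x - a) (b - x)) by (apply Rmin_pos; lra).
  exists (mkposreal _ Hd); intros t Ht.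
  assert (H1 := Rmin_l (x - a) (b - x)). assert (H2 := Rmin_r (x - a) (b - x)).
  change (Rabs (t - x) < Rmin (x - a) (b - x)) in Ht. apply Rabs_lt_between in Ht. lra.
Qed.

(** At interior points the derivative relative to D is the ordinary one; the two projections are
    linear. *)
Lemma is_derive_on_components (D : R -> Prop) (y : R -> C) (a b x : R) (l : C) :
  (forall t, a < t < b -> D t) -> a < x < b -> is_derive_on D y x l ->
  is_derive (fun t => Re (y t)) x (Re l) /\ is_derive (fun t => Im (y t)) x (Im l).
Proof.
  intros HD Hx [Hlin Hdom].
  assert (HDl : locally x D).
  { apply filter_imp with (2 := locally_Ioo a b x Hx). exact HD. }
  assert (Hd : filterdiff (U := R_NormedModule) (V := C_R_NormedModule) y (locally x)
    (fun h : R => @scal R_AbsRing C_R_NormedModule h l)).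
  { split; [exact Hlin|]. intros x' Hx'.
    assert (E : x = x') by (apply (is_filter_lim_locally_unique (V := R_NormedModule)); exact Hx').
    subst x'. intros eps.
    assert (Hw : is_filter_lim (T := R_UniformSpace) (within D (locally x)) x).
    { intros Q HQ; apply filter_imp with (2 := HQ); auto. }
    generalize (filter_and _ _ HDl (Hdom x Hw eps)). apply filter_imp. intros t [H1 H2]; auto. }
  split.
  - apply (filterdiff_comp (V := C_R_NormedModule) (W := R_NormedModule) y (fun z : R * R => fst z) _ (fun z : R * R => fst z) Hd).
    apply filterdiff_linear, is_linear_fst.
  - apply (filterdiff_comp (V := C_R_NormedModule) (W := R_NormedModule) y (fun z : R * R => snd z) _ (fun z : R * R => snd z) Hd).
    apply filterdiff_linear, is_linear_snd.
Qed.

(* A function that is C2 on an open interval, with one-sided limits at the ends,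
   is extended to all of R by integrating an extension of its second derivative. *)
Lemma c2_extend (u du ddu : R -> R) a b : a < b ->
  (forall x, continuous u x) -> (forall x, continuous du x) -> (forall x, continuous ddu x) ->
  (forall x, a < x < b -> is_derive u x (du x)) -> (forall x, a < x < b -> is_derive du x (ddu x)) ->
  exists f : c2, forall x, a <= x <= b -> v0 f x = u x /\ v1 f x = du x /\ v2 f x = ddu x.
Proof.
  intros Hab Hu Hdu Hddu H1 H2.
  set (w1 := fun x => du a + RInt ddu a x).
  assert (Hw1 : forall x, is_derive w1 x (ddu x)).
  { intro x; eapply der_eq; [apply (der_plus (fun _ => du a) (fun x => RInt ddu a x));
      [apply der_const|now apply is_derive_RInt_upper]|cbv beta; ring]. }
  assert (Hw1c : forall x, continuous w1 x) by (intro x; exact (der_continuous _ _ _ (Hw1 x))).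
  set (w0 := fun x => u a + RInt w1 a x).
  assert (Hw0 : forall x, is_derive w0 x (w1 x)).
  { intro x; eapply der_eq; [apply (der_plus (fun _ => u a) (fun x => RInt w1 a x));
      [apply der_const|now apply is_derive_RInt_upper]|cbv beta; ring]. }
  assert (Hw0c : forall x, continuous w0 x) by (intro x; exact (der_continuous _ _ _ (Hw0 x))).
  assert (Hconst : forall g h dg dh : R -> R, (forall x, continuous g x) -> (forall x, continuous h x) ->
    (forall x, a < x < b -> is_derive g x (dg x)) -> (forall x, a < x < b -> is_derive h x (dh x)) ->
    (forall x, a < x < b -> dg x = dh x) ->
    g a = h a -> forall x, a <= x <= b -> g x = h x).
  { intros g h dg dh Hg Hh Hdg Hdh E Ea x Hx.
    destruct (Req_dec a x) as [<-|Hne]; [exact Ea|].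
    destruct (MVT_gen (fun t => g t + (-1) * h t) a x (fun t => 0)) as [z [_ Hz]].
    - intros t Ht; rewrite Rmin_left, Rmax_right in Ht by lra.
      eapply der_eq; [apply (der_plus g (fun t => -1 * h t)); [apply Hdg; lra|apply der_scal, Hdh; lra]|].
      rewrite E by lra; ring.
    - intros t _; apply continuity_pt_filterlim.
      apply (con_plus g (fun t => -1 * h t)); [apply Hg|apply (con_mult (fun _ => -1) h); [apply con_const|apply Hh]].
    - rewrite Ea in Hz; lra. }
  assert (E1 : forall x, a <= x <= b -> w1 x = du x).
  { apply (Hconst w1 du ddu ddu); auto.
    unfold w1; rewrite (RInt_point (V := R_CompleteNormedModule)); apply Rplus_0_r. }
  assert (E0 : forall x, a <= x <= b -> w0 x = u x).
  { apply (Hconst w0 u w1 du); auto.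
    - intros x Hx; apply E1; lra.
    - unfold w0; rewrite (RInt_point (V := R_CompleteNormedModule)); apply Rplus_0_r. }
  exists (MkC2 w0 w1 ddu Hw0 Hw1 Hddu); simpl; intros x Hx; auto.
Qed.

Lemma is_derive_ext_Ioo (f g : R -> R) (a b x l : R) : a < x < b -> (forall t, a < t < b -> f t = g t) ->
  is_derive f x l -> is_derive g x l.
Proof.
  intros Hx H; apply is_derive_ext_loc.
  apply filter_imp with (2 := locally_Ioo a b x Hx); exact H.
Qed.

(** Limits of y and y' at the ends suffice: those of y'' follow from the equation and the continuity
    of q'. For nonreal lam the real and imaginary parts satisfy a coupled system. *)
Lemma solution_components (P : bvtp) (D : R -> Prop) (a b p : R) (q' : R -> R) (lam : C)
  (y dy : R -> C) (ya dya yb dyb : C) : a < b -> 0 < p -> (forall x, continuous q' x) ->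
  (forall x, a < x < b -> D x /\ pcoef P x = p /\ q' x = q P x) ->
  is_solution P D lam y dy ->
  filterlim y (at_right a) (locally ya) -> filterlim dy (at_right a) (locally dya) ->
  filterlim y (at_left b) (locally yb) -> filterlim dy (at_left b) (locally dyb) ->
  exists f g : c2,
    (forall x, a < x < b -> y x = (v0 f x, v0 g x) /\ dy x = (v1 f x, v1 g x)) /\
    ya = (v0 f a, v0 g a) /\ dya = (v1 f a, v1 g a) /\
    yb = (v0 f b, v0 g b) /\ dyb = (v1 f b, v1 g b) /\
    (forall x, a <= x <= b ->
       - p * v2 f x + q' x * v0 f x = Re lam * v0 f x - Im lam * v0 g x /\
       - p * v2 g x + q' x * v0 g x = Im lam * v0 f x + Re lam * v0 g x).
Proof.
  intros Hab Hp Hq HD [ddy Hsol] Ha Hda Hb Hdb.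
  assert (Hder : forall x, a < x < b ->
    (is_derive (fun t => Re (y t)) x (Re (dy x)) /\ is_derive (fun t => Im (y t)) x (Im (dy x))) /\
    (is_derive (fun t => Re (dy t)) x (Re (ddy x)) /\ is_derive (fun t => Im (dy t)) x (Im (ddy x)))).
  { intros x Hx; destruct (Hsol x (proj1 (HD x Hx))) as [H1 [H2 _]].
    split; apply (is_derive_on_components D _ a b); auto; intros t Ht; now apply HD. }
  assert (Hcon : forall x, a < x < b -> continuous (fun t => Re (y t)) x /\ continuous (fun t => Im (y t)) x /\
    continuous (fun t => Re (dy t)) x /\ continuous (fun t => Im (dy t)) x).
  { intros x Hx; destruct (Hder x Hx) as [[H1 H2] [H3 H4]].
    repeat split; eapply der_continuous; eassumption. }
  destruct (C0_extension_lt (fun t => Re (y t)) (Re ya) (Re yb) a b Hab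
    (fun x Hx => proj1 (Hcon x Hx)) (filterlim_Re _ _ _ Ha) (filterlim_Re _ _ _ Hb)) as [u [Hu [Eu [Eua Eub]]]].
  destruct (C0_extension_lt (fun t => Im (y t)) (Im ya) (Im yb) a b Hab
    (fun x Hx => proj1 (proj2 (Hcon x Hx))) (filterlim_Im _ _ _ Ha) (filterlim_Im _ _ _ Hb)) as [v [Hv [Ev [Eva Evb]]]].
  destruct (C0_extension_lt (fun t => Re (dy t)) (Re dya) (Re dyb) a b Hab
    (fun x Hx => proj1 (proj2 (proj2 (Hcon x Hx)))) (filterlim_Re _ _ _ Hda) (filterlim_Re _ _ _ Hdb)) as [du [Hdu [Edu [Edua Edub]]]].
  destruct (C0_extension_lt (fun t => Im (dy t)) (Im dya) (Im dyb) a b Hab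
    (fun x Hx => proj2 (proj2 (proj2 (Hcon x Hx)))) (filterlim_Im _ _ _ Hda) (filterlim_Im _ _ _ Hdb)) as [dv [Hdv [Edv [Edva Edvb]]]].
  change (forall x, continuous u x) in Hu. change (forall x, continuous v x) in Hv.
  (* The second derivatives are defined by solving the equation for them, which makes them
     continuous on all of R. *)
  set (ddu := fun x => / p * (q' x * u x + ((- Re lam) * u x + Im lam * v x))).
  set (ddv := fun x => / p * (q' x * v x + ((- Im lam) * u x + (- Re lam) * v x))).
  assert (Hddu : forall x, continuous ddu x) by (intro; unfold ddu; con).
  assert (Hddv : forall x, continuous ddv x) by (intro; unfold ddv; con).
  assert (Hode : forall x, a < x < b -> Re (ddy x) = ddu x /\ Im (ddy x) = ddv x).
  { intros x Hx; destruct (HD x Hx) as [HDx [Epx Eqx]].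
    destruct (Hsol x HDx) as [_ [_ E]]. rewrite Epx, <- Eqx in E.
    unfold ddu, ddv; rewrite Eu, Ev by exact Hx.
    destruct (y x) as [y1 y2], (ddy x) as [z1 z2], lam as [l1 l2].
    injection E as E1 E2; simpl in E1, E2 |- *.
    split; apply (Rmult_eq_reg_l p); try lra; rewrite <- Rmult_assoc, Rinv_r, Rmult_1_l by lra; lra. }
  destruct (c2_extend u du ddu a b Hab Hu Hdu Hddu) as [f Hf].
  { intros x Hx; rewrite Edu by exact Hx.
    apply (is_derive_ext_Ioo (fun t => Re (y t)) u a b); [exact Hx|intros; symmetry; now apply Eu|]. apply Hder, Hx. }
  { intros x Hx; rewrite <- (proj1 (Hode x Hx)).
    apply (is_derive_ext_Ioo (fun t => Re (dy t)) du a b); [exact Hx|intros; symmetry; now apply Edu|]. apply Hder, Hx. }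
  destruct (c2_extend v dv ddv a b Hab Hv Hdv Hddv) as [g Hg].
  { intros x Hx; rewrite Edv by exact Hx.
    apply (is_derive_ext_Ioo (fun t => Im (y t)) v a b); [exact Hx|intros; symmetry; now apply Ev|]. apply Hder, Hx. }
  { intros x Hx; rewrite <- (proj2 (Hode x Hx)).
    apply (is_derive_ext_Ioo (fun t => Im (dy t)) dv a b); [exact Hx|intros; symmetry; now apply Edv|]. apply Hder, Hx. }
  exists f, g.
  assert (Ha' : a <= a <= b) by lra. assert (Hb' : a <= b <= b) by lra.
  destruct (Hf a Ha') as [F1 [F2 _]], (Hf b Hb') as [F3 [F4 _]],
    (Hg a Ha') as [G1 [G2 _]], (Hg b Hb') as [G3 [G4 _]].
  split.
  { intros x Hx; assert (Hx' : a <= x <= b) by lra.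
    destruct (Hf x Hx') as [A1 [A2 _]], (Hg x Hx') as [B1 [B2 _]].
    rewrite A1, A2, B1, B2, Eu, Ev, Edu, Edv by exact Hx.
    destruct (y x), (dy x); split; reflexivity. }
  rewrite F1, F2, F3, F4, G1, G2, G3, G4, Eua, Eub, Eva, Evb, Edua, Edub, Edva, Edvb.
  repeat (split; [match goal with |- ?z = _ => destruct z; reflexivity end|]).
  intros x Hx; destruct (Hf x Hx) as [A1 [_ A3]], (Hg x Hx) as [B1 [_ B3]].
  rewrite A1, A3, B1, B3; unfold ddu, ddv. split; field; lra.
Qed.

Lemma at_right_within (T : UniformSpace) (D : R -> Prop) (f : R -> T) (Q : (T -> Prop) -> Prop) a b :
  a < b -> (forall x, a < x < b -> D x) -> filterlim f (within D (locally a)) Q -> filterlim f (at_right a) Q.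
Proof.
  intros Hab HD H; apply filterlim_filter_le_1 with (2 := H).
  intros U HU.
  assert (Hl : locally a (fun t => t < b)).
  { apply filter_imp with (2 := locally_Ioo (a - 1) b a ltac:(lra)). tauto. }
  unfold at_right, at_left, within in *.
  generalize (filter_and _ _ Hl HU). apply filter_imp. intros t [H1 H2] H3. apply H2, HD; lra.
Qed.

Lemma at_left_within (T : UniformSpace) (D : R -> Prop) (f : R -> T) (Q : (T -> Prop) -> Prop) a b :
  a < b -> (forall x, a < x < b -> D x) -> filterlim f (within D (locally b)) Q -> filterlim f (at_left b) Q.
Proof.
  intros Hab HD H; apply filterlim_filter_le_1 with (2 := H).
  intros U HU.
  assert (Hl : locally b (fun t => a < t)).
  { apply filter_imp with (2 := locally_Ioo a (b + 1) b ltac:(lra)). tauto. }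
  unfold at_right, at_left, within in *.
  generalize (filter_and _ _ Hl HU). apply filter_imp. intros t [H1 H2] H3. apply H2, HD; lra.
Qed.

Lemma is_derive_on_continuous (D : R -> Prop) (y : R -> C) (x : R) (l : C) : D x ->
  is_derive_on D y x l -> filterlim y (within D (locally x)) (locally (y x)).
Proof.
  intros HD H.
  assert (Hw : is_filter_lim (T := R_UniformSpace) (within D (locally x)) x).
  { intros Q HQ; apply filter_imp with (2 := HQ); auto. }
  assert (He : ex_filterdiff (U := R_NormedModule) (V := C_R_NormedModule) y (within D (locally x))).
  { eexists; exact H. }
  exact (filterdiff_continuous_aux y He x Hw).
Qed.

(** * The boundary value transmission problem *)

Lemma is_derive_on_RtoC (D : R -> Prop) (y : R -> C) (f : R -> R) (x l : R) : D x ->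
  (forall t, D t -> y t = RtoC (f t)) -> is_derive f x l -> is_derive_on D y x (RtoC l).
Proof.
  intros HD Hy Hf.
  assert (Hd : filterdiff (U := R_NormedModule) (V := C_R_NormedModule) (fun t => RtoC (f t)) (locally x)
    (fun h : R => @scal R_AbsRing C_R_NormedModule h (RtoC l))).
  { apply filterdiff_ext_lin with (fun h : R => @scal R_AbsRing C_R_NormedModule (scal h l) (RtoC 1)).
    - apply filterdiff_ext with (fun t => @scal R_AbsRing C_R_NormedModule (f t) (RtoC 1)).
      + intro t; apply injective_projections; simpl; unfold scal; simpl; unfold mult; simpl; ring.
      + apply (filterdiff_scal_l_fct (K := R_AbsRing) (U := R_NormedModule) (V := C_R_NormedModule)). exact Hf.
    - intro h; apply injective_projections; simpl; unfold scal; simpl; unfold mult; simpl; ring. }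
  destruct Hd as [Hlin Hdom]; split; [exact Hlin|].
  intros x' Hx'.
  (* The definition of [filterdiff] speaks about every limit x' of the filter. Here x is the only
     one, since x in D belongs to each of its neighbourhoods. *)
  assert (E : x' = x).
  { apply NNPP; intro Hne.
    assert (Hp : 0 < Rabs (x - x')) by (apply Rabs_pos_lt; lra).
    destruct (Hx' (ball x' (mkposreal _ Hp)) (locally_ball x' (mkposreal _ Hp))) as [e He].
    specialize (He x (ball_center x e) HD). change (Rabs (x - x') < Rabs (x - x')) in He. lra. }
  subst x'. intros eps.
  apply filter_imp with (2 := Hdom x (fun Q HQ => HQ) eps).
  intros t Ht HDt. rewrite (Hy t HDt), (Hy x HD). exact Ht.
Qed.

Lemma filterlim_RtoC {T : Type} (Fl : (T -> Prop) -> Prop) (y : T -> C) (f : T -> R) (l : R) {HF : Filter Fl} :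
  Fl (fun t => y t = RtoC (f t)) -> filterlim f Fl (locally l) -> filterlim y Fl (locally (RtoC l)).
Proof.
  intros Hy Hf. apply (filterlim_ext_loc (fun t => RtoC (f t))).
  { apply filter_imp with (2 := Hy); auto. }
  eapply filterlim_comp; [exact Hf|].
  intros Q [e He]; exists e; intros z Hz; apply He; split; [exact Hz|apply ball_center].
Qed.

Lemma continuous_within (D : R -> Prop) (f : R -> R) x : continuous f x ->
  filterlim f (within D (locally x)) (locally (f x)).
Proof.
  intro H; apply filterlim_filter_le_1 with (2 := H). intros Q HQ; apply filter_imp with (2 := HQ); auto.
Qed.

(** The finite limits of q at 0 close the half-open intervals, so each piece extends continuously to
    R. *)
Lemma q_extension (P : bvtp) : admissible P -> exists qe : bool -> R -> R,
  (forall b x, continuous (qe b) x) /\ (forall x, left_part x -> qe true x = q P x) /\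
  (forall x, right_part x -> qe false x = q P x).
Proof.
  intros [_ [_ [HL [HR [[l1 H1] [l2 H2]]]]]].
  assert (Hpi := PI_RGT_0).
  destruct (C0_extension_lt (q P) (q P (- PI)) l1 (- PI) 0 ltac:(lra)) as [qL [HqL [E1 [E2 _]]]].
  { intros c Hc.
    assert (Hl : locally c left_part).
    { apply filter_imp with (2 := locally_Ioo (- PI) 0 c Hc). unfold left_part; intros; lra. }
    apply filterlim_filter_le_1 with (2 := HL c ltac:(unfold left_part; lra)).
    intros Q HQ. unfold within in HQ. generalize (filter_and _ _ Hl HQ). apply filter_imp. tauto. }
  { apply (at_right_within R_UniformSpace left_part (q P) _ (- PI) 0); [lra|unfold left_part; intros; lra|].
    apply HL; unfold left_part; lra. }
  { exact H1. }
  destruct (C0_extension_lt (q P) l2 (q P PI) 0 PI ltac:(lra)) as [qR [HqR [E3 [_ E4]]]].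
  { intros c Hc.
    assert (Hl : locally c right_part).
    { apply filter_imp with (2 := locally_Ioo 0 PI c Hc). unfold right_part; intros; lra. }
    apply filterlim_filter_le_1 with (2 := HR c ltac:(unfold right_part; lra)).
    intros Q HQ. unfold within in HQ. generalize (filter_and _ _ Hl HQ). apply filter_imp. tauto. }
  { exact H2. }
  { apply (at_left_within R_UniformSpace right_part (q P) _ 0 PI); [lra|unfold right_part; intros; lra|].
    apply HR; unfold right_part; lra. }
  exists (fun b : bool => if b then qL else qR); split; [|split].
  - intros [|] x; [apply HqL|apply HqR].
  - intros x [Hx1 Hx2]; destruct (Req_dec x (- PI)) as [->|Hne]; [exact E2|apply E1; lra].
  - intros x [Hx1 Hx2]; destruct (Req_dec x PI) as [->|Hne]; [exact E4|apply E3; lra].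
Qed.

(** * The boundary value transmission problem in real form *)

Section Bridge.
Variable P : bvtp.
Hypothesis HP : admissible P.
Hypothesis HDelta : 0 < DeltaT P 1 2 * DeltaT P 3 4.
Variable qe : bool -> R -> R.
Hypothesis qe_con : forall b x, continuous (qe b) x.
Hypothesis qe_left : forall x, left_part x -> qe true x = q P x.
Hypothesis qe_right : forall x, right_part x -> qe false x = q P x.

Let D12 := DeltaT P 1 2. Let D34 := DeltaT P 3 4.
Let D13 := DeltaT P 1 3. Let D14 := DeltaT P 1 4.
Let D23 := DeltaT P 2 3. Let D24 := DeltaT P 2 4.

Lemma D12_neq0 : D12 <> 0.
Proof. intro H; fold D12 D34 in HDelta; rewrite H in HDelta; lra. Qed.

Lemma D34_neq0 : D34 <> 0.
Proof. intro H; fold D12 D34 in HDelta; rewrite H in HDelta; lra. Qed.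

(** The Pluecker relation for the minors of a 2 x 4 matrix. It evaluates the determinant of the
    transmission matrix to Delta_34 / Delta_12. *)
Lemma plucker : D13 * D24 - D14 * D23 = D12 * D34.
Proof. unfold D13, D24, D14, D23, D12, D34, DeltaT; ring. Qed.

(* Multiplying by the common sign of [Delta_12] and [Delta_34] makes the weights positive. *)
Definition sgn_delta : R := if Rlt_dec 0 D12 then 1 else -1.
Let sg := sgn_delta.

Lemma sgn_sq : sg * sg = 1.
Proof. unfold sg, sgn_delta; destruct (Rlt_dec 0 D12); lra. Qed.

Lemma sgn_neq0 : sg <> 0.
Proof. unfold sg, sgn_delta; destruct (Rlt_dec 0 D12); lra. Qed.

Lemma sgn_D12 : sg * D12 > 0.
Proof. assert (H := D12_neq0). unfold sg, sgn_delta; destruct (Rlt_dec 0 D12); lra. Qed.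

Lemma sgn_D34 : sg * D34 > 0.
Proof.
  assert (H := D34_neq0). fold D12 D34 in HDelta. unfold sg, sgn_delta; destruct (Rlt_dec 0 D12); nra.
Qed.

(** The transmission matrix comes from solving the two conditions for the values at 0+ by Cramer's
    rule. Its determinant dictates the ratio of the weights, and [sg] makes them positive. *)
Definition sl_of_bvtp : sl_data.
Proof.
  refine (SLData (fun b : bool => if b then - PI else 0) (fun b : bool => if b then 0 else PI)
    (fun b : bool => if b then p1 P else p2 P) (fun b : bool => if b then sg * D34 else sg * D12) qe
    (cos (alpha P)) (sin (alpha P)) (cos (beta P)) (sin (beta P))
    (D23 / D12) (D24 / D12) (- D13 / D12) (- D14 / D12) _ _ _ qe_con _ _ _).
  - assert (H := PI_RGT_0); intros [|]; lra.
  - intros [|]; apply HP.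
  - intros [|]; [apply sgn_D34|apply sgn_D12].
  - assert (H := sin2_cos2 (alpha P)). unfold Rsqr in H.
    destruct (Req_dec (cos (alpha P)) 0) as [E|E]; [right|left; exact E].
    intro E2; rewrite E, E2 in H; lra.
  - assert (H := sin2_cos2 (beta P)). unfold Rsqr in H.
    destruct (Req_dec (cos (beta P)) 0) as [E|E]; [right|left; exact E].
    intro E2; rewrite E, E2 in H; lra.
  - assert (H := D12_neq0).
    transitivity (sg * (D13 * D24 - D14 * D23) / D12); [field; exact H|].
    rewrite plucker; field; exact H.
Defined.

Let M := sl_of_bvtp.

Lemma left_solution lam y dy ym dym : is_solution P left_part lam y dy -> lim0m y ym -> lim0m dy dym ->
  exists f g : c2,
    (forall x, left_part x -> y x = (v0 f x, v0 g x) /\ dy x = (v1 f x, v1 g x)) /\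
    ym = (v0 f 0, v0 g 0) /\ dym = (v1 f 0, v1 g 0) /\
    (forall x, - PI <= x <= 0 ->
       - p1 P * v2 f x + qe true x * v0 f x = Re lam * v0 f x - Im lam * v0 g x /\
       - p1 P * v2 g x + qe true x * v0 g x = Im lam * v0 f x + Re lam * v0 g x).
Proof.
  intros Hs Hy Hdy; assert (Hpi := PI_RGT_0).
  assert (HD : left_part (- PI)) by (unfold left_part; lra).
  assert (HI : forall x, - PI < x < 0 -> left_part x) by (unfold left_part; intros; lra).
  destruct Hs as [ddy Hs']. assert (Hs : is_solution P left_part lam y dy) by now exists ddy.
  destruct (Hs' _ HD) as [K1 [K2 _]].
  destruct (solution_components P left_part (- PI) 0 (p1 P) (qe true) lam y dy (y (- PI)) (dy (- PI)) ym dym)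
    as [f [g [H1 [H2 [H3 [H4 [H5 H6]]]]]]]; auto; try lra.
  - apply HP.
  - intros x Hx; split; [auto|]; split; [|now apply qe_left, HI].
    unfold pcoef; destruct (Rlt_dec x 0); lra.
  - apply (at_right_within _ left_part y _ (- PI) 0); auto; try lra. eapply is_derive_on_continuous; eauto.
  - apply (at_right_within _ left_part dy _ (- PI) 0); auto; try lra. eapply is_derive_on_continuous; eauto.
  - exists f, g; split; [|auto].
    intros x [Hx1 Hx2]; destruct (Req_dec x (- PI)) as [->|Hne]; [auto|apply H1; lra].
Qed.

Lemma right_solution lam y dy yp dyp : is_solution P right_part lam y dy -> lim0p y yp -> lim0p dy dyp ->
  exists f g : c2,
    (forall x, right_part x -> y x = (v0 f x, v0 g x) /\ dy x = (v1 f x, v1 g x)) /\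
    yp = (v0 f 0, v0 g 0) /\ dyp = (v1 f 0, v1 g 0) /\
    (forall x, 0 <= x <= PI ->
       - p2 P * v2 f x + qe false x * v0 f x = Re lam * v0 f x - Im lam * v0 g x /\
       - p2 P * v2 g x + qe false x * v0 g x = Im lam * v0 f x + Re lam * v0 g x).
Proof.
  intros Hs Hy Hdy; assert (Hpi := PI_RGT_0).
  assert (HD : right_part PI) by (unfold right_part; lra).
  assert (HI : forall x, 0 < x < PI -> right_part x) by (unfold right_part; intros; lra).
  destruct Hs as [ddy Hs']. assert (Hs : is_solution P right_part lam y dy) by now exists ddy.
  destruct (Hs' _ HD) as [K1 [K2 _]].
  destruct (solution_components P right_part 0 PI (p2 P) (qe false) lam y dy yp dyp (y PI) (dy PI))
    as [f [g [H1 [H2 [H3 [H4 [H5 H6]]]]]]]; auto; try lra.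
  - apply HP.
  - intros x Hx; split; [auto|]; split; [|now apply qe_right, HI].
    unfold pcoef; destruct (Rlt_dec x 0); lra.
  - apply (at_left_within _ right_part y _ 0 PI); auto; try lra. eapply is_derive_on_continuous; eauto.
  - apply (at_left_within _ right_part dy _ 0 PI); auto; try lra. eapply is_derive_on_continuous; eauto.
  - exists f, g; split; [|auto].
    intros x [Hx1 Hx2]; destruct (Req_dec x PI) as [->|Hne]; [auto|apply H1; lra].
Qed.

Lemma transm_iff u v u' v' : transm M u v u' v' <->
  (forall i, (i = 1%nat \/ i = 2%nat) -> bm P i 1 * v + bm P i 0 * u + bp P i 1 * v' + bp P i 0 * u' = 0).
Proof.
  assert (HD := D12_neq0). unfold transm; simpl. split.
  - intros [E1 E2] i Hi.
    apply (Rmult_eq_reg_l D12); [|exact HD]. rewrite E1, E2.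
    transitivity (D12 * (bm P i 1 * v + bm P i 0 * u) + bp P i 1 * (- D13 * u + - D14 * v) +
      bp P i 0 * (D23 * u + D24 * v)); [field; exact HD|].
    unfold D12, D13, D14, D23, D24, DeltaT, Tmat.
    destruct Hi as [-> | ->]; ring.
  - intro H. assert (E1 := H 1%nat (or_introl eq_refl)). assert (E2 := H 2%nat (or_intror eq_refl)).
    split; apply (Rmult_eq_reg_l D12); try exact HD.
    + transitivity (D23 * u + D24 * v); [|field; exact HD].
      (* Eliminates v' between the two conditions; below, u' is eliminated in the same way. *)
      assert (E : bp P 2 1 * (bm P 1 1 * v + bm P 1 0 * u + bp P 1 1 * v' + bp P 1 0 * u') -
        bp P 1 1 * (bm P 2 1 * v + bm P 2 0 * u + bp P 2 1 * v' + bp P 2 0 * u') = 0) by (rewrite E1, E2; ring).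
      unfold D12, D23, D24, DeltaT, Tmat. lra.
    + transitivity (- D13 * u + - D14 * v); [|field; exact HD].
      assert (E : bp P 2 0 * (bm P 1 1 * v + bm P 1 0 * u + bp P 1 1 * v' + bp P 1 0 * u') -
        bp P 1 0 * (bm P 2 1 * v + bm P 2 0 * u + bp P 2 1 * v' + bp P 2 0 * u') = 0) by (rewrite E1, E2; ring).
      unfold D12, D13, D14, DeltaT, Tmat. lra.
Qed.

Definition on_I (Q : bool -> R -> Prop) := forall b t, sl_lo M b <= t <= sl_hi M b -> Q b t.

Lemma on_I_intro (Q : bool -> R -> Prop) : (forall t, - PI <= t <= 0 -> Q true t) ->
  (forall t, 0 <= t <= PI -> Q false t) -> on_I Q.
Proof. intros H1 H2 [|] t Ht; [apply H1, Ht|apply H2, Ht]. Qed.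

Lemma real_eigenvalue U mu : dom M U -> on_I (fun b t => lop M U b t = mu * v0 (U b) t) ->
  (exists b t, sl_lo M b <= t <= sl_hi M b /\ v0 (U b) t <> 0) -> is_eigenvalue P (RtoC mu).
Proof.
  intros [HU1 [HU2 HU3]] HL Hne; assert (Hpi := PI_RGT_0).
  simpl in HU1, HU2, HU3.
  set (pw := fun (f : c2 -> R -> R) x => RtoC (if Rlt_dec x 0 then f (U true) x else f (U false) x)).
  assert (Hpl : forall f x, x < 0 -> pw f x = RtoC (f (U true) x)).
  { intros f x Hx; unfold pw; destruct (Rlt_dec x 0); [reflexivity|lra]. }
  assert (Hpr : forall f x, 0 <= x -> pw f x = RtoC (f (U false) x)).
  { intros f x Hx; unfold pw; destruct (Rlt_dec x 0); [lra|reflexivity]. }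
  exists (pw v0), (pw v1). split; [|split; [|split; [|split; [|split]]]].
  - exists (pw v2); intros x Hx; unfold left_part in Hx. split; [|split].
    + rewrite (Hpl v1) by lra. apply (is_derive_on_RtoC _ _ (v0 (U true)));
        [exact Hx|intros t Ht; apply Hpl; apply Ht|apply v0_der].
    + rewrite (Hpl v2) by lra. apply (is_derive_on_RtoC _ _ (v1 (U true)));
        [exact Hx|intros t Ht; apply Hpl; apply Ht|apply v1_der].
    + rewrite !Hpl by lra. assert (E := HL true x ltac:(simpl; lra)).
      unfold lop in E; simpl in E. rewrite qe_left in E by exact Hx.
      unfold pcoef; destruct (Rlt_dec x 0); [|lra].
      rewrite <- !RtoC_mult, <- RtoC_opp, <- RtoC_mult, <- RtoC_plus. now rewrite E.
  - exists (pw v2); intros x Hx; unfold right_part in Hx. split; [|split].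
    + rewrite (Hpr v1) by lra. apply (is_derive_on_RtoC _ _ (v0 (U false)));
        [exact Hx|intros t Ht; apply Hpr; unfold right_part in Ht; lra|apply v0_der].
    + rewrite (Hpr v2) by lra. apply (is_derive_on_RtoC _ _ (v1 (U false)));
        [exact Hx|intros t Ht; apply Hpr; unfold right_part in Ht; lra|apply v1_der].
    + rewrite !Hpr by lra. assert (E := HL false x ltac:(simpl; lra)).
      unfold lop in E; simpl in E. rewrite qe_right in E by exact Hx.
      unfold pcoef; destruct (Rlt_dec x 0); [lra|].
      rewrite <- !RtoC_mult, <- RtoC_opp, <- RtoC_mult, <- RtoC_plus. now rewrite E.
  - rewrite !Hpl by lra. rewrite <- !RtoC_mult, <- RtoC_plus. unfold bc_left in HU1; simpl in HU1. now rewrite HU1.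
  - rewrite !Hpr by lra. rewrite <- !RtoC_mult, <- RtoC_plus. unfold bc_right in HU2; simpl in HU2. now rewrite HU2.
  - exists (RtoC (v0 (U true) 0)), (RtoC (v1 (U true) 0)), (RtoC (v0 (U false) 0)), (RtoC (v1 (U false) 0)).
    assert (Hml : forall f, at_left 0 (fun t => pw f t = RtoC (f (U true) t))).
    { intro f; exists posreal_one; intros t _ Ht; now apply Hpl. }
    assert (Hmr : forall f, at_right 0 (fun t => pw f t = RtoC (f (U false) t))).
    { intro f; exists posreal_one; intros t _ Ht; apply Hpr; lra. }
    split; [|split; [|split; [|split]]].
    + apply (filterlim_RtoC (at_left 0) (pw v0) (v0 (U true)) (v0 (U true) 0)); [apply Hml|apply continuous_within, v0_con].
    + apply (filterlim_RtoC (at_left 0) (pw v1) (v1 (U true)) (v1 (U true) 0)); [apply Hml|apply continuous_within, v1_con].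
    + apply (filterlim_RtoC (at_right 0) (pw v0) (v0 (U false)) (v0 (U false) 0)); [apply Hmr|apply continuous_within, v0_con].
    + apply (filterlim_RtoC (at_right 0) (pw v1) (v1 (U false)) (v1 (U false) 0)); [apply Hmr|apply continuous_within, v1_con].
    + intros i Hi. rewrite <- !RtoC_mult, <- !RtoC_plus. f_equal. exact (proj1 (transm_iff _ _ _ _) HU3 i Hi).
  (* The given point of nonvanishing may be 0, which is not in [two_intervals]. If the function were
     zero off 0, its one-sided continuity there would make it zero at 0- and 0+ too. *)
  - apply NNPP; intro Hz.
    assert (Hz2 : forall x, two_intervals x -> pw v0 x = 0%C).
    { intros x Hx; apply NNPP; intro; apply Hz; now exists x. }
    assert (HzT : forall x, - PI <= x < 0 -> v0 (U true) x = 0).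
    { intros x Hx; apply RtoC_inj; rewrite <- Hpl by lra. apply Hz2; left; exact Hx. }
    assert (HzF : forall x, 0 < x <= PI -> v0 (U false) x = 0).
    { intros x Hx; apply RtoC_inj; rewrite <- Hpr by lra. apply Hz2; right; exact Hx. }
    destruct Hne as [b [t [Ht Hne]]]; apply Hne.
    destruct b; simpl in Ht.
    + destruct (Req_dec t 0) as [->|Ht0]; [|apply HzT; lra].
      apply (filterlim_locally_unique (K := R_AbsRing) (V := R_NormedModule) (F := at_left 0) (v0 (U true))).
      * apply continuous_within, v0_con.
      * apply filterlim_ext_loc with (fun _ => 0); [|apply filterlim_const].
        exists (mkposreal PI Hpi); intros s Hs1 Hs2. symmetry; apply HzT.
        change (Rabs (s - 0) < PI) in Hs1. apply Rabs_lt_between in Hs1. lra.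
    + destruct (Req_dec t 0) as [->|Ht0]; [|apply HzF; lra].
      apply (filterlim_locally_unique (K := R_AbsRing) (V := R_NormedModule) (F := at_right 0) (v0 (U false))).
      * apply continuous_within, v0_con.
      * apply filterlim_ext_loc with (fun _ => 0); [|apply filterlim_const].
        exists (mkposreal PI Hpi); intros s Hs1 Hs2. symmetry; apply HzF.
        change (Rabs (s - 0) < PI) in Hs1. apply Rabs_lt_between in Hs1. lra.
Qed.


(** For y = U + iV and lam = a + ib one has L U = aU - bV and L V = bU + aV; symmetry of L gives b
    (|U|^2 + |V|^2) = 0. One of U, V is then a nonzero real eigenfunction. *)
Lemma eigenvalue_real lam : is_eigenvalue P lam -> Im lam = 0 /\ exists U, dom M U /\
  on_I (fun b t => lop M U b t = Re lam * v0 (U b) t) /\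
  (exists b t, sl_lo M b <= t <= sl_hi M b /\ v0 (U b) t <> 0).
Proof.
  intros [y [dy [HsL [HsR [HbL [HbR [[ym [dym [yp [dyp [Lm [Ldm [Lp [Ldp Htr]]]]]]]] [x0 [Hx0 Hne]]]]]]]]].
  assert (Hpi := PI_RGT_0).
  destruct (left_solution lam y dy ym dym HsL Lm Ldm) as [fL [gL [EL [EymL [EdymL OL]]]]].
  destruct (right_solution lam y dy yp dyp HsR Lp Ldp) as [fR [gR [ER [EypR [EdypR OR]]]]].
  set (U := fun b : bool => if b then fL else fR). set (V := fun b : bool => if b then gL else gR).
  assert (HlopU : forall b t, sl_lo M b <= t <= sl_hi M b ->
    lop M U b t = Re lam * val U b t + - Im lam * val V b t).
  { intros [|] t Ht; unfold lop, val, U, V; simpl.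
    - rewrite (proj1 (OL t Ht)); ring.
    - rewrite (proj1 (OR t Ht)); ring. }
  assert (HlopV : forall b t, sl_lo M b <= t <= sl_hi M b ->
    lop M V b t = Im lam * val U b t + Re lam * val V b t).
  { intros [|] t Ht; unfold lop, val, U, V; simpl.
    - rewrite (proj2 (OL t Ht)); ring.
    - rewrite (proj2 (OR t Ht)); ring. }
  destruct (EL (- PI)) as [A1 A2]; [unfold left_part; lra|].
  destruct (ER PI) as [B1 B2]; [unfold right_part; lra|].
  rewrite A1, A2 in HbL. rewrite B1, B2 in HbR.
  injection HbL as L1 L2. injection HbR as R1 R2.
  assert (T1 : transm M (v0 fL 0) (v1 fL 0) (v0 fR 0) (v1 fR 0)).
  { apply transm_iff; intros i Hi; specialize (Htr i Hi).
    rewrite EymL, EdymL, EypR, EdypR in Htr. injection Htr as T1 _. lra. }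
  assert (T2 : transm M (v0 gL 0) (v1 gL 0) (v0 gR 0) (v1 gR 0)).
  { apply transm_iff; intros i Hi; specialize (Htr i Hi).
    rewrite EymL, EdymL, EypR, EdypR in Htr. injection Htr as _ T2. lra. }
  assert (HdU : dom M U).
  { unfold dom, bc_left, bc_right; simpl; split; [lra|split; [lra|exact T1]]. }
  assert (HdV : dom M V).
  { unfold dom, bc_left, bc_right; simpl; split; [lra|split; [lra|exact T2]]. }
  assert (Hnz : (exists b t, sl_lo M b <= t <= sl_hi M b /\ v0 (U b) t <> 0) \/
    (exists b t, sl_lo M b <= t <= sl_hi M b /\ v0 (V b) t <> 0)).
  { apply NNPP; intro Hz; apply Hne.
    assert (Z : forall b t, sl_lo M b <= t <= sl_hi M b -> v0 (U b) t = 0 /\ v0 (V b) t = 0).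
    { intros b t Ht; split; apply NNPP; intro; apply Hz; [left|right]; now exists b, t. }
    destruct Hx0 as [Hx0|Hx0].
    - rewrite (proj1 (EL x0 Hx0)). unfold left_part in Hx0.
      destruct (Z true x0) as [Z1 Z2]; [simpl; lra|]. simpl in Z1, Z2. now rewrite Z1, Z2.
    - rewrite (proj1 (ER x0 Hx0)). unfold right_part in Hx0.
      destruct (Z false x0) as [Z1 Z2]; [simpl; lra|]. simpl in Z1, Z2. now rewrite Z1, Z2. }
  assert (Him : Im lam = 0).
  { assert (S := lop_symmetric M U V HdU HdV).
    assert (Hc : forall W b x, continuous (val W b) x) by (intros; apply v0_con).
    rewrite (ip_ext M (lop M U) (val V) (fun b t => Re lam * val U b t + - Im lam * val V b t) (val V)) in S
      by (intros; now rewrite HlopU).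
    rewrite (ip_comm M (val U) (lop M V)) in S.
    rewrite (ip_ext M (lop M V) (val U) (fun b t => Im lam * val U b t + Re lam * val V b t) (val U)) in S
      by (intros; now rewrite HlopV).
    rewrite 2!ip_lin_l, (ip_comm M (val V) (val U)) in S by auto.
    assert (G1 := ip_ge0 M U). assert (G2 := ip_ge0 M V).
    assert (E : Im lam * (ip M (val U) (val U) + ip M (val V) (val V)) = 0) by lra.
    destruct (Rmult_integral _ _ E) as [E1|E1]; [exact E1|exfalso].
    destruct Hnz as [[b [t [Ht Hn]]]|[b [t [Ht Hn]]]]; apply Hn.
    - apply (ip_eq0 M U); [lra|exact Ht].
    - apply (ip_eq0 M V); [lra|exact Ht]. }
  split; [exact Him|].
  destruct Hnz as [Hn|Hn]; [exists U|exists V]; (split; [assumption|]; split; [|exact Hn]).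
  - intros b t Ht; rewrite HlopU, Him by exact Ht; unfold val; ring.
  - intros b t Ht; rewrite HlopV, Him by exact Ht; unfold val; ring.
Qed.

(** * Basic solutions at real values of the parameter *)

Variable S : basic_solutions P.

Lemma imaginary_part_zero b (g : c2) mu t0 : sl_lo M b <= t0 <= sl_hi M b ->
  (forall t, sl_lo M b <= t <= sl_hi M b -> - pc M b * v2 g t + qe b t * v0 g t = mu * v0 g t) ->
  v0 g t0 = 0 -> v1 g t0 = 0 -> forall t, sl_lo M b <= t <= sl_hi M b -> v0 g t = 0 /\ v1 g t = 0.
Proof.
  intros Ht0 Ho H0 H1.
  apply (linear_ode_unique g (pc M b) mu (qe b) (sl_lo M b) (sl_hi M b) t0); auto. apply (pc_pos M).
Qed.

(** The imaginary part solves the same real equation with zero data at -PI, hence vanishes on the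
    left. The data at 0+ are then real, so it vanishes on the right as well. *)
Lemma phi_real (mu : R) : exists F : bool -> c2,
  on_I (fun b t => lop M F b t = mu * v0 (F b) t) /\
  v0 (F true) (- PI) = sin (alpha P) /\ v1 (F true) (- PI) = - cos (alpha P) /\
  transm M (v0 (F true) 0) (v1 (F true) 0) (v0 (F false) 0) (v1 (F false) 0) /\
  (forall x, left_part x -> phi1 S mu x = RtoC (v0 (F true) x)) /\
  (forall x, right_part x -> phi2 S mu x = RtoC (v0 (F false) x)) /\
  (forall x, left_part x -> dphi1 S mu x = RtoC (v1 (F true) x)) /\
  (forall x, right_part x -> dphi2 S mu x = RtoC (v1 (F false) x)).
Proof.
  assert (Hpi := PI_RGT_0). assert (HD := D12_neq0).
  destruct (phi1_sol P S mu) as [HL [HL0 HL1]].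
  destruct (phi2_sol P S mu) as [HR [u [du [Lu [Ldu [Lp Ldp]]]]]].
  destruct (left_solution mu _ _ u du HL Lu Ldu) as [f [g [E [Eu [Edu O]]]]].
  destruct (right_solution mu _ _ _ _ HR Lp Ldp) as [f' [g' [E' [Eu' [Edu' O']]]]].
  destruct (E (- PI)) as [A1 A2]; [unfold left_part; lra|].
  rewrite HL0 in A1. rewrite HL1 in A2. injection A1 as A1 A3. injection A2 as A2 A4.
  assert (Z : forall t, - PI <= t <= 0 -> v0 g t = 0 /\ v1 g t = 0).
  { apply (imaginary_part_zero true g mu (- PI)); simpl; try lra.
    intros t Ht; rewrite (proj2 (O t Ht)); simpl; ring. }
  destruct (Z 0) as [Z1 Z2]; [lra|]. rewrite Z1 in Eu. rewrite Z2 in Edu.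
  rewrite Eu, Edu in Eu', Edu'.
  (* Clearing the complex denominator makes the components of the equations polynomial. *)
  apply (f_equal (fun z : C => (D12 * z)%C)) in Eu'. apply (f_equal (fun z : C => (D12 * z)%C)) in Edu'.
  assert (HDC : RtoC D12 <> 0%C) by (intro H; apply HD; now apply RtoC_inj).
  fold D12 in Eu', Edu'.
  match type of Eu' with ?l = _ => replace l with (DeltaT P 2 3 * (v0 f 0, 0) + DeltaT P 2 4 * (v1 f 0, 0))%C in Eu'
    by (field; exact HDC) end.
  match type of Edu' with ?l = _ => replace l with (- (DeltaT P 1 3 * (v0 f 0, 0) + DeltaT P 1 4 * (v1 f 0, 0)))%C in Edu'
    by (field; exact HDC) end.
  fold D23 D24 in Eu'. fold D13 D14 in Edu'.
  injection Eu' as I1 I2. injection Edu' as I3 I4.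
  assert (Z' : forall t, 0 <= t <= PI -> v0 g' t = 0 /\ v1 g' t = 0).
  { apply (imaginary_part_zero false g' mu 0); simpl; try lra.
    - intros t Ht; rewrite (proj2 (O' t Ht)); simpl; ring.
    - apply (Rmult_eq_reg_l D12); [lra|exact HD].
    - apply (Rmult_eq_reg_l D12); [lra|exact HD]. }
  exists (fun b : bool => if b then f else f'); simpl.
  split; [|split; [|split; [|split; [|split; [|split; [|split]]]]]].
  - apply on_I_intro; intros t Ht; unfold lop; simpl.
    + rewrite (proj1 (O t Ht)); simpl; ring.
    + rewrite (proj1 (O' t Ht)); simpl; ring.
  - exact (eq_sym A1).
  - exact (eq_sym A2).
  - split; simpl; apply (Rmult_eq_reg_l D12); try exact HD.
    + transitivity (D23 * v0 f 0 + D24 * v1 f 0); [lra|field; exact HD].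
    + transitivity (- D13 * v0 f 0 + - D14 * v1 f 0); [lra|field; exact HD].
  - intros x Hx; rewrite (proj1 (E x Hx)). now rewrite (proj1 (Z x ltac:(unfold left_part in Hx; lra))).
  - intros x Hx; rewrite (proj1 (E' x Hx)). now rewrite (proj1 (Z' x ltac:(unfold right_part in Hx; lra))).
  - intros x Hx; rewrite (proj2 (E x Hx)). now rewrite (proj2 (Z x ltac:(unfold left_part in Hx; lra))).
  - intros x Hx; rewrite (proj2 (E' x Hx)). now rewrite (proj2 (Z' x ltac:(unfold right_part in Hx; lra))).
Qed.

(** As for phi, but starting from PI and crossing 0 from right to left. *)
Lemma chi_real (mu : R) : exists F : bool -> c2,
  on_I (fun b t => lop M F b t = mu * v0 (F b) t) /\
  v0 (F false) PI = - sin (beta P) /\ v1 (F false) PI = cos (beta P) /\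
  transm M (v0 (F true) 0) (v1 (F true) 0) (v0 (F false) 0) (v1 (F false) 0) /\
  (forall x, left_part x -> chi1 S mu x = RtoC (v0 (F true) x)) /\
  (forall x, right_part x -> chi2 S mu x = RtoC (v0 (F false) x)) /\
  (forall x, left_part x -> dchi1 S mu x = RtoC (v1 (F true) x)) /\
  (forall x, right_part x -> dchi2 S mu x = RtoC (v1 (F false) x)).
Proof.
  assert (Hpi := PI_RGT_0). assert (HD := D12_neq0). assert (HD' := D34_neq0).
  destruct (chi2_sol P S mu) as [HR [HR0 HR1]].
  destruct (chi1_sol P S mu) as [HL [u [du [Lu [Ldu [Lm Ldm]]]]]].
  destruct (right_solution mu _ _ u du HR Lu Ldu) as [f' [g' [E' [Eu' [Edu' O']]]]].
  destruct (left_solution mu _ _ _ _ HL Lm Ldm) as [f [g [E [Eu [Edu O]]]]].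
  destruct (E' PI) as [A1 A2]; [unfold right_part; lra|].
  rewrite HR0 in A1. rewrite HR1 in A2. injection A1 as A1 A3. injection A2 as A2 A4.
  assert (Z' : forall t, 0 <= t <= PI -> v0 g' t = 0 /\ v1 g' t = 0).
  { apply (imaginary_part_zero false g' mu PI); simpl; try lra.
    intros t Ht; rewrite (proj2 (O' t Ht)); simpl; ring. }
  destruct (Z' 0) as [Z1 Z2]; [lra|]. rewrite Z1 in Eu'. rewrite Z2 in Edu'.
  rewrite Eu', Edu' in Eu, Edu.
  apply (f_equal (fun z : C => (D34 * z)%C)) in Eu. apply (f_equal (fun z : C => (D34 * z)%C)) in Edu.
  assert (HDC : RtoC D34 <> 0%C) by (intro H; apply HD'; now apply RtoC_inj).
  fold D34 in Eu, Edu.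
  match type of Eu with ?l = _ => replace l with (- (DeltaT P 1 4 * (v0 f' 0, 0) + DeltaT P 2 4 * (v1 f' 0, 0)))%C in Eu
    by (field; exact HDC) end.
  match type of Edu with ?l = _ => replace l with (DeltaT P 1 3 * (v0 f' 0, 0) + DeltaT P 2 3 * (v1 f' 0, 0))%C in Edu
    by (field; exact HDC) end.
  fold D14 D24 in Eu. fold D13 D23 in Edu.
  injection Eu as I1 I2. injection Edu as I3 I4.
  assert (Z : forall t, - PI <= t <= 0 -> v0 g t = 0 /\ v1 g t = 0).
  { apply (imaginary_part_zero true g mu 0); simpl; try lra.
    - intros t Ht; rewrite (proj2 (O t Ht)); simpl; ring.
    - apply (Rmult_eq_reg_l D34); [lra|exact HD'].
    - apply (Rmult_eq_reg_l D34); [lra|exact HD']. }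
  exists (fun b : bool => if b then f else f'); simpl.
  split; [|split; [|split; [|split; [|split; [|split; [|split]]]]]].
  - apply on_I_intro; intros t Ht; unfold lop; simpl.
    + rewrite (proj1 (O t Ht)); simpl; ring.
    + rewrite (proj1 (O' t Ht)); simpl; ring.
  - exact (eq_sym A1).
  - exact (eq_sym A2).
  (* [chi1] is prescribed through values at 0+, [transm] runs the other way; the two matrices are
     inverse by the Pluecker relation. *)
  - assert (Pl := plucker).
    split; simpl; apply (Rmult_eq_reg_l (D12 * D34)); try (now apply Rmult_integral_contrapositive).
    + transitivity (D23 * (D34 * v0 f 0) + D24 * (D34 * v1 f 0)); [|field; exact HD].
      replace (D34 * v0 f 0) with (- (D14 * v0 f' 0 + D24 * v1 f' 0)) by lra.
      replace (D34 * v1 f 0) with (D13 * v0 f' 0 + D23 * v1 f' 0) by lra.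
      rewrite <- Pl; ring.
    + transitivity (- D13 * (D34 * v0 f 0) + - D14 * (D34 * v1 f 0)); [|field; exact HD].
      replace (D34 * v0 f 0) with (- (D14 * v0 f' 0 + D24 * v1 f' 0)) by lra.
      replace (D34 * v1 f 0) with (D13 * v0 f' 0 + D23 * v1 f' 0) by lra.
      rewrite <- Pl; ring.
  - intros x Hx; rewrite (proj1 (E x Hx)). now rewrite (proj1 (Z x ltac:(unfold left_part in Hx; lra))).
  - intros x Hx; rewrite (proj1 (E' x Hx)). now rewrite (proj1 (Z' x ltac:(unfold right_part in Hx; lra))).
  - intros x Hx; rewrite (proj2 (E x Hx)). now rewrite (proj2 (Z x ltac:(unfold left_part in Hx; lra))).
  - intros x Hx; rewrite (proj2 (E' x Hx)). now rewrite (proj2 (Z' x ltac:(unfold right_part in Hx; lra))).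
Qed.

(** Simplicity of the eigenvalues: the condition at -PI makes the initial data of U proportional to
    those of phi, and uniqueness carries the factor along the left interval, across 0 and along the
    right one. *)
Lemma phi_multiple U F mu : dom M U -> on_I (fun b t => lop M U b t = mu * v0 (U b) t) ->
  on_I (fun b t => lop M F b t = mu * v0 (F b) t) ->
  v0 (F true) (- PI) = sin (alpha P) -> v1 (F true) (- PI) = - cos (alpha P) ->
  transm M (v0 (F true) 0) (v1 (F true) 0) (v0 (F false) 0) (v1 (F false) 0) ->
  exists k, on_I (fun b t => v0 (U b) t = k * v0 (F b) t /\ v1 (U b) t = k * v1 (F b) t).
Proof.
  intros [HU1 [HU2 [HU3 HU4]]] HLU HLF F0 F1 [T1 T2]. assert (Hpi := PI_RGT_0).
  unfold bc_left in HU1; simpl in HU1, HU3, HU4, T1, T2.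
  set (u := v0 (U true) (- PI)) in *. set (du := v1 (U true) (- PI)) in *.
  (* The component of (u, u') along the unit vector (sin alpha, -cos alpha), which spans the
     solutions of the left condition. *)
  set (k := sin (alpha P) * u - cos (alpha P) * du).
  assert (Hsc := sin2_cos2 (alpha P)). unfold Rsqr in Hsc.
  set (ss := sin (alpha P)) in *. set (cc := cos (alpha P)) in *.
  assert (Eu : u = k * ss).
  { unfold k. transitivity (u * (ss * ss + cc * cc) - cc * (cc * u + ss * du)); [rewrite Hsc, HU1; ring|ring]. }
  assert (Edu : du = k * - cc).
  { unfold k. transitivity (du * (ss * ss + cc * cc) - ss * (cc * u + ss * du)); [rewrite Hsc, HU1; ring|ring]. }
  set (W := lin 1 U (- k) F).
  assert (HW : forall b t, sl_lo M b <= t <= sl_hi M b -> - pc M b * v2 (W b) t + qe b t * v0 (W b) t = mu * v0 (W b) t).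
  { intros b t Ht. change (lop M W b t = mu * v0 (W b) t). unfold W; rewrite lop_lin, HLU, HLF by exact Ht.
    simpl; ring. }
  assert (WT : forall t, - PI <= t <= 0 -> v0 (W true) t = 0 /\ v1 (W true) t = 0).
  { apply (imaginary_part_zero true (W true) mu (- PI)); [simpl; lra|apply HW| |]; simpl.
    - fold u; rewrite F0, Eu; ring.
    - fold du; rewrite F1, Edu; ring. }
  assert (WF : forall t, 0 <= t <= PI -> v0 (W false) t = 0 /\ v1 (W false) t = 0).
  { destruct (WT 0) as [Z1 Z2]; [lra|]; simpl in Z1, Z2.
    assert (Y1 : v0 (U true) 0 = k * v0 (F true) 0) by lra.
    assert (Y2 : v1 (U true) 0 = k * v1 (F true) 0) by lra.
    apply (imaginary_part_zero false (W false) mu 0); [simpl; lra|apply HW| |]; simpl.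
    - rewrite HU3, T1, Y1, Y2; ring.
    - rewrite HU4, T2, Y1, Y2; ring. }
  exists k; apply on_I_intro; intros t Ht.
  - destruct (WT t Ht) as [Z1 Z2]; simpl in Z1, Z2; lra.
  - destruct (WF t Ht) as [Z1 Z2]; simpl in Z1, Z2; lra.
Qed.

(** An eigenfunction U is a nonzero multiple of phi, so phi inherits the condition at PI from U and
    is itself nonzero. *)
Lemma phi_eigen U F mu : dom M U -> on_I (fun b t => lop M U b t = mu * v0 (U b) t) ->
  (exists b t, sl_lo M b <= t <= sl_hi M b /\ v0 (U b) t <> 0) ->
  on_I (fun b t => lop M F b t = mu * v0 (F b) t) ->
  v0 (F true) (- PI) = sin (alpha P) -> v1 (F true) (- PI) = - cos (alpha P) ->
  transm M (v0 (F true) 0) (v1 (F true) 0) (v0 (F false) 0) (v1 (F false) 0) ->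
  dom M F /\ 0 < ip M (val F) (val F).
Proof.
  intros HU HLU [b [t [Ht Hn]]] HLF F0 F1 T. assert (Hpi := PI_RGT_0).
  destruct (phi_multiple U F mu HU HLU HLF F0 F1 T) as [k Hk].
  assert (Hk0 : k <> 0).
  { intro E; apply Hn. rewrite (proj1 (Hk b t Ht)), E; ring. }
  split.
  - split; [|split; [|exact T]].
    + unfold bc_left; simpl. rewrite F0, F1; ring.
    + unfold bc_right; simpl. destruct HU as [_ [HU _]]; unfold bc_right in HU; simpl in HU.
      destruct (Hk false PI) as [E1 E2]; [simpl; lra|]. rewrite E1, E2 in HU.
      apply (Rmult_eq_reg_l k); [lra|exact Hk0].
  - destruct (ip_ge0 M F) as [H|H]; [exact H|exfalso].
    apply Hn. rewrite (proj1 (Hk b t Ht)), (ip_eq0 M F (eq_sym H) b t Ht); ring.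
Qed.

(** On each interval the Wronskian has derivative zero. Across 0 it is multiplied by the
    transmission determinant, so the weights [mc] make the two constants equal. *)
Lemma wronskian_constant F G : on_I (fun b t => lop M F b t = 0) -> on_I (fun b t => lop M G b t = 0) ->
  transm M (v0 (F true) 0) (v1 (F true) 0) (v0 (F false) 0) (v1 (F false) 0) ->
  transm M (v0 (G true) 0) (v1 (G true) 0) (v0 (G false) 0) (v1 (G false) 0) ->
  exists c, on_I (fun b t => mc M b * (v0 (F b) t * v1 (G b) t - v1 (F b) t * v0 (G b) t) = c).
Proof.
  intros HF HG [F1 F2] [G1 G2]. assert (Hpi := PI_RGT_0).
  set (W := fun b t => v0 (F b) t * v1 (G b) t + (-1) * (v1 (F b) t * v0 (G b) t)).
  set (dW := fun b t => v0 (F b) t * v2 (G b) t + (-1) * (v2 (F b) t * v0 (G b) t)).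
  assert (HW : forall b t, is_derive (W b) t (dW b t)).
  { intros b t; unfold W, dW. eapply der_eq; [der|cbv beta; ring]. }
  assert (HdW : forall b t, sl_lo M b <= t <= sl_hi M b -> dW b t = 0).
  { intros b t Ht; unfold dW. apply (Rmult_eq_reg_l (pc M b)); [|apply Rgt_not_eq, (pc_pos M)].
    assert (A := HF b t Ht). assert (B := HG b t Ht). unfold lop in A, B.
    transitivity (v0 (G b) t * (- pc M b * v2 (F b) t + qc M b t * v0 (F b) t) -
      v0 (F b) t * (- pc M b * v2 (G b) t + qc M b t * v0 (G b) t)); [ring|rewrite A, B; ring]. }
  assert (Hc : forall b s t, sl_lo M b <= s <= sl_hi M b -> sl_lo M b <= t <= sl_hi M b -> W b s = W b t).
  { intros b s t Hs Ht. destruct (MVT_gen (W b) s t (dW b)) as [z [Hz E]].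
    - intros; apply HW.
    - intros x _; apply continuity_pt_filterlim. exact (der_continuous _ _ _ (HW b x)).
    - rewrite HdW in E; [lra|].
      unfold Rmin, Rmax in Hz; destruct (Rle_dec s t); lra. }
  assert (HC : W false 0 * mc M false = W true 0 * mc M true).
  { unfold W; rewrite F1, F2, G1, G2, <- (t_det M); ring. }
  exists (mc M true * W true 0). intros b t Ht.
  transitivity (mc M b * W b t); [unfold W; ring|].
  destruct b.
  - now rewrite (Hc true t 0) by (auto; simpl; lra).
  - rewrite (Hc false t 0) by (auto; simpl; lra). lra.
Qed.

(** Integrating f'' f by parts shows that the integral of f'^2 is zero; this reaches the endpoints,
    where f is known on one side only. *)
Lemma v1_zero (f : c2) a b : a < b -> (forall t, a <= t <= b -> v0 f t = 0) ->
  forall t, a <= t <= b -> v1 f t = 0.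
Proof.
  intros Hab H t Ht. apply Rsqr_0_uniq.
  apply (RInt_nonneg_eq0 (fun t => (v1 f t)²) a b); auto.
  - intro; unfold Rsqr; con.
  - intros; apply Rle_0_sqr.
  - assert (E := RInt_by_parts f f a b).
    assert (E0 : RInt (fun t => v2 f t * v0 f t) a b = RInt (fun _ => 0) a b).
    { apply RInt_ext_Ioo; [lra|intros x Hx]. rewrite H by lra. ring. }
    rewrite E0, RInt_const, (H a), (H b) in E by lra.
    change ((b - a) * 0 = v1 f b * 0 - v1 f a * 0 - RInt (fun t => (v1 f t)²) a b) in E. lra.
Qed.

Definition side (x : R) : bool := if Rlt_dec x 0 then true else false.

Lemma side_in x : two_intervals x -> sl_lo M (side x) <= x <= sl_hi M (side x).
Proof.
  unfold two_intervals, left_part, right_part, side; intros H; destruct (Rlt_dec x 0); simpl; lra.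
Qed.

(** * Real forms of the norms, the series terms and Green's function *)

Lemma RInt_RtoC (y : R -> C) (f : R -> R) a b : a < b -> (forall x, continuous f x) ->
  (forall t, a < t < b -> y t = RtoC (f t)) ->
  RInt (V := C_R_CompleteNormedModule) y a b = RtoC (RInt f a b).
Proof.
  intros Hab Hf Hy. apply (is_RInt_unique (V := C_R_CompleteNormedModule)).
  apply (is_RInt_ext (V := C_R_NormedModule)) with (fun t => RtoC (f t)).
  { intros t Ht; rewrite Rmin_left, Rmax_right in Ht by lra. symmetry; auto. }
  apply (is_RInt_fct_extend_pair (U := R_NormedModule) (V := R_NormedModule) (fun t => RtoC (f t)) a b (RInt f a b) 0).
  - exact (RInt_correct (V := R_CompleteNormedModule) f a b (continuous_ex_RInt f a b Hf)).
  - assert (H := is_RInt_const (V := R_NormedModule) a b 0). simpl.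
    change (scal (b - a) 0) with ((b - a) * 0) in H. now rewrite Rmult_0_r in H.
Qed.

Lemma norm2_real mu F :
  (forall x, left_part x -> phi1 S mu x = RtoC (v0 (F true) x)) ->
  (forall x, right_part x -> phi2 S mu x = RtoC (v0 (F false) x)) ->
  norm2 S mu = RtoC (sg * ip M (val F) (val F)).
Proof.
  intros HL HR. assert (Hpi := PI_RGT_0). unfold norm2.
  rewrite (RInt_RtoC _ (fun t => v0 (F true) t * v0 (F true) t) (- PI) 0).
  2: lra. 2: { intro; con. }
  2: { intros t Ht; unfold phi; destruct (Rlt_dec t 0); [|lra].
       rewrite HL by (unfold left_part; lra). now rewrite RtoC_mult. }
  rewrite (RInt_RtoC _ (fun t => v0 (F false) t * v0 (F false) t) 0 PI).
  2: lra. 2: { intro; con. }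
  2: { intros t Ht; unfold phi; destruct (Rlt_dec t 0); [lra|].
       rewrite HR by (unfold right_part; lra). now rewrite RtoC_mult. }
  rewrite <- !RtoC_mult, <- RtoC_plus. f_equal.
  unfold ip, wt, val; simpl. fold D12 D34.
  assert (Hp1 : p1 P <> 0) by (apply Rgt_not_eq, HP). assert (Hp2 : p2 P <> 0) by (apply Rgt_not_eq, HP).
  assert (Hs := sgn_sq).
  set (I1 := RInt _ (- PI) 0). set (I2 := RInt _ 0 PI).
  transitivity (sg * sg * (D34 / p1 P * I1 + D12 / p2 P * I2)); [rewrite Hs; ring|field; auto].
Qed.

Lemma Csqrt_sq_real (r : R) : (Csqrt (RtoC r) * Csqrt (RtoC r))%C = RtoC r.
Proof.
  unfold Csqrt; rewrite Cmod_R; simpl.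
  destruct (Rlt_dec 0 0) as [H|_]; [lra|].
  assert (H1 := Rle_abs r). assert (H2 := Rle_abs (- r)). rewrite Rabs_Ropp in H2.
  assert (E1 := sqrt_sqrt ((Rabs r + r) / 2) ltac:(lra)).
  assert (E2 := sqrt_sqrt ((Rabs r - r) / 2) ltac:(lra)).
  set (a := sqrt ((Rabs r + r) / 2)) in *. set (b := sqrt ((Rabs r - r) / 2)) in *.
  (* The radicands multiply to (|r|^2 - r^2) / 4 = 0: the root of a real number is real or purely
     imaginary. *)
  assert (E3 : a * b = 0).
  { unfold a, b; rewrite <- sqrt_mult by lra.
    replace ((Rabs r + r) / 2 * ((Rabs r - r) / 2)) with ((Rabs r * Rabs r - r * r) / 4) by field.
    assert (Hr : Rabs r * Rabs r = r * r) by apply (eq_sym (Rsqr_abs r)).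
    rewrite Hr. replace ((r * r - r * r) / 4) with 0 by field. apply sqrt_0. }
  apply injective_projections; simpl.
  - transitivity (a * a - b * b); [ring|]. rewrite E1, E2; field.
  - transitivity (2 * (a * b)); [ring|]. rewrite E3; ring.
Qed.

Lemma phi_side mu F x :
  (forall x, left_part x -> phi1 S mu x = RtoC (v0 (F true) x)) ->
  (forall x, right_part x -> phi2 S mu x = RtoC (v0 (F false) x)) ->
  two_intervals x -> phi S mu x = RtoC (v0 (F (side x)) x).
Proof.
  intros HL HR Hx. unfold phi, side. unfold two_intervals, left_part, right_part in *.
  destruct (Rlt_dec x 0); [apply HL|apply HR]; lra.
Qed.

(** Only the square of the root enters, and it equals sg * N; since sg^2 = 1, its inverse is sg /
    N. *)
Lemma eigen_term_real (lam : nat -> C) (lamr : nat -> R) (F : nat -> bool -> c2) n x xi :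
  lam n = RtoC (lamr n) -> lamr n <> 0 ->
  (forall x, left_part x -> phi1 S (lamr n) x = RtoC (v0 (F n true) x)) ->
  (forall x, right_part x -> phi2 S (lamr n) x = RtoC (v0 (F n false) x)) ->
  0 < ip M (val (F n)) (val (F n)) -> two_intervals x -> two_intervals xi ->
  eigen_term S lam x xi n = RtoC (sg * (/ lamr n *
    (/ sqrt (ip M (val (F n)) (val (F n))) * v0 (F n (side x)) x) *
    (/ sqrt (ip M (val (F n)) (val (F n))) * v0 (F n (side xi)) xi))).
Proof.
  intros El Hl HL HR HN Hx Hxi. unfold eigen_term, normalized_phi. rewrite El.
  rewrite (phi_side _ _ x HL HR Hx), (phi_side _ _ xi HL HR Hxi), (norm2_real _ _ HL HR).
  set (N := ip M (val (F n)) (val (F n))) in *.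
  set (z := Csqrt (RtoC (sg * N))).
  assert (Hz : (z * z)%C = RtoC (sg * N)) by apply Csqrt_sq_real.
  assert (Hs := sgn_sq). assert (Hs0 := sgn_neq0).
  assert (HsN : sg * N <> 0) by (apply Rmult_integral_contrapositive; split; [exact Hs0|lra]).
  assert (Hz0 : z <> 0%C).
  { intro E; rewrite E in Hz. apply HsN, RtoC_inj. rewrite <- Hz. ring. }
  assert (Hn := sqrt_sqrt N ltac:(lra)). assert (Hn0 : sqrt N <> 0) by (apply Rgt_not_eq, sqrt_lt_R0; lra).
  assert (Hlc : RtoC (lamr n) <> 0%C) by (intro E; apply Hl; now apply RtoC_inj).
  transitivity (/ RtoC (lamr n) * (RtoC (v0 (F n (side x)) x) * RtoC (v0 (F n (side xi)) xi)) / (z * z))%C.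
  { field. auto. }
  rewrite Hz, <- RtoC_inv, <- !RtoC_mult, <- RtoC_div by auto. f_equal.
  transitivity (sg * / lamr n * (v0 (F n (side x)) x * v0 (F n (side xi)) xi) / (sqrt N * sqrt N)).
  - rewrite Hn. transitivity (sg * sg * / lamr n * (v0 (F n (side x)) x * v0 (F n (side xi)) xi) / (sg * N)).
    + rewrite Hs; field; repeat split; auto; lra.
    + field; repeat split; auto; lra.
  - field; auto.
Qed.

(** Both denominators Delta_34 omega1 and Delta_12 omega2 equal sg * c, by the constancy of the
    weighted Wronskian. *)
Lemma Green_real F G c x xi : c <> 0 ->
  (forall x, left_part x -> phi1 S 0%C x = RtoC (v0 (F true) x)) ->
  (forall x, right_part x -> phi2 S 0%C x = RtoC (v0 (F false) x)) ->
  (forall x, left_part x -> dphi1 S 0%C x = RtoC (v1 (F true) x)) ->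
  (forall x, right_part x -> dphi2 S 0%C x = RtoC (v1 (F false) x)) ->
  (forall x, left_part x -> chi1 S 0%C x = RtoC (v0 (G true) x)) ->
  (forall x, right_part x -> chi2 S 0%C x = RtoC (v0 (G false) x)) ->
  (forall x, left_part x -> dchi1 S 0%C x = RtoC (v1 (G true) x)) ->
  (forall x, right_part x -> dchi2 S 0%C x = RtoC (v1 (G false) x)) ->
  on_I (fun b t => mc M b * (v0 (F b) t * v1 (G b) t - v1 (F b) t * v0 (G b) t) = c) ->
  two_intervals x -> two_intervals xi ->
  Green S 0%C x xi = RtoC (- sg * gkern F G c (side x) (side xi) x xi).
Proof.
  intros Hc F1 F2 F3 F4 G1 G2 G3 G4 HW Hx Hxi. assert (Hpi := PI_RGT_0).
  assert (Hs := sgn_sq). assert (Hs0 := sgn_neq0).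
  assert (HL : left_part (- PI)) by (unfold left_part; lra).
  assert (HR : right_part PI) by (unfold right_part; lra).
  assert (W1 : (DeltaT P 3 4 * omega1 S 0)%C = RtoC (sg * c)).
  { unfold omega1; rewrite F1, F3, G1, G3 by exact HL.
    rewrite <- !RtoC_mult, <- RtoC_minus, <- RtoC_mult. f_equal.
    rewrite <- (HW true (- PI)) by (simpl; lra). simpl mc. fold D34.
    rewrite <- !Rmult_assoc, Hs; ring. }
  assert (W2 : (DeltaT P 1 2 * omega2 S 0)%C = RtoC (sg * c)).
  { unfold omega2; rewrite F2, F4, G2, G4 by exact HR.
    rewrite <- !RtoC_mult, <- RtoC_minus, <- RtoC_mult. f_equal.
    rewrite <- (HW false PI) by (simpl; lra). simpl mc. fold D12.
    rewrite <- !Rmult_assoc, Hs; ring. }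
  assert (Hsc : sg * c <> 0) by now apply Rmult_integral_contrapositive.
  assert (Hdiv : forall u v : R, (RtoC u * RtoC v / RtoC (sg * c))%C = RtoC (- sg * (- / c * (u * v)))).
  { intros u v. rewrite <- RtoC_mult, <- RtoC_div by exact Hsc. f_equal.
    transitivity (sg * sg * (u * v) / (sg * c)); [rewrite Hs; field; auto|field; auto]. }
  unfold Green, side, gkern. unfold two_intervals, left_part, right_part in *.
  destruct (Rlt_dec x 0) as [Lx|Lx], (Rlt_dec xi 0) as [Lxi|Lxi].
  - rewrite W1. destruct (Rlt_dec xi x).
    + rewrite G1, F1, Rmin_right, Rmax_left by lra. rewrite Hdiv. f_equal; ring.
    + rewrite G1, F1, Rmin_left, Rmax_right by lra. apply Hdiv.
  - rewrite W1, F1, G2 by lra. apply Hdiv.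
  - rewrite W2, G2, F1 by lra. apply Hdiv.
  - rewrite W2. destruct (Rle_dec xi x).
    + rewrite G2, F2, Rmin_right, Rmax_left by lra. rewrite Hdiv. f_equal; ring.
    + rewrite G2, F2, Rmin_left, Rmax_right by lra. apply Hdiv.
Qed.

Lemma sum_n_RtoC (a : nat -> C) (b : nat -> R) (k : R) n : (forall i, a i = RtoC (k * b i)) ->
  sum_n a n = RtoC (k * sum_n b n).
Proof.
  intro H; induction n as [|n IH]; [now rewrite 2!sum_O|].
  rewrite 2!sum_Sn, IH, H. unfold plus; simpl. now rewrite <- RtoC_plus, Rmult_plus_distr_l.
Qed.

(** * The spectrum and the expansion of Green's function *)

Variable lam : nat -> C.
Hypothesis H0 : ~ is_eigenvalue P 0%C.
Hypothesis Hinj : forall m n : nat, lam m = lam n -> m = n.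
Hypothesis Hlam : forall l : C, is_eigenvalue P l <-> exists n : nat, lam n = l.

Lemma lam_real n : lam n = RtoC (Re (lam n)).
Proof.
  destruct (eigenvalue_real (lam n)) as [Him _]; [apply Hlam; now exists n|].
  apply injective_projections; [reflexivity|exact Him].
Qed.

Lemma lam_nonzero n : Re (lam n) <> 0.
Proof.
  intro E; apply H0, Hlam; exists n. now rewrite lam_real, E.
Qed.

Lemma kernel_trivial U : dom M U -> on_I (fun b t => lop M U b t = 0) -> on_I (fun b t => v0 (U b) t = 0).
Proof.
  intros HU HL b t Ht. apply NNPP; intro Hn; apply H0.
  apply (real_eigenvalue U 0 HU); [|now exists b, t].
  intros b' t' Ht'; rewrite HL by exact Ht'; ring.
Qed.

Lemma eigenfunctions : exists F : nat -> bool -> c2, forall n,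
  dom M (F n) /\ on_I (fun b t => lop M (F n) b t = Re (lam n) * v0 (F n b) t) /\
  0 < ip M (val (F n)) (val (F n)) /\
  (forall x, left_part x -> phi1 S (Re (lam n)) x = RtoC (v0 (F n true) x)) /\
  (forall x, right_part x -> phi2 S (Re (lam n)) x = RtoC (v0 (F n false) x)) /\
  (forall U, dom M U -> on_I (fun b t => lop M U b t = Re (lam n) * v0 (U b) t) ->
     exists k, on_I (fun b t => v0 (U b) t = k * v0 (F n b) t)).
Proof.
  enough (H : forall n, exists F, dom M F /\ on_I (fun b t => lop M F b t = Re (lam n) * v0 (F b) t) /\
    0 < ip M (val F) (val F) /\
    (forall x, left_part x -> phi1 S (Re (lam n)) x = RtoC (v0 (F true) x)) /\
    (forall x, right_part x -> phi2 S (Re (lam n)) x = RtoC (v0 (F false) x)) /\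
    (forall U, dom M U -> on_I (fun b t => lop M U b t = Re (lam n) * v0 (U b) t) ->
       exists k, on_I (fun b t => v0 (U b) t = k * v0 (F b) t))).
  (* Countable choice of one real eigenfunction per index. *)
  { exists (fun n => proj1_sig (constructive_indefinite_description _ (H n))).
    intro n; exact (proj2_sig (constructive_indefinite_description _ (H n))). }
  intro n.
  destruct (eigenvalue_real (lam n)) as [_ [U [HU [HL Hn]]]]; [apply Hlam; now exists n|].
  destruct (phi_real (Re (lam n))) as [F [F1 [F2 [F3 [F4 [F5 [F6 _]]]]]]].
  exists F. destruct (phi_eigen U F _ HU HL Hn F1 F2 F3 F4) as [HF HN].
  repeat (split; [assumption|]).
  intros V HV HLV. destruct (phi_multiple V F _ HV HLV F1 F2 F3 F4) as [k Hk].
  exists k; intros b t Ht; now apply Hk.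
Qed.

(** Factors the sign out of Green's function and of the terms, which leaves convergence statements
    about real numbers only. *)
Lemma green_eigen_expansion :
  exists (a : R -> R -> nat -> R) (g : R -> R -> R),
    (forall x xi, two_intervals x -> two_intervals xi -> Green S 0%C x xi = RtoC (- sg * g x xi)) /\
    (forall x xi n, two_intervals x -> two_intervals xi -> eigen_term S lam x xi n = RtoC (sg * a x xi n)) /\
    (forall eps, 0 < eps -> exists N, forall n, (N <= n)%nat -> forall x xi,
       two_intervals x -> two_intervals xi -> Rabs (sum_n (a x xi) n - g x xi) < eps) /\
    (forall eta, 0 < eta -> exists N, forall n n' x xi, (N <= n)%nat ->
       two_intervals x -> two_intervals xi -> sum_n_m (fun i => Rabs (a x xi i)) n n' <= eta).
Proof.
  assert (Hpi := PI_RGT_0).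
  destruct eigenfunctions as [F HF].
  destruct (phi_real 0) as [Ph [A1 [A2 [A3 [A4 [A5 [A6 [A7 A8]]]]]]]].
  destruct (chi_real 0) as [Ch [B1 [B2 [B3 [B4 [B5 [B6 [B7 B8]]]]]]]].
  assert (A1' : on_I (fun b t => lop M Ph b t = 0)) by (intros b t Ht; rewrite A1 by exact Ht; ring).
  assert (B1' : on_I (fun b t => lop M Ch b t = 0)) by (intros b t Ht; rewrite B1 by exact Ht; ring).
  destruct (wronskian_constant Ph Ch A1' B1' A4 B4) as [c Hc].
  (* At PI the Wronskian of phi and chi is the left side of the right boundary condition for phi. If
     it vanished, phi would lie in the kernel of L, hence be zero, against its data (sin alpha, -cos
     alpha) at -PI. *)
  assert (Hc0 : c <> 0).
  { intro E. assert (W := Hc false PI ltac:(simpl; lra)). cbv beta in W. rewrite B2, B3, E in W.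
    assert (Hm : mc M false <> 0) by apply Rgt_not_eq, (mc_pos M).
    apply Rmult_integral in W; destruct W as [W|W]; [easy|].
    assert (HdP : dom M Ph).
    { split; [|split; [|exact A4]]; [unfold bc_left|unfold bc_right]; simpl; [rewrite A2, A3; ring|lra]. }
    assert (Z : forall t, - PI <= t <= 0 -> v0 (Ph true) t = 0) by (intros t Ht; apply (kernel_trivial Ph HdP A1' true t Ht)).
    assert (Z1 := v1_zero (Ph true) (- PI) 0 ltac:(lra) Z (- PI) ltac:(lra)).
    specialize (Z (- PI) ltac:(lra)). rewrite A2 in Z. rewrite A3 in Z1.
    assert (H := sin2_cos2 (alpha P)). unfold Rsqr in H.
    rewrite Z in H. replace (cos (alpha P)) with 0 in H by lra. lra. }
  set (N := fun n => ip M (val (F n)) (val (F n))).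
  assert (HN : forall n, 0 < N n) by (intro n; exact (proj1 (proj2 (proj2 (HF n))))).
  (* A scalar multiple, expressed by [lin] with a zero second coefficient. *)
  set (ev := fun n => lin (/ sqrt (N n)) (F n) 0 (F n)).
  assert (Hev0 : forall n b t, v0 (ev n b) t = / sqrt (N n) * v0 (F n b) t) by (intros; simpl; ring).
  assert (Hsq : forall n, sqrt (N n) <> 0) by (intro n; apply Rgt_not_eq, sqrt_lt_R0, HN).
  set (lamr := fun n => Re (lam n)).
  assert (Hdom : forall n, dom M (ev n)) by (intro n; apply dom_lin; exact (proj1 (HF n))).
  assert (Hlop : forall n b t, sl_lo M b <= t <= sl_hi M b -> lop M (ev n) b t = lamr n * v0 (ev n b) t).
  { intros n b t Ht. unfold ev at 1; rewrite lop_lin, Hev0, (proj1 (proj2 (HF n)) b t Ht). unfold lamr; ring. }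
  assert (Hl0 : forall n, lamr n <> 0) by (intro; apply lam_nonzero).
  assert (Hli : forall i j, lamr i = lamr j -> i = j).
  { intros i j E; apply Hinj; rewrite (lam_real i), (lam_real j). unfold lamr in E; now rewrite E. }
  assert (Hnorm : forall n, ip M (val (ev n)) (val (ev n)) = 1).
  { intro n.
    rewrite (ip_ext M _ _ (fun b t => / (N n) * val (F n) b t + 0 * val (F n) b t) (val (F n))).
    - rewrite ip_lin_l by (intros; apply v0_con). fold (N n). field. apply Rgt_not_eq, HN.
    - intros b t _; unfold val; rewrite Hev0.
      assert (E := sqrt_sqrt (N n) (Rlt_le _ _ (HN n))). rewrite <- E at 3. field. apply Hsq. }
  assert (Hcomp : forall U mu, dom M U -> on_I (fun b t => lop M U b t = mu * v0 (U b) t) ->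
    (exists b t, sl_lo M b <= t <= sl_hi M b /\ v0 (U b) t <> 0) ->
    exists n k, on_I (fun b t => v0 (U b) t = k * v0 (ev n b) t)).
  (* A real eigenfunction has its eigenvalue in the list by [Hlam], and that eigenvalue is
     simple. *)
  { intros U mu HU HL Hn.
    destruct (proj1 (Hlam (RtoC mu)) (real_eigenvalue U mu HU HL Hn)) as [n En].
    assert (Emu : Re (lam n) = mu) by now rewrite En.
    destruct (proj2 (proj2 (proj2 (proj2 (proj2 (HF n))))) U HU) as [k Hk]; [now rewrite Emu|].
    exists n, (k * sqrt (N n)); intros b t Ht; rewrite Hev0, (Hk b t Ht). field; apply Hsq. }
  exists (fun x xi n => / lamr n * v0 (ev n (side x)) x * v0 (ev n (side xi)) xi).
  exists (fun x xi => gkern Ph Ch c (side x) (side xi) x xi).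
  split; [|split; [|split]].
  - intros x xi Hx Hxi; now apply Green_real.
  - intros x xi n Hx Hxi. rewrite 2!Hev0.
    destruct (HF n) as [_ [_ [F3 [F4 [F5 _]]]]].
    apply (eigen_term_real lam lamr F n x xi); auto. apply lam_real.
  - intros eps He.
    destruct (green_expansion M Ph Ch c A1' B1') with (ev := ev) (lam := lamr) (eps := eps) as [N0 HN0]; auto.
    + unfold bc_left; simpl; rewrite A2, A3; ring.
    + unfold bc_right; simpl; rewrite B2, B3; ring.
    + apply kernel_trivial.
    + exists N0; intros n Hn x xi Hx Hxi. apply (HN0 n Hn (side x) (side xi) x xi); now apply side_in.
  - intros eta He.
    destruct (green_expansion_tail M ev lamr Hdom Hlop Hl0 Hli Hnorm eta He) as [N0 HN0].
    exists N0; intros n n' x xi Hn Hx Hxi. apply (HN0 n n' (side x) (side xi) x xi Hn); now apply side_in.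
Qed.

End Bridge.

Theorem theorem3p1 (P : bvtp) (S : basic_solutions P) (lam : nat -> C)
  (HP : admissible P)
  (HDelta : 0 < DeltaT P 1 2 * DeltaT P 3 4)
  (H0 : ~ is_eigenvalue P 0%C)
  (Hinj : forall m n : nat, lam m = lam n -> m = n)
  (Hlam : forall l : C, is_eigenvalue P l <-> exists n : nat, lam n = l) :
  (forall x xi : R, two_intervals x -> two_intervals xi ->
     is_series (eigen_term S lam x xi) (- Green S 0%C x xi)%C) /\
  (forall x xi : R, two_intervals x -> two_intervals xi ->
     ex_series (fun n : nat => Cmod (eigen_term S lam x xi n))) /\
  (forall eps : R, 0 < eps ->
     exists N : nat, forall n : nat, (N <= n)%nat ->
       forall x xi : R, two_intervals x -> two_intervals xi ->
         Cmod (Green S 0%C x xi - - sum_n (eigen_term S lam x xi) n)%C < eps).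
Proof.
  destruct (q_extension P HP) as [qe [Hq [HqL HqR]]].
  destruct (green_eigen_expansion P HP HDelta qe Hq HqL HqR S lam H0 Hinj Hlam)
    as [a [g [HG [Ha [Hlim Htail]]]]].
  set (sg := sgn_delta P) in *.
  assert (Hsg : Rabs sg = 1).
  { unfold sg, sgn_delta; destruct (Rlt_dec 0 (DeltaT P 1 2)); [apply Rabs_R1|].
    rewrite Rabs_left; lra. }
  assert (Hsum : forall x xi n, two_intervals x -> two_intervals xi ->
    sum_n (eigen_term S lam x xi) n = RtoC (sg * sum_n (a x xi) n)).
  { intros x xi n Hx Hxi; apply (sum_n_RtoC _ (a x xi) sg); auto. }
  split; [|split].
  - intros x xi Hx Hxi. rewrite HG, <- RtoC_opp by assumption.
    apply (filterlim_RtoC eventually _ (fun n => sg * sum_n (a x xi) n) (- (- sg * g x xi))).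
    + exists 0%nat; intros n _; now apply Hsum.
    + apply filterlim_locally; intros [eps He].
      destruct (Hlim eps He) as [N HN]; exists N; intros n Hn.
      specialize (HN n Hn x xi Hx Hxi).
      change (Rabs (sg * sum_n (a x xi) n - - (- sg * g x xi)) < eps).
      replace (sg * sum_n (a x xi) n - - (- sg * g x xi)) with (sg * (sum_n (a x xi) n - g x xi)) by ring.
      now rewrite Rabs_mult, Hsg, Rmult_1_l.
  - intros x xi Hx Hxi.
    apply (ex_series_ext (V := R_NormedModule) (fun n => Rabs (a x xi n))).
    { intro n; rewrite Ha, Cmod_R, Rabs_mult, Hsg by assumption. symmetry; apply Rmult_1_l. }
    (* Absolute convergence is the Cauchy criterion for the tails of |a|; the nonstrict tail bound
       is taken at eps / 2. *)
    apply (ex_series_Cauchy (V := R_CompleteNormedModule)); intros [eps He].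
    destruct (Htail (eps / 2)) as [N HN]; [lra|].
    exists N; intros n m Hn Hm. specialize (HN n m x xi Hn Hx Hxi).
    change (Rabs (sum_n_m (fun i => Rabs (a x xi i)) n m) < eps).
    rewrite Rabs_pos_eq; [lra|]. apply sum_n_m_ge0; intro; apply Rabs_pos.
  - intros eps He; destruct (Hlim eps He) as [N HN]; exists N; intros n Hn x xi Hx Hxi.
    rewrite HG, Hsum by assumption.
    replace (RtoC (- sg * g x xi) - - RtoC (sg * sum_n (a x xi) n))%C
      with (RtoC (sg * (sum_n (a x xi) n - g x xi))).
    + rewrite Cmod_R, Rabs_mult, Hsg, Rmult_1_l. now apply HN.
    + apply injective_projections; simpl; ring.
Qed.
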